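(* Let $\Delta\in\mathbb C$ and $\Lambda\in\mathbb Z_+$. With the vectors $a_1,\dots,a_{16}\in M(\Delta,\Lambda)$ defined in the context, a complete list of proper singular vectors inside the $SK(1,4)_+$-module $M(\Delta,\Lambda)$ is given by (with $\alpha,\beta,\gamma\in\mathbb C$): (i) If $2\Delta-\Lambda=0$: (a) $\alpha a_2+\beta a_3$, $(\alpha,\beta)\ne(0,0)$; (b) $\alpha a_8$, $\alpha\neq0$. (ii) If $2\Delta+\Lambda+2=0$ and $\Lambda\ge2$: (a) $\alpha a_4+\beta a_5$, $(\alpha,\beta)\neq(0,0)$; (b) $\alpha a_{11}$, $\alpha\ne0$. (iii) If $2\Delta+\Lambda+2=0$ and $\Lambda=1$: (a) $\alpha a_4+\beta a_5$, $(\alpha,\beta)\neq(0,0)$; (b) $\alpha a_{14}+\beta(a_{15}-2\partial a_5)$, $(\alpha,\beta)\ne(0,0)$; (c) $\alpha(a_{16}-2\partial a_{10})$, $\alpha\ne0$. (iv) If $2\Delta+\Lambda+2=0$ and $\Lambda=0$: (a) $\alpha a_6+\beta a_7+\gamma(a_9-2\partial a_1)$, $(\alpha,\beta,\gamma)\neq(0,0,0)$; (b) $\alpha a_{13}+\beta(a_{12}+2\partial a_2)$, $(\alpha,\beta)\neq(0,0)$.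
   Context: $\mathbb Z_+$ is the set of non-negative integers. Let $\{H,E,F\}$ be the standard basis of $\mathfrak{sl}_2$. Let $\{G^{++},G^{-+}\}$ and $\{G^{+-},G^{--}\}$ be standard bases of two copies of the standard $\mathfrak{sl}_2$-module: $H\cdot G^{+\pm}=G^{+\pm}$, $H\cdot G^{-\pm}=-G^{-\pm}$, $E\cdot G^{+\pm}=F\cdot G^{-\pm}=0$, $F\cdot G^{+\pm}=G^{-\pm}$, $E\cdot G^{-\pm}=G^{+\pm}$. $\mathfrak g=SK(1,4)_+$ (the annihilation algebra of the ''small'' $N=4$ superconformal algebra) is the complex Lie superalgebra with basis: even elements $L_m$ ($m\in\mathbb Z$, $m\ge-1$), $X_n$ ($X=H,E,F$; $n\in\mathbb Z$, $n\ge 0$); odd elements $x_r$ ($x=G^{++},G^{-+},G^{+-},G^{--}$; $r\in\frac12+\mathbb Z$, $r\ge-\frac12$); and brackets $[L_m,L_n]=(m-n)L_{m+n}$, $[L_m,X_n]=-nX_{m+n}$, $[L_m,x_r]=(\frac m2-r)x_{m+r}$, $[X_m,Y_n]=[X,Y]_{m+n}$, $[X_m,y_r]=(X\cdot y)_{m+r}$, $[x_r,x_s]=0$, $[G^{++}_r,G^{+-}_s]=2(r-s)E_{r+s}$, $[G^{++}_r,G^{-+}_s]=0$, $[G^{++}_r,G^{--}_s]=-(r-s)H_{r+s}-2L_{r+s}$, $[G^{+-}_r,G^{-+}_s]=(r-s)H_{r+s}+2L_{r+s}$, $[G^{+-}_r,G^{--}_s]=0$, $[G^{-+}_r,G^{--}_s]=-2(r-s)F_{r+s}$.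 Let $\mathfrak g_j$ be the span of the basis elements with index $j$, so $\mathfrak g=\bigoplus_{j\ge-1}\mathfrak g_j$, $j\in\frac12\mathbb Z$, with $\mathfrak g_0=\mathfrak{sl}_2\oplus\mathbb CL_0$, $\mathfrak{sl}_2=\langle H_0,E_0,F_0\rangle$. Put $\partial=L_{-1}$, $\mathfrak L_0=\bigoplus_{j\ge0}\mathfrak g_j$. For $\Delta\in\mathbb C$, $\Lambda\in\mathbb Z_+$ let $U^{\Delta,\Lambda}$ be the irreducible $\mathfrak{sl}_2$-module of highest weight $\Lambda$ with highest weight vector $v=v_{\Delta,\Lambda}$, on which $L_0$ acts as the scalar $\Delta$ and $\mathfrak g_j$ acts as $0$ for $j>0$. Let $M(\Delta,\Lambda)=U(\mathfrak g)\otimes_{U(\mathfrak L_0)}U^{\Delta,\Lambda}$. A nonzero $(L_0,H_0)$-weight vector (simultaneous eigenvector) $w\in M(\Delta,\Lambda)$ is singular if $E_0w=0$ and $\mathfrak g_jw=0$ for all $j>0$; it is a proper singular vector if moreover it is not a scalar multiple of $v_{\Delta,\Lambda}$. Writing $G^{\pm\pm}$ for $G^{\pm\pm}_{-\frac12}$, the vectors $a_i$ are: $a_1=v$, $a_2=G^{++}v$, $a_3=G^{+-}v$, $a_4=(\Lambda G^{-+}-G^{++}F_0)v$, $a_5=(-\Lambda G^{--}+G^{+-}F_0)v$, $a_6=G^{-+}G^{++}v$, $a_7=G^{+-}G^{--}v$, $a_8=G^{++}G^{+-}v$, $a_9=(G^{-+}G^{+-}-G^{++}G^{--})v$, $a_{10}=(-\Lambda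 G^{++}G^{--}+G^{++}G^{+-}F_0)v$, $a_{11}=\big((\Lambda-1)(-\Lambda G^{-+}G^{--}+G^{-+}G^{+-}F_0+G^{++}G^{--}F_0)-G^{++}G^{+-}F_0^2\big)v$, $a_{12}=G^{-+}G^{++}G^{+-}v$, $a_{13}=G^{++}G^{+-}G^{--}v$, $a_{14}=G^{-+}G^{++}(-\Lambda G^{--}+G^{+-}F_0)v$, $a_{15}=(-\Lambda G^{-+}G^{+-}G^{--}+G^{++}G^{+-}G^{--}F_0)v$, $a_{16}=G^{-+}G^{++}G^{+-}G^{--}v$. *)

(* Defs.v *)
From HB Require Import structures.
From mathcomp Require Import all_boot all_order all_algebra.
From mathcomp Require Import generic_quotient ring_quotient finmap.
From mathcomp Require Import boolp ring.
From mathcomp.multinomials Require Import monalg.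
From mathcomp Require Export reals complex.

Set Implicit Arguments.
Unset Strict Implicit.
Unset Printing Implicit Defensive.

Import GRing.Theory.

Local Open Scope ring_scope.
Local Open Scope quotient_scope.

Section SpanQuotient.
Variables (A : pzRingType) (V : lmodType A) (S : V -> Prop).

Inductive span : V -> Prop :=
| span0 : span 0
| span_cons c s v : S s -> span v -> span (c *: s + v).

Lemma span_gen s : S s -> span s.
Proof. by move=> Ss; rewrite -[s]addr0 -[s]scale1r; apply: span_cons => //; apply: span0. Qed.

Lemma spanD u v : span u -> span v -> span (u + v).
Proof.
elim=> [|c s {}u Ss _ IHu] Sv; first by rewrite add0r.
by rewrite -addrA; apply: span_cons => //; apply: IHu.
Qed.

Lemma spanZ c v : span v -> span (c *: v).
Proof.
elim=> [|d s u Ss _ IHu]; first by rewrite scaler0; apply: span0.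
by rewrite scalerDr scalerA; apply: span_cons.
Qed.

Definition span_pred : {pred V} := fun v => `[< span v >].

Lemma span_predP v : reflect (span v) (v \in span_pred).
Proof. exact: asboolP. Qed.

Lemma span_submod_closed : subsemimod_closed span_pred.
Proof.
split; first split.
- exact/span_predP/span0.
- by move=> u v /span_predP Su /span_predP Sv; apply/span_predP/spanD.
- by move=> c v /span_predP Sv; apply/span_predP/spanZ.
Qed.

HB.instance Definition _ :=
  GRing.isSubmodClosed.Build A V span_pred span_submod_closed.

Definition span_quot := Quotient.quot span_pred.

HB.instance Definition _ := GRing.Zmodule.on span_quot.
HB.instance Definition _ := EqQuotient.on span_quot.

End SpanQuotient.

(* These two operations, and later fa_mul and env_inj, are locked: failing
   conversion tests would otherwise unfold them at a prohibitive cost. *)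
HB.lock Definition span_proj (A : pzRingType) (V : lmodType A) (S : V -> Prop)
    (v : V) : span_quot S := \pi_(span_quot S) v.

HB.lock Definition span_scale (A : pzRingType) (V : lmodType A) (S : V -> Prop)
    (c : A) (x : span_quot S) : span_quot S := span_proj S (c *: repr x).

Section SpanQuotientTheory.
Variables (A : pzRingType) (V : lmodType A) (S : V -> Prop).
Local Notation span := (@span A V S).
Local Notation span_pred := (@span_pred A V S).
Local Notation span_predP := (@span_predP A V S).
Local Notation span_quot := (@span_quot A V S).
Local Notation span_proj := (@span_proj A V S).
Local Notation span_scale := (@span_scale A V S).

Lemma span_projE u v : span_proj u = span_proj v <-> span (u - v).
Proof.
rewrite span_proj.unlock; split=> [/eqP | Suv].
  by rewrite -Quotient.idealrBE => /span_predP.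
by apply/eqP; rewrite -Quotient.idealrBE; apply/span_predP.
Qed.

Lemma span_projK (x : span_quot) : span_proj (repr x) = x.
Proof. by rewrite span_proj.unlock reprK. Qed.

Lemma span_projP (x : span_quot) : exists v, x = span_proj v.
Proof. by exists (repr x); rewrite span_projK. Qed.

Lemma span_proj_zmod_morphism : zmod_morphism span_proj.
Proof. by move=> u v; rewrite span_proj.unlock !piE. Qed.

HB.instance Definition _ :=
  GRing.isZmodMorphism.Build V span_quot span_proj span_proj_zmod_morphism.

Lemma span_proj_scale c v : span_scale c (span_proj v) = span_proj (c *: v).
Proof.
rewrite span_scale.unlock; apply/span_projE; rewrite -scalerBr; apply: spanZ.
by apply/span_projE; rewrite span_projK.
Qed.

Fact span_scaleA a b x : span_scale a (span_scale b x) = span_scale (a * b) x.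
Proof. by case: (span_projP x) => v ->; rewrite !span_proj_scale scalerA. Qed.

Fact span_scale1 : left_id 1 span_scale.
Proof. by move=> x; case: (span_projP x) => v ->; rewrite span_proj_scale scale1r. Qed.

Fact span_scaleDr : right_distributive span_scale +%R.
Proof.
move=> c x y; case: (span_projP x) => u ->; case: (span_projP y) => v ->.
by rewrite -raddfD !span_proj_scale scalerDr raddfD.
Qed.

Fact span_scaleDl x : {morph span_scale^~ x : a b / a + b}.
Proof.
by move=> a b; case: (span_projP x) => v ->; rewrite !span_proj_scale scalerDl raddfD.
Qed.

HB.instance Definition _ := GRing.Zmodule_isLmodule.Build A span_quot
  span_scaleA span_scale1 span_scaleDr span_scaleDl.

Lemma span_proj_scalable : scalable span_proj.
Proof. by move=> c v; rewrite -span_proj_scale. Qed.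

HB.instance Definition _ :=
  GRing.isScalable.Build A V span_quot *:%R span_proj span_proj_scalable.

End SpanQuotientTheory.

Inductive sl2_basis := slH | slE | slF.

Definition sl2_code (x : sl2_basis) : option bool :=
  match x with slH => None | slE => Some true | slF => Some false end.
Definition sl2_decode (c : option bool) : sl2_basis :=
  match c with None => slH | Some true => slE | Some false => slF end.
Lemma sl2_codeK : cancel sl2_code sl2_decode. Proof. by case. Qed.
HB.instance Definition _ := Countable.copy sl2_basis (can_type sl2_codeK).

(* The basis of SK(1,4)_+: [bL n] is L_(n-1), [bX x n] is x_n and
   [bG a b n] is G^{ab}_(n-1/2); the signs a and b are + for [true] and - for [false]. *)
Inductive sk_basis :=
| bL of nat
| bX of sl2_basis & nat
| bG of bool & bool & nat.

Definition sk_code (x : sk_basis) : nat + sl2_basis * nat + bool * bool * nat :=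
  match x with
  | bL n => inl (inl n)
  | bX x n => inl (inr (x, n))
  | bG a b n => inr (a, b, n)
  end.
Definition sk_decode (c : nat + sl2_basis * nat + bool * bool * nat) : sk_basis :=
  match c with
  | inl (inl n) => bL n
  | inl (inr (x, n)) => bX x n
  | inr (a, b, n) => bG a b n
  end.
Lemma sk_codeK : cancel sk_code sk_decode. Proof. by case. Qed.
HB.instance Definition _ := Countable.copy sk_basis (can_type sk_codeK).

Definition sk_index (x : sk_basis) : rat :=
  match x with
  | bL n => n%:R - 1
  | bX _ n => n%:R
  | bG _ _ n => n%:R - 2^-1
  end.

Definition sk_odd (x : sk_basis) : bool := if x is bG _ _ _ then true else false.

Section SK.
Variable K : fieldType.

Local Notation SK := {malg K[sk_basis]}.

Definition sk_gen (x : sk_basis) : SK := << x >>.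

(* Elements with an out-of-range index are 0. *)
Definition eL (m : int) : SK :=
  if m + 1 is Posz n then sk_gen (bL n) else 0.
Definition eX (x : sl2_basis) (m : int) : SK :=
  if m is Posz n then sk_gen (bX x n) else 0.
(* [eG a b k] is G^{ab}_(k-1/2). *)
Definition eG (a b : bool) (k : int) : SK :=
  if k is Posz n then sk_gen (bG a b n) else 0.

(* [x, y]_m, for the bracket of sl_2. *)
Definition sl2_bracket (x y : sl2_basis) (m : int) : SK :=
  match x, y with
  | slH, slE => 2 *: eX slE m
  | slE, slH => - (2 *: eX slE m)
  | slH, slF => - (2 *: eX slF m)
  | slF, slH => 2 *: eX slF m
  | slE, slF => eX slH m
  | slF, slE => - eX slH m
  | _, _ => 0
  end.

(* (x . G^{ab})_(k-1/2), for the standard sl_2-module. *)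
Definition sl2_act (x : sl2_basis) (a b : bool) (k : int) : SK :=
  match x, a with
  | slH, true => eG true b k
  | slH, false => - eG false b k
  | slE, false => eG true b k
  | slF, true => eG false b k
  | _, _ => 0
  end.

(* [G^{a+}_r, G^{c-}_s], where d = r - s and m = r + s. *)
Definition odd_bracket (a c : bool) (d m : int) : SK :=
  match a, c with
  | true, true => (2 * d%:~R) *: eX slE m
  | true, false => - (d%:~R *: eX slH m) - 2 *: eL m
  | false, true => - (d%:~R *: eX slH m) + 2 *: eL m
  | false, false => - ((2 * d%:~R) *: eX slF m)
  end.

Definition sk_bracket (x y : sk_basis) : SK :=
  match x, y with
  | bL i, bL j =>
      let m := i%:Z - 1 in let n := j%:Z - 1 in (m - n)%:~R *: eL (m + n)
  | bL i, bX y n => let m := i%:Z - 1 in - (n%:R *: eX y (m + n%:Z))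
  | bX x n, bL i => let m := i%:Z - 1 in n%:R *: eX x (m + n%:Z)
  | bL i, bG a b k =>
      let m := i%:Z - 1 in (m%:~R / 2 - (k%:R - 2^-1)) *: eG a b (m + k%:Z)
  | bG a b k, bL i =>
      let m := i%:Z - 1 in - ((m%:~R / 2 - (k%:R - 2^-1)) *: eG a b (m + k%:Z))
  | bX x m, bX y n => sl2_bracket x y (m%:Z + n%:Z)
  | bX x m, bG a b k => sl2_act x a b (m%:Z + k%:Z)
  | bG a b k, bX x m => - sl2_act x a b (m%:Z + k%:Z)
  | bG a true k, bG c false l => odd_bracket a c (k%:Z - l%:Z) (k%:Z + l%:Z - 1)
  | bG c false l, bG a true k => odd_bracket a c (k%:Z - l%:Z) (k%:Z + l%:Z - 1)
  | bG _ _ _, bG _ _ _ => 0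
  end.

Definition sk_homog (q : rat) (x : SK) : Prop :=
  forall b, b \in msupp x -> sk_index b = q.

End SK.

Definition free_alg (K : fieldType) := {malg K[{fmonom sk_basis}]}.

HB.instance Definition _ (K : fieldType) := GRing.Lmodule.on (free_alg K).

HB.lock Definition fa_mul (K : fieldType) (x y : free_alg K) : free_alg K :=
  (x : {malg K[{fmonom sk_basis}]}) * y.

Section Enveloping.
Variable K : fieldType.

Local Notation SK := {malg K[sk_basis]}.
Local Notation FA := (free_alg K).
Local Notation MA := {malg K[{fmonom sk_basis}]}.

Definition fa_one : FA := (1 : MA).

Fact fa_mulA : associative (@fa_mul K).
Proof. by move=> x y z; rewrite !fa_mul.unlock; exact: mulrA. Qed.

Fact fa_mul1l : left_id fa_one (@fa_mul K).
Proof. by move=> x; rewrite !fa_mul.unlock; exact: mul1r. Qed.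

Fact fa_mul1r : right_id fa_one (@fa_mul K).
Proof. by move=> x; rewrite !fa_mul.unlock; exact: mulr1. Qed.

Fact fa_mulDl : left_distributive (@fa_mul K) +%R.
Proof. by move=> x y z; rewrite !fa_mul.unlock; exact: mulrDl. Qed.

Fact fa_mulDr : right_distributive (@fa_mul K) +%R.
Proof. by move=> x y z; rewrite !fa_mul.unlock; exact: mulrDr. Qed.

Fact fa_one_neq0 : fa_one != 0.
Proof. exact: oner_neq0. Qed.

HB.instance Definition _ := GRing.Zmodule_isNzRing.Build FA
  fa_mulA fa_mul1l fa_mul1r fa_mulDl fa_mulDr fa_one_neq0.

Fact fa_scalerAl (c : K) (x y : FA) : c *: fa_mul x y = fa_mul (c *: x) y.
Proof. by rewrite !fa_mul.unlock; exact: scalerAl. Qed.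

HB.instance Definition _ := GRing.Lmodule_isLalgebra.Build K FA fa_scalerAl.

Fact malg_scalerC (c : K) (x y : MA) : (c *: x) * y = x * (c *: y).
Proof.
rewrite -[c *: x]mul_malgC -[c *: y]mul_malgC [RHS]mulrA.
apply: (f_equal ( *%R^~ y)).
rewrite [x]monalgE mulr_sumr mulr_suml; apply: eq_bigr => k _.
by rewrite !malgM_def !fgmulUU mulrC mul1m mulm1.
Qed.

Fact fa_scalerAr (c : K) (x y : FA) : c *: fa_mul x y = fa_mul x (c *: y).
Proof. by rewrite fa_scalerAl !fa_mul.unlock; exact: malg_scalerC. Qed.

HB.instance Definition _ := GRing.Lalgebra_isAlgebra.Build K FA fa_scalerAr.

Lemma fa_mulE (x y : FA) : x * y = (x : MA) * (y : MA) :> MA.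
Proof. by rewrite -[LHS]/(fa_mul x y) fa_mul.unlock. Qed.

Definition fa_gen (x : sk_basis) : FA := << fmu x >>.

Definition fa_inj (x : SK) : FA := \sum_(b <- msupp x) x@_b *: fa_gen b.

Definition env_relator (x y : sk_basis) : FA :=
  fa_gen x * fa_gen y - (-1) ^+ (sk_odd x && sk_odd y) * (fa_gen y * fa_gen x)
  - fa_inj (sk_bracket K x y).

Definition env_ideal_gen (t : FA) : Prop :=
  exists a b x y, t = a * env_relator x y * b.

Definition env := span_quot env_ideal_gen.

HB.instance Definition _ := GRing.Lmodule.on env.
HB.instance Definition _ := EqQuotient.on env.

Definition env_proj : FA -> env := @span_proj K FA env_ideal_gen.

HB.instance Definition _ := GRing.Linear.on env_proj.

Local Notation env_ideal := (@span K FA env_ideal_gen).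

Lemma env_idealMl a t : env_ideal t -> env_ideal (a * t).
Proof.
elim=> [|c s v [b [d [x [y ->]]]] _ IH]; first by rewrite mulr0; apply: span0.
rewrite mulrDr -scalerAr; apply: span_cons => //.
by exists (a * b), d, x, y; rewrite !mulrA.
Qed.

Lemma env_idealMr a t : env_ideal t -> env_ideal (t * a).
Proof.
elim=> [|c s v [b [d [x [y ->]]]] _ IH]; first by rewrite mul0r; apply: span0.
rewrite mulrDl -scalerAl; apply: span_cons => //.
by exists b, (d * a), x, y; rewrite mulrA.
Qed.

Lemma env_projE s t : env_proj s = env_proj t <-> env_ideal (s - t).
Proof. exact: span_projE. Qed.

Lemma env_projK (u : env) : env_proj (repr u) = u.
Proof. exact: span_projK. Qed.

Lemma env_projP (u : env) : exists t, u = env_proj t.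
Proof. exact: span_projP. Qed.

Lemma env_projZ c t : env_proj (c *: t) = c *: env_proj t.
Proof. exact: linearZ. Qed.

Definition env_one : env := env_proj 1.
Definition env_mul (u v : env) : env := env_proj (repr u * repr v).

Lemma env_proj_mul s t : env_mul (env_proj s) (env_proj t) = env_proj (s * t).
Proof.
apply/env_projE; set s' := repr _; set t' := repr _.
have -> : s' * t' - s * t = s' * (t' - t) + (s' - s) * t.
  by rewrite mulrBr mulrBl addrA subrK.
by apply: spanD; [apply: env_idealMl | apply: env_idealMr];
   apply/env_projE; rewrite env_projK.
Qed.

Fact env_mulA : associative env_mul.
Proof.
move=> u v w; case: (env_projP u) => x ->; case: (env_projP v) => y ->.
by case: (env_projP w) => z ->; rewrite !env_proj_mul mulrA.
Qed.

Fact env_mul1l : left_id env_one env_mul.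
Proof. by move=> u; case: (env_projP u) => x ->; rewrite env_proj_mul mul1r. Qed.

Fact env_mul1r : right_id env_one env_mul.
Proof. by move=> u; case: (env_projP u) => x ->; rewrite env_proj_mul mulr1. Qed.

Fact env_mulDl : left_distributive env_mul +%R.
Proof.
move=> u v w; case: (env_projP u) => x ->; case: (env_projP v) => y ->.
by case: (env_projP w) => z ->; rewrite -raddfD !env_proj_mul mulrDl raddfD.
Qed.

Fact env_mulDr : right_distributive env_mul +%R.
Proof.
move=> u v w; case: (env_projP u) => x ->; case: (env_projP v) => y ->.
by case: (env_projP w) => z ->; rewrite -raddfD !env_proj_mul mulrDr raddfD.
Qed.

Fact env_one_neq0 : env_one != 0.
Proof.
pose eps := mcoeff (mone : {fmonom sk_basis}) : FA -> K.
have epsM s t : eps (s * t) = eps s * eps t.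
  by rewrite /eps fa_mulE; exact: rmorphM.
have eps_gen x : eps (fa_gen x) = 0 by rewrite /eps mcoeffU1 -val_eqE /= fmU fm1.
have eps_inj x : eps (fa_inj x) = 0.
  rewrite /eps /fa_inj raddf_sum big1 // => b _.
  by rewrite /= mcoeffZ -/(eps _) eps_gen mulr0.
have eps_ideal t : env_ideal t -> eps t = 0.
  elim=> [|c s v [a [b [x [y ->]]]] _ IH]; first exact: raddf0.
  have eps_rel : eps (env_relator x y) = 0.
    by rewrite /eps 2!mcoeffB -!/(eps _) 3!epsM eps_inj !eps_gen !mulr0 !subr0.
  by rewrite /eps mcoeffD mcoeffZ -!/(eps _) 2!epsM IH eps_rel mulr0 mul0r mulr0 addr0.
apply/eqP; rewrite -[0](raddf0 env_proj) => /env_projE; rewrite subr0.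
by move/eps_ideal/eqP; rewrite /eps mcoeff1 eqxx oner_eq0.
Qed.

HB.instance Definition _ := GRing.Zmodule_isNzRing.Build env
  env_mulA env_mul1l env_mul1r env_mulDl env_mulDr env_one_neq0.

Lemma env_proj_monoid_morphism : monoid_morphism env_proj.
Proof. by split=> // s t; rewrite -env_proj_mul. Qed.

HB.instance Definition _ :=
  GRing.isMonoidMorphism.Build FA env env_proj env_proj_monoid_morphism.

Lemma env_projM s t : env_proj (s * t) = env_proj s * env_proj t.
Proof. exact: rmorphM. Qed.

Fact env_scalerAl (c : K) (u v : env) : c *: (u * v) = (c *: u) * v.
Proof.
case: (env_projP u) => x ->; case: (env_projP v) => y ->.
by rewrite -env_projM -env_projZ scalerAl env_projM env_projZ.
Qed.

HB.instance Definition _ := GRing.Lmodule_isLalgebra.Build K env env_scalerAl.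

Fact env_scalerAr (c : K) (u v : env) : c *: (u * v) = u * (c *: v).
Proof.
case: (env_projP u) => x ->; case: (env_projP v) => y ->.
by rewrite -env_projM -env_projZ scalerAr env_projM env_projZ.
Qed.

HB.instance Definition _ := GRing.Lalgebra_isAlgebra.Build K env env_scalerAr.

End Enveloping.

HB.lock Definition env_inj (K : fieldType) (x : {malg K[sk_basis]}) : env K :=
  env_proj (fa_inj x).

Section Induced.
Variables (K : fieldType) (Delta : K) (Lambda : nat).

Local Notation SK := {malg K[sk_basis]}.
Local Notation U := 'rV[K]_Lambda.+1.

(* F^j v, where v is the highest weight vector; this is 0 when j > Lambda. *)
Definition irr_vec (j : nat) : U := \row_i (i == j :> nat)%:R.

Definition irr_img (x : sk_basis) (j : nat) : U :=
  match x with
  | bL 1 => Delta *: irr_vec j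
  | bX slH 0 => (Lambda%:R - 2 * j%:R) *: irr_vec j
  | bX slE 0 => (j%:R * (Lambda%:R - j%:R + 1)) *: irr_vec j.-1
  | bX slF 0 => irr_vec j.+1
  | _ => 0
  end.

(* Meaningful only for the x of non-negative index. *)
Definition irr_act (x : sk_basis) (u : U) : U := \sum_j u 0 j *: irr_img x j.

(* The next lemmas check that this is the irreducible sl_2-module of highest
   weight Lambda. *)
Lemma irr_vec_gt j : (Lambda < j)%N -> irr_vec j = 0.
Proof.
by move=> lt_j; apply/rowP => i; rewrite !mxE ltn_eqF // (leq_trans (ltn_ord i)).
Qed.

Lemma irr_act_vec x j : irr_act x (irr_vec j) = irr_img x j.
Proof.
rewrite /irr_act; case: (ltnP j Lambda.+1) => [lt_j | lt_j].
  rewrite (bigD1 (Ordinal lt_j)) //= mxE eqxx scale1r big1 ?addr0 // => i ne_ij.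
  by rewrite mxE -[_ == j]/(i == Ordinal lt_j) (negPf ne_ij) scale0r.
rewrite irr_vec_gt // big1 => [|i _]; last by rewrite mxE scale0r.
case: x => [[|[|n]] | [] [|n] | //] //=; rewrite ?(irr_vec_gt lt_j) ?scaler0 //.
  case: j lt_j => // j; rewrite ltnS leq_eqVlt => /predU1P[<- | lt_j].
    by rewrite -natr1 opprD addNKr addNr mulr0 scale0r.
  by rewrite irr_vec_gt ?scaler0.
by rewrite irr_vec_gt // leqW.
Qed.

Lemma irr_act_is_linear x : linear (irr_act x).
Proof.
move=> c u w; rewrite /irr_act scaler_sumr -big_split /=; apply: eq_bigr => i _.
by rewrite !mxE scalerDl scalerA.
Qed.

HB.instance Definition _ x :=
  GRing.isLinear.Build K U U *:%R (irr_act x) (irr_act_is_linear x).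

Lemma irr_act0 x : irr_act x 0 = 0. Proof. exact: linear0. Qed.

Lemma irr_actZ x c u : irr_act x (c *: u) = c *: irr_act x u.
Proof. exact: linearZ. Qed.

Lemma irr_actP x c u w : irr_act x (c *: u + w) = c *: irr_act x u + irr_act x w.
Proof. exact: linearP. Qed.

Lemma irr_vec_sum (u : U) : u = \sum_j u 0 j *: irr_vec j.
Proof.
apply/rowP => i; rewrite summxE (bigD1 i) //= !mxE eqxx mulr1 big1 ?addr0 //.
by move=> j ne_ji; rewrite !mxE eq_sym -[_ == _]/(j == i) (negPf ne_ji) mulr0.
Qed.

Lemma irr_ind (W : U -> Prop) :
    W 0 -> (forall c u w, W u -> W w -> W (c *: u + w)) ->
    (forall j, W (irr_vec j)) -> forall u, W u.
Proof.
move=> W0 WD Wv u; rewrite [u]irr_vec_sum.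
elim/big_ind: _ => // [s t Ws Wt | j _]; first by rewrite -[s]scale1r; apply: WD.
by rewrite -[_ *: _]addr0; apply: WD.
Qed.

Local Notation H := (irr_act (bX slH 0)).
Local Notation E := (irr_act (bX slE 0)).
Local Notation F := (irr_act (bX slF 0)).

Lemma irr_HE u : H (E u) - E (H u) = 2 *: E u.
Proof.
elim/irr_ind: u => [|c u w IHu IHw|j]; first by rewrite !irr_act0 subr0 scaler0.
  rewrite !irr_actP scalerDr scalerA mulrC -scalerA -IHu -IHw.
  by rewrite scalerBr opprD addrACA.
rewrite !irr_act_vec /= !irr_actZ !irr_act_vec /= !scalerA -scalerBl.
case: j => [|k] /=; first by rewrite !(mul0r, mulr0) subrr.
by congr (_ *: _); rewrite -natr1; ring.
Qed.

Lemma irr_HF u : H (F u) - F (H u) = - 2 *: F u.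
Proof.
elim/irr_ind: u => [|c u w IHu IHw|j]; first by rewrite !irr_act0 subr0 scaler0.
  rewrite !irr_actP scalerDr scalerA mulrC -scalerA -IHu -IHw.
  by rewrite scalerBr opprD addrACA.
rewrite !irr_act_vec /= !irr_actZ !irr_act_vec /= -scalerBl.
by congr (_ *: _); rewrite -natr1; ring.
Qed.

Lemma irr_EF u : E (F u) - F (E u) = H u.
Proof.
elim/irr_ind: u => [|c u w IHu IHw|j]; first by rewrite !irr_act0 subr0.
  by rewrite !irr_actP -IHu -IHw scalerBr opprD addrACA.
rewrite !irr_act_vec /= !irr_actZ !irr_act_vec /=.
case: j => [|k] /=; first by rewrite !mul0r scale0r subr0; congr (_ *: _); ring.
by rewrite -scalerBl; congr (_ *: _); rewrite -!natr1; ring.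
Qed.

Lemma irr_simple (W : U -> Prop) :
    [pchar K] =i pred0 -> W 0 ->
    (forall c u w, W u -> W w -> W (c *: u + w)) ->
    (forall u, W u -> W (E u)) -> (forall u, W u -> W (F u)) ->
  (exists2 u, W u & u != 0) -> forall u, W u.
Proof.
move=> K0 W0 WD WE WF [u Wu nz_u] w.
have WZ c t : W t -> W (c *: t) by move=> Wt; rewrite -[_ *: _]addr0; apply: WD.
suff Wv j : W (irr_vec j).
  exact: irr_ind.
suff Wv0 : W (irr_vec 0).
  by elim: j => // j /WF; rewrite irr_act_vec.
have {j} [n] : exists n, forall i : 'I_Lambda.+1, (n <= i)%N -> u 0 i = 0.
  by exists Lambda.+1 => i; rewrite leqNgt ltn_ord.
elim: n u Wu nz_u => [|n IH] u Wu nz_u u_n.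
  by case/negP: nz_u; apply/eqP/rowP => i; rewrite mxE u_n.
have [lt_n|ge_n] := ltnP n Lambda.+1; last first.
  by apply: (IH u) => // i le_n; move: (leq_trans ge_n le_n); rewrite leqNgt ltn_ord.
have [u_n0|nz_un] := eqVneq (u 0 (Ordinal lt_n)) 0.
  apply: (IH u) => // i; rewrite leq_eqVlt => /predU1P[n_i | ]; last exact: u_n.
  by rewrite -[RHS]u_n0; congr (u 0 _); apply: val_inj.
have /pcharf0P natr_eq0 := K0.
case: n IH u_n lt_n nz_un => [|n] IH u_n lt_n nz_un.
  suff -> : irr_vec 0 = (u 0 (Ordinal lt_n))^-1 *: u by apply: WZ.
  apply/rowP => i; rewrite !mxE; case: (posnP i) => [i0 | i_gt0].
    by rewrite (_ : i = Ordinal lt_n) ?mulVf ?eqxx //; apply: val_inj.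
  by rewrite (u_n i) // mulr0.
have Eu i : E u 0 i = \sum_(j : 'I_Lambda.+1)
    u 0 j * (j%:R * (Lambda%:R - j%:R + 1)) * (i == j.-1 :> nat)%:R.
  by rewrite /irr_act summxE; apply: eq_bigr => j _; rewrite !mxE mulrA.
apply: (IH (E u) (WE _ Wu)).
  apply/eqP => /rowP/(_ (Ordinal (ltnW lt_n))); rewrite Eu mxE.
  rewrite (bigD1 (Ordinal lt_n)) //= eqxx mulr1 big1 => [|j ne_j]; last first.
    case: (posnP j) => [-> | j_gt0]; first by rewrite mul0r mulr0 mul0r.
    rewrite (_ : (n == j.-1) = false) ?mulr0 //; apply: contraNF ne_j => /eqP n_j.
    by apply/eqP/val_inj; rewrite /= n_j prednK.
  move/eqP; rewrite addr0 !mulf_eq0 (negPf nz_un) natr_eq0 /=.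
  have le_n : (n.+1 <= Lambda)%N by [].
  by rewrite -natrB // natr1 natr_eq0.
move=> i le_n; rewrite Eu big1 // => j _.
have [le_j|lt_j] := leqP j n.+1; last by rewrite (u_n j) // !mul0r.
case: (posnP j) => [-> | j_gt0]; first by rewrite mul0r mulr0 mul0r.
have [ij|] := eqVneq (i : nat) j.-1; last by rewrite mulr0.
by move: le_n; rewrite ij -ltnS prednK // ltnNge le_j.
Qed.

(* U(g) ⊗_C U is realized as the free U(g)-module on the basis (F^j v)_j of
   U, that is, as row vectors over U(g); [one_tensor u] is 1 ⊗ u. *)
Definition one_tensor (u : U) : 'rV[env K]_Lambda.+1 := map_mx (in_alg (env K)) u.

(* The relations y ⊗ u = 1 ⊗ y u that turn U(g) ⊗_C U into the tensor product
   over U(g_(>=0)), where g_(>=0) is spanned by the elements of non-negative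
   index. It is enough to impose them for y in a basis of g_(>=0), since these
   elements generate U(g_(>=0)). *)
Definition balance_gen (t : 'rV[env K]_Lambda.+1) : Prop :=
  exists x u, 0 <= sk_index x /\
    t = env_inj (sk_gen K x) *: one_tensor u - one_tensor (irr_act x u).

Definition indM := span_quot balance_gen.

HB.instance Definition _ := GRing.Lmodule.on indM.
HB.instance Definition _ := EqQuotient.on indM.

Definition tensor (a : env K) (u : U) : indM := span_proj balance_gen (a *: one_tensor u).

Definition hwv : indM := tensor 1 (irr_vec 0).

Definition cscale (c : K) (w : indM) : indM := c%:A *: w.

Definition weight_vector (w : indM) : Prop :=
  w != 0 /\
  exists a b : K, env_inj (eL K 0) *: w = cscale a w /\
                  env_inj (eX K slH 0) *: w = cscale b w.

Definition singular (w : indM) : Prop :=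
  [/\ weight_vector w,
      env_inj (eX K slE 0) *: w = 0 &
      forall (j : rat) (x : SK), 0 < j -> sk_homog j x -> env_inj x *: w = 0].

Definition proper_singular (w : indM) : Prop :=
  singular w /\ ~ exists c : K, w = cscale c hwv.

Definition partial : env K := env_inj (eL K (-1)).

Local Notation v := hwv.
Local Notation Gpp := (env_inj (eG K true true 0)).
Local Notation Gmp := (env_inj (eG K false true 0)).
Local Notation Gpm := (env_inj (eG K true false 0)).
Local Notation Gmm := (env_inj (eG K false false 0)).
Local Notation F0 := (env_inj (eX K slF 0)).
Local Notation La := (Lambda%:R : env K).

Definition a1 : indM := v.
Definition a2 : indM := Gpp *: v.
Definition a3 : indM := Gpm *: v.
Definition a4 : indM := (La * Gmp - Gpp * F0) *: v.
Definition a5 : indM := (- (La * Gmm) + Gpm * F0) *: v.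
Definition a6 : indM := (Gmp * Gpp) *: v.
Definition a7 : indM := (Gpm * Gmm) *: v.
Definition a8 : indM := (Gpp * Gpm) *: v.
Definition a9 : indM := (Gmp * Gpm - Gpp * Gmm) *: v.
Definition a10 : indM := (- (La * Gpp * Gmm) + Gpp * Gpm * F0) *: v.
Definition a11 : indM :=
  ((La - 1) * (- (La * Gmp * Gmm) + Gmp * Gpm * F0 + Gpp * Gmm * F0)
   - Gpp * Gpm * F0 ^+ 2) *: v.
Definition a12 : indM := (Gmp * Gpp * Gpm) *: v.
Definition a13 : indM := (Gpp * Gpm * Gmm) *: v.
Definition a14 : indM := (Gmp * Gpp * (- (La * Gmm) + Gpm * F0)) *: v.
Definition a15 : indM := (- (La * Gmp * Gpm * Gmm) + Gpp * Gpm * Gmm * F0) *: v.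
Definition a16 : indM := (Gmp * Gpp * Gpm * Gmm) *: v.

End Induced.

(* Main.v *)
Require Import Defs.
From HB Require Import structures.
From Stdlib Require Import ZArith Lia Ring_polynom InitialRing.
From mathcomp Require Import all_boot all_order all_algebra finmap.
From mathcomp Require Import boolp ring.
From mathcomp Require Import reals complex.
From mathcomp.multinomials Require Import monalg.

(** The negative part of the algebra is spanned by ∂ = L_(-1) and the four odd
    letters G^(-+), G^(++), G^(+-), G^(--) of index -1/2, so M(Delta, Lambda)
    should have the basis ∂^k S F^j v, where S is one of the sixteen ordered
    products of distinct letters. In coordinates with respect to this basis
    every generator of the algebra is a difference operator: it shifts k and j,
    changes S, and multiplies by polynomials in k, j, Delta and Lambda. Since
    the mode n of a current only enters through the power of d/d∂ and through
    polynomial coefficients, one formula covers a whole family L_n, X_n or G_r.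

    Such operators are data (current_op), and they obey the brackets of the algebra
    because the normal forms agree for formal m and n (current_bracket).
    This gives a representation on coordinate functions (rho_bracket), hence a
    map Phi from the induced module to functions (Phi_gen). The vectors
    ∂^k S F^j v span M(Delta, Lambda) by the usual reordering argument
    (indM_spanned), and Phi sends them to nonzero multiples of distinct delta
    functions (Phi_bas); therefore Phi is injective (Phi_inj), and every question
    about M(Delta, Lambda) becomes a computation with coordinates.

    A weight vector has its coordinates on a single line: 2k + |S| = N and
    2j - wt(S) = J are fixed, so it is given by sixteen scalars x_S
    (weight_graded). If it is singular, it is killed by E_0, by the four
    G_(1/2), and by the diagonal operator H_1 + (d/dG^(++)) G^(++)_(1/2) -
    (d/dG^(-+)) G^(-+)_(1/2), which multiplies x_S by Lambda - 2j + (weight of the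
    G^(+-), G^(--) part of S) and lowers k by one (kills_DH). These equations are
    solved for each N: for odd N >= 5 there is no solution (odd_large), for even
    N >= 4 only N = 4 and Lambda = 1 (even_large), and N = 1, 2, 3 give the
    remaining families (degree1, degree2, degree3); N = 0 is the highest weight
    vector (degree0).

    Conversely E_0, F_1, G^(-+)_(1/2) and G^(--)_(1/2) generate all
    elements of positive index (positive_annihilates), so that the singularity of
    each listed vector is again a finite check on sixteen coordinates
    (homogeneous_singular). *)

Set Implicit Arguments.
Unset Strict Implicit.
Unset Printing Implicit Defensive.

Import Order.TTheory GRing.Theory Num.Theory.
Local Open Scope ring_scope.
Delimit Scope Z_scope with ZZ.

(** * Polynomial coefficients *)

(** The coefficients of the operators are polynomials over Z in the coordinates
    k and j, two formal modes m and n, d = 2 Delta and L = Lambda. They are kept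
    as syntax, so that identities between operators can be decided by comparing
    the normal forms of ring reflection. *)
Inductive var := Vk | Vj | Vm | Vn | Vd | VL.

Inductive expr :=
| Cst of Z
| Var of var
| Add of expr & expr
| Mul of expr & expr.

Declare Scope expr_scope.
Delimit Scope expr_scope with X.
Bind Scope expr_scope with expr.
Notation "x + y" := (Add x y) : expr_scope.
Notation "x * y" := (Mul x y) : expr_scope.
Notation "- x" := (Mul (Cst (-1)%ZZ) x) : expr_scope.
Notation "x - y" := (Add x (Mul (Cst (-1)%ZZ) y)) : expr_scope.
Notation "1" := (Cst 1%ZZ) : expr_scope.
Notation "2" := (Cst 2%ZZ) : expr_scope.

Fixpoint esubst (s : var -> expr) (e : expr) : expr :=
  match e with
  | Cst c => Cst c
  | Var v => s v
  | Add e1 e2 => Add (esubst s e1) (esubst s e2)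
  | Mul e1 e2 => Mul (esubst s e1) (esubst s e2)
  end.

Definition var_pos (v : var) : positive :=
  match v with Vk => 1 | Vj => 2 | Vm => 3 | Vn => 4 | Vd => 5 | VL => 6 end%positive.

Fixpoint expr_pe (e : expr) : PExpr Z :=
  match e with
  | Cst c => PEc c
  | Var v => PEX Z (var_pos v)
  | Add e1 e2 => PEadd (expr_pe e1) (expr_pe e2)
  | Mul e1 e2 => PEmul (expr_pe e1) (expr_pe e2)
  end.

Definition Znorm : PExpr Z -> Pol Z :=
  norm_subst 0%ZZ 1%ZZ Z.add Z.mul Z.sub Z.opp Z.eqb Z.quotrem 0 nil.

Definition expr_zero (e : expr) : bool :=
  Ring_polynom.Peq Z.eqb (Znorm (expr_pe e)) (Znorm (PEc 0%ZZ)).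

Section ExprEval.
Variable K : numFieldType.

(** Phrased through gen_phiZ because the correctness theorem of ring reflection is
    available for this form of the map from Z. *)
Definition zr : Z -> K := gen_phiZ 0 1 +%R *%R -%R.

Let K_eq := Eqsth K.
Let K_ext : ring_eq_ext +%R *%R -%R (@eq K) := Eq_ext _ _ _.

Lemma pzring_theory :
  ring_theory 0 1 +%R *%R (fun x y => x - y) -%R (@eq K).
Proof.
constructor; first [exact: add0r | exact: addrC | exact: addrA | exact: mul1r
  | exact: mulrC | exact: mulrA | exact: mulrDl | exact: subrr | by []].
Qed.

Let zr_morph := gen_phiZ_morph K_eq K_ext pzring_theory.

Lemma zrD a b : zr (a + b)%ZZ = zr a + zr b. Proof. exact: (morph_add zr_morph). Qed.
Lemma zrM a b : zr (a * b)%ZZ = zr a * zr b. Proof. exact: (morph_mul zr_morph). Qed.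
Lemma zrN a : zr (- a)%ZZ = - zr a. Proof. exact: (morph_opp zr_morph). Qed.
Lemma zrB a b : zr (a - b)%ZZ = zr a - zr b. Proof. exact: (morph_sub zr_morph). Qed.

Lemma zr_nat n : zr (Z.of_nat n) = n%:R.
Proof. by elim: n => // n IHn; rewrite Nat2Z.inj_succ -Z.add_1_r zrD IHn -natr1. Qed.

Variable r : var -> K.

Fixpoint ev (e : expr) : K :=
  match e with
  | Cst c => zr c
  | Var v => r v
  | Add e1 e2 => ev e1 + ev e2
  | Mul e1 e2 => ev e1 * ev e2
  end.

Let env := [:: r Vk; r Vj; r Vm; r Vn; r Vd; r VL].
Let peval := PEeval 0 1 +%R *%R (fun x y => x - y) -%R zr id_phi_N
                    (pow_N 1 *%R) env.

Lemma expr_peE e : ev e = peval (expr_pe e).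
Proof. by elim: e => //= [[]|e1 -> e2 ->|e1 -> e2 ->]. Qed.

Lemma expr_zeroE e : expr_zero e -> ev e = 0.
Proof.
move=> e0; rewrite expr_peE -[RHS]/(peval (PEc 0%ZZ)).
exact: (ring_correct K_eq K_ext (Rth_ARth K_eq K_ext pzring_theory) zr_morph
  (pow_N_th _ _ K_eq) (Ztriv_div_th K_eq zr) 0%N env nil _ _ I e0).
Qed.

End ExprEval.

Lemma ev_subst (K : numFieldType) (r r' : var -> K) s e :
  (forall v, ev r (s v) = r' v) -> ev r (esubst s e) = ev r' e.
Proof. by move=> rs; elim: e => //= e1 -> e2 ->. Qed.

(** * Difference operators as data *)

(** Which of the letters G^(-+), G^(++), G^(+-), G^(--) of index -1/2 occur in a
    product, in this order. *)
Definition state := (bool * bool * bool * bool)%type.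

(** The integer a m + b n + c, by which a mode-dependent operator shifts k. *)
Record lin := Lin { lin_m : Z; lin_n : Z; lin_c : Z }.

Definition lin_add (l l' : lin) : lin :=
  Lin (lin_m l + lin_m l')%ZZ (lin_n l + lin_n l')%ZZ (lin_c l + lin_c l')%ZZ.
Definition lin_scale (a : Z) (l : lin) : lin :=
  Lin (a * lin_m l)%ZZ (a * lin_n l)%ZZ (a * lin_c l)%ZZ.
Definition lin_cst (c : Z) : lin := Lin 0 0 c.
Definition lin_eq (l l' : lin) : bool :=
  [&& (lin_m l =? lin_m l')%ZZ, (lin_n l =? lin_n l')%ZZ & (lin_c l =? lin_c l')%ZZ].
Definition lin_expr (l : lin) : expr :=
  (Cst (lin_m l) * Var Vm + (Cst (lin_n l) * Var Vn + Cst (lin_c l)))%X.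

(** Operators act on functions of (S, k, j) and are stored by rows: a term t of
    A S contributes coef t * f (src t) (k + kshift t) (j + jshift t) to the value
    of A f at (S, k, j). *)
Record term := Term { coef : expr; src : state; kshift : lin; jshift : Z }.
Definition op := state -> seq term.

Definition shift_sub (l : lin) (u : Z) (v : var) : expr :=
  match v with
  | Vk => (Var Vk + lin_expr l)%X
  | Vj => (Var Vj + Cst u)%X
  | v => Var v
  end.

(** In a product, the row of B is read at the point to which A has moved, whence
    the substitution of the shifted coordinates. *)
Definition opmul (A B : op) : op := fun S =>
  flatten [seq [seq Term (coef a * esubst (shift_sub (kshift a) (jshift a)) (coef b))%X
                     (src b) (lin_add (kshift a) (kshift b))
                     (jshift a + jshift b)%ZZ | b <- B (src a)] | a <- A S].
Definition opadd (A B : op) : op := fun S => A S ++ B S.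
Definition opscale (c : expr) (A : op) : op := fun S =>
  [seq Term (c * coef a)%X (src a) (kshift a) (jshift a) | a <- A S].

Definition mode_sub (l : lin) (v : var) : expr :=
  match v with Vn => lin_expr l | Vm => Cst 0 | v => Var v end.
Definition at_mode (l : lin) (A : op) : op := fun S =>
  [seq Term (esubst (mode_sub l) (coef a)) (src a)
     (lin_add (lin_cst (lin_c (kshift a))) (lin_scale (lin_n (kshift a)) l))
     (jshift a) | a <- A S].

Definition same_key (t u : term) : bool :=
  [&& src t == src u, lin_eq (kshift t) (kshift u) & (jshift t =? jshift u)%ZZ].

(** Terms with the same source and shifts are collected, and each collected
    coefficient has to vanish; the fuel is any bound on the number of terms. *)
Fixpoint terms_zero (fuel : nat) (l : seq term) : bool :=
  match fuel, l with
  | _, [::] => true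
  | 0, _ => false
  | n.+1, t :: _ =>
      expr_zero (foldr (fun u e => coef u + e)%X (Cst 0) (filter (same_key t) l)) &&
      terms_zero n (filter (predC (same_key t)) l)
  end.

Definition states : seq state :=
  let bs := [:: false; true] in
  allpairs pair (allpairs pair (allpairs pair bs bs) bs) bs.

Lemma mem_states S : S \in states.
Proof. by case: S => [[[[] []] []] []]. Qed.

Definition op_zero (A : op) : bool := all (fun S => terms_zero (size (A S)) (A S)) states.

Declare Scope op_scope.
Delimit Scope op_scope with OP.
Bind Scope op_scope with op.
Notation "A * B" := (opmul A B) : op_scope.
Notation "A + B" := (opadd A B) : op_scope.
Notation "c *: A" := (opscale c%X A) : op_scope.
Notation "A - B" := (opadd A (opscale (Cst (-1)%ZZ) B)) : op_scope.
Notation "- A" := (opscale (Cst (-1)%ZZ) A) : op_scope.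

Definition op_eq (A B : op) := op_zero (A - B).

Section OpEval.
Variables (K : numFieldType) (d : K) (Lam : nat).

(** A value f S k j stands for the coordinate at ∂^k/k! S m_j, where m_j is F^j v
    divided by Lambda (Lambda-1) ... (Lambda-j+1). With these denominators E, F
    and d/d∂ have polynomial coefficients. The coordinates k and j range over
    all of Z, so that shifting never needs a side condition. *)
Definition model := state -> Z -> Z -> K.

Definition valuation (m n k j : Z) (v : var) : K :=
  match v with
  | Vk => zr K k | Vj => zr K j | Vm => zr K m | Vn => zr K n | Vd => d | VL => Lam%:R
  end.

Variables m n : Z.

Definition lval (l : lin) : Z := (lin_m l * m + lin_n l * n + lin_c l)%ZZ.

Definition apply_term (f : model) (k j : Z) (t : term) : K :=
  ev (valuation m n k j) (coef t)
  * f (src t) (k + lval (kshift t))%ZZ (j + jshift t)%ZZ.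

Definition apply_terms (f : model) (k j : Z) (l : seq term) : K :=
  foldr (fun t a => apply_term f k j t + a) 0 l.

Definition apply_op (A : op) (f : model) : model := fun S k j => apply_terms f k j (A S).

Lemma lin_exprE k j l : ev (valuation m n k j) (lin_expr l) = zr K (lval l).
Proof. by rewrite /= /lval !zrD !zrM addrA. Qed.

Lemma lval_add l l' : lval (lin_add l l') = (lval l + lval l')%ZZ.
Proof. by rewrite /lval /=; lia. Qed.

Lemma eval_terms_cat f k j l l' :
  apply_terms f k j (l ++ l') = apply_terms f k j l + apply_terms f k j l'.
Proof. by elim: l => [|t l /= ->]; rewrite ?add0r ?addrA. Qed.

Lemma apply_opD A B f S k j : apply_op (A + B)%OP f S k j = apply_op A f S k j + apply_op B f S k j.
Proof. exact: eval_terms_cat. Qed.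

Lemma apply_opZ c A f S k j :
  apply_op (c *: A)%OP f S k j = ev (valuation m n k j) c * apply_op A f S k j.
Proof.
rewrite /apply_op /opscale; elim: (A S) => [|t l IHl] /=; first by rewrite mulr0.
by rewrite IHl mulrDr mulrA.
Qed.

Lemma apply_opN A f S k j : apply_op (- A)%OP f S k j = - apply_op A f S k j.
Proof. by rewrite apply_opZ mulN1r. Qed.

Lemma apply_opM A B f : apply_op (A * B)%OP f = apply_op A (apply_op B f).
Proof.
apply/funext=> S; apply/funext=> k; apply/funext=> j; rewrite /apply_op /opmul.
elim: (A S) => //= a l IHl; rewrite eval_terms_cat IHl; congr (_ + _).
rewrite /apply_term; elim: (B (src a)) => [|b l' IHl'] /=; first by rewrite mulr0.
rewrite IHl' mulrDr; congr (_ + _); rewrite /apply_term /= lval_add !Z.add_assoc mulrA.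
congr (_ * _ * _); by apply: ev_subst => -[] //=; rewrite /lval !zrD ?zrM ?addrA.
Qed.

(** Induction on the fuel: the terms with the key of the first one add up to a
    polynomial multiple of a single value of f. *)
Lemma terms_zeroE fuel l f k j : terms_zero fuel l -> apply_terms f k j l = 0.
Proof.
have split_terms (p : pred term) l' : apply_terms f k j l' =
    apply_terms f k j (filter p l') + apply_terms f k j (filter (predC p) l').
  elim: l' => [|u l' IHl] /=; first by rewrite addr0.
  by case: (p u); rewrite /= IHl; ring.
elim: fuel l => [|fuel IH] [|t l] // /andP[].
rewrite (split_terms (same_key t)).
move=> /(@expr_zeroE K (valuation m n k j)) e0 /IH ->; rewrite addr0.
suff -> : apply_terms f k j (filter (same_key t) (t :: l)) =
    ev (valuation m n k j)
       (foldr (fun u e => coef u + e)%X (Cst 0) (filter (same_key t) (t :: l)))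
    * f (src t) (k + lval (kshift t))%ZZ (j + jshift t)%ZZ by rewrite e0 mul0r.
elim: {e0} (t :: l) => [|u l' IHl] /=; first by rewrite mul0r.
case: ifP => //= /and3P[/eqP eqS /and3P[/Z.eqb_spec em /Z.eqb_spec en /Z.eqb_spec ec]].
by move=> /Z.eqb_spec ej; rewrite IHl mulrDl /apply_term /lval -em -en -ec -ej -eqS.
Qed.

Lemma op_eqE A B f : op_eq A B -> apply_op A f = apply_op B f.
Proof.
move=> /allP AB; apply/funext=> S; apply/funext=> k; apply/funext=> j.
have /AB/terms_zeroE E := mem_states S; have {E} := E f k j.
by rewrite -[apply_terms _ _ _ _]/(apply_op (A - B)%OP f S k j) apply_opD apply_opN => /subr0_eq.
Qed.

End OpEval.

Lemma apply_at_mode (K : numFieldType) (d : K) Lam m n l A f :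
  apply_op d Lam m n (at_mode l A) f = apply_op d Lam 0 (lval m n l) A f.
Proof.
apply/funext=> S; apply/funext=> k; apply/funext=> j.
rewrite /apply_op /at_mode; elim: (A S) => //= t s ->; congr (_ + _).
rewrite /apply_term /=; congr (_ * f _ _ _); last by rewrite /lval /=; lia.
by apply: ev_subst => -[] //; rewrite lin_exprE.
Qed.

(** * The operators of the currents *)
Definition l0 : lin := lin_cst 0.
Definition op0 : op := fun=> [::].
Definition op1 : op := fun S => [:: Term 1 S l0 0].
(** With respect to ∂^k/k!, the derivative in ∂ only shifts k, and opS, the
    multiplication by ∂, takes k as a factor. *)
Definition opD (l : lin) : op := fun S => [:: Term 1 S l 0].
Definition opS : op := fun S => [:: Term (Var Vk) S (lin_cst (-1)) 0].
Definition opE : op := fun S => [:: Term (Var Vj + 1) S l0 1].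
Definition opF : op := fun S => [:: Term (Var VL - Var Vj + 1) S l0 (-1)].
Definition opH : op := fun S => [:: Term (Var VL - 2 * Var Vj) S l0 0].

(** The letters G^(-+), G^(++), G^(+-), G^(--), generating an exterior algebra on
    which lmul and lder multiply and differentiate. The prefix Th stands for the first two,
    Et for the last two, and the last character is the sl_2-weight. *)
Inductive letter := Thm | Thp | Etp | Etm.

Definition occurs (i : letter) (S : state) : bool :=
  let: (a, b, c, d) := S in
  match i with Thm => a | Thp => b | Etp => c | Etm => d end.

Definition toggle (i : letter) (S : state) : state :=
  let: (a, b, c, d) := S in
  match i with
  | Thm => (~~ a, b, c, d) | Thp => (a, ~~ b, c, d)
  | Etp => (a, b, ~~ c, d) | Etm => (a, b, c, ~~ d)
  end.

Definition letter_sign (i : letter) (S : state) : expr :=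
  let: (a, b, c, d) := S in
  let odd := match i with
             | Thm => false | Thp => a | Etp => a (+) b | Etm => a (+) b (+) c end in
  if odd then Cst (-1) else 1%X.

Definition lmul (i : letter) : op := fun S =>
  if occurs i S then [:: Term (letter_sign i S) (toggle i S) l0 0] else [::].
Definition lder (i : letter) : op := fun S =>
  if occurs i S then [::] else [:: Term (letter_sign i S) (toggle i S) l0 0].

Section Currents.
Local Open Scope op_scope.

(** The Eta-operators are the action of sl_2 on the products of G^(+-) and G^(--),
    tensored with U, the Th-operators that on the products of G^(-+) and G^(++). *)
Definition EtaE := opE + lmul Etp * lder Etm.
Definition EtaF := opF + lmul Etm * lder Etp.
Definition EtaH := opH + lmul Etp * lder Etp - lmul Etm * lder Etm.
Definition EtaN := lmul Etp * lder Etp + lmul Etm * lder Etm.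
Definition ThE := lmul Thp * lder Thm.
Definition ThF := lmul Thm * lder Thp.
Definition ThH := lmul Thp * lder Thp - lmul Thm * lder Thm.
Definition ThN := lmul Thp * lder Thp + lmul Thm * lder Thm.
Definition opd : op := Var Vd *: op1.

(** The index 1/2 elements G^(++), G^(-+), G^(+-), G^(--), in this order, acting on
    the vectors without ∂, the derivative in a letter standing for the contraction
    of this letter by a bracket. *)
Definition Rp := 2 *: (opE * lder Etp) - (opH + opd) * lder Etm
  - 2 *: (lmul Etp * lder Etp * lder Etm).
Definition Rm := (opd - opH) * lder Etp - 2 *: (opF * lder Etm)
  - 2 *: (lmul Etm * lder Etp * lder Etm).
Definition Tp := (EtaH + EtaN + opd) * lder Thm - 2 *: (EtaE * lder Thp)
  + 2 *: (lmul Thp * lder Thp * lder Thm).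
Definition Tm := (EtaH - EtaN - opd) * lder Thp + 2 *: (EtaF * lder Thm)
  + 2 *: (lmul Thm * lder Thp * lder Thm).

(** From [x_n, ∂] = n x_(n-1) follows
    x_n p(∂) = sum_i n(n-1)...(n-i+1) (D^(n-i) p)(∂) x_i / i!, where D is the
    derivative. Dn i A is the summand with x_i / i! = A, and it is zero for i > 2
    in all cases of interest. *)
Definition Dn (i : nat) (A : op) : op :=
  match i with
  | 0 => opD (Lin 0 1 0) * A
  | 1 => Var Vn *: (opD (Lin 0 1 (-1)) * A)
  | _ => (Var Vn * (Var Vn - 1))%X *: (opD (Lin 0 1 (-2)) * A)
  end.

(** A current is numbered by modes n >= 0: L_(n-1), X_n and G_(n-1/2). *)
Inductive current := fL | fX of sl2_basis | fG of bool & bool.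

(** The operator of L is doubled, which keeps all coefficients integral. The
    letters G^(+-) and G^(--) have to move past G^(-+) and G^(++), with which they
    bracket to 2∂ and -2∂; this is the origin of the terms with opS. *)
Definition current_op (x : current) : op :=
  match x with
  | fL => 2 *: (opS * Dn 0 op1) + Dn 1 (opd + EtaN + ThN) + Dn 2 (Rp * lder Thp + Rm * lder Thm)
  | fX slH => Dn 0 (EtaH + ThH) + Dn 1 (Rp * lder Thp - Rm * lder Thm)
  | fX slE => Dn 0 (EtaE + ThE) + Dn 1 (Rp * lder Thm)
  | fX slF => Dn 0 (EtaF + ThF) + Dn 1 (Rm * lder Thp)
  | fG true true => Dn 0 (lmul Thp) + Dn 1 Rp
  | fG false true => Dn 0 (lmul Thm) + Dn 1 Rm
  | fG true false => Dn 0 (lmul Etp) + 2 *: (opS * Dn 0 (lder Thm)) + Dn 1 Tp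
      + 2 *: Dn 2 (Rp * lder Thp * lder Thm)
  | fG false false => Dn 0 (lmul Etm) - 2 *: (opS * Dn 0 (lder Thp)) + Dn 1 Tm
      + 2 *: Dn 2 (Rm * lder Thp * lder Thm)
  end.

Definition lm := Lin 1 0 0.
Definition ln := Lin 0 1 0.
Definition lmn := Lin 1 1 0.
Definition lmn1 := Lin 1 1 (-1).

Definition current_odd (x : current) : bool := if x is fG _ _ then true else false.

Definition supercomm (x y : current) : op :=
  let A := at_mode lm (current_op x) in let B := at_mode ln (current_op y) in
  if current_odd x && current_odd y then A * B + B * A else A * B - B * A.

(** The table sk_bracket in terms of modes, with each L doubled. *)
Definition bracket_terms (x y : current) : seq (expr * current * lin) :=
  let m := Var Vm in let n := Var Vn in
  match x, y with
  | fL, fL => [:: (2 * (m - n), fL, lmn1)%X]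
  | fL, fX a => [:: (- (2 * n), fX a, lmn1)%X]
  | fX a, fL => [:: (2 * m, fX a, lmn1)%X]
  | fL, fG a b => [:: (m - 2 * n, fG a b, lmn1)%X]
  | fG a b, fL => [:: (2 * m - n, fG a b, lmn1)%X]
  | fX slH, fX slE => [:: (2, fX slE, lmn)%X]
  | fX slE, fX slH => [:: (- (2), fX slE, lmn)%X]
  | fX slH, fX slF => [:: (- (2), fX slF, lmn)%X]
  | fX slF, fX slH => [:: (2, fX slF, lmn)%X]
  | fX slE, fX slF => [:: (1, fX slH, lmn)%X]
  | fX slF, fX slE => [:: (- (1), fX slH, lmn)%X]
  | fX slH, fG true b => [:: (1, fG true b, lmn)%X]
  | fX slH, fG false b => [:: (- (1), fG false b, lmn)%X]
  | fX slE, fG false b => [:: (1, fG true b, lmn)%X]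
  | fX slF, fG true b => [:: (1, fG false b, lmn)%X]
  | fG true b, fX slH => [:: (- (1), fG true b, lmn)%X]
  | fG false b, fX slH => [:: (1, fG false b, lmn)%X]
  | fG false b, fX slE => [:: (- (1), fG true b, lmn)%X]
  | fG true b, fX slF => [:: (- (1), fG false b, lmn)%X]
  | fG true true, fG true false => [:: (2 * (m - n), fX slE, lmn1)%X]
  | fG true true, fG false false => [:: (- (m - n), fX slH, lmn1)%X; (- (1), fL, lmn)%X]
  | fG false true, fG true false => [:: (- (m - n), fX slH, lmn1)%X; (1, fL, lmn)%X]
  | fG false true, fG false false => [:: (- (2 * (m - n)), fX slF, lmn1)%X]
  | fG true false, fG true true => [:: (2 * (n - m), fX slE, lmn1)%X]
  | fG false false, fG true true => [:: (- (n - m), fX slH, lmn1)%X; (- (1), fL, lmn)%X]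
  | fG true false, fG false true => [:: (- (n - m), fX slH, lmn1)%X; (1, fL, lmn)%X]
  | fG false false, fG false true => [:: (- (2 * (n - m)), fX slF, lmn1)%X]
  | _, _ => [::]
  end.

Definition bracket_op (x y : current) : op :=
  foldr (fun t A => let: (c, z, l) := t in c *: at_mode l (current_op z) + A) op0
    (bracket_terms x y).

(** Both sides are operators with polynomial coefficients in m, n, k, j, 2 Delta
    and Lambda. They are equal for all values because their normal forms agree. *)
Lemma current_bracket x y : op_eq (supercomm x y) (bracket_op x y).
Proof.
by case: x => [|[]|[] []]; case: y => [|[]|[] []]; vm_compute.
Qed.

End Currents.

(** * The representation on coordinate functions *)
Section Action.
Variables (K : numFieldType) (Delta : K) (Lam : nat).
Local Notation model := (model K).
Local Notation act_op := (apply_op (2 * Delta) Lam).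
Implicit Types (f g : model) (A B : op).

Definition kind (x : sk_basis) : current :=
  match x with bL _ => fL | bX a _ => fX a | bG a b _ => fG a b end.
Definition mode (x : sk_basis) : nat :=
  match x with bL n => n | bX _ n => n | bG _ _ n => n end.
(** Undoes the doubling of L. *)
Definition halve (x : current) : K := if x is fL then 2^-1 else 1.

(** There are no coordinates with k < 0, so these values have to be reset. *)
Definition trunc f : model := fun S k j => if (0 <=? k)%ZZ then f S k j else 0.
Definition scale (c : K) f : model := fun S k j => c * f S k j.

Definition rho (x : sk_basis) f : model :=
  trunc (scale (halve (kind x)) (act_op 0 (Z.of_nat (mode x)) (current_op (kind x)) f)).

Definition agree f g := forall S k j, (0 <= k)%ZZ -> f S k j = g S k j.

Lemma trunc_eqP f g : agree f g -> trunc f = trunc g.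
Proof.
move=> fg; apply/funext=> S; apply/funext=> k; apply/funext=> j.
by rewrite /trunc; case: Z.leb_spec => // /fg.
Qed.

Lemma agree_trunc f : agree (trunc f) f.
Proof. by move=> S k j; rewrite /trunc => /Z.leb_le ->. Qed.

Lemma apply_op_scale m n A c f : act_op m n A (scale c f) = scale c (act_op m n A f).
Proof.
apply/funext=> S; apply/funext=> k; apply/funext=> j; rewrite /act_op /scale.
elim: (A S) => /= [|t l ->]; first by rewrite mulr0.
by rewrite mulrDr /apply_term mulrCA.
Qed.

(** Resetting the values at k < 0 is compatible with composition as long as the
    values of A f at k >= 0 only depend on those of f at k >= 0. *)
Section Local.
Variable n : Z.
Hypothesis n0 : (0 <= n)%ZZ.

Definition local A := forall f g, agree f g -> agree (act_op 0 n A f) (act_op 0 n A g).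

Lemma local_add A B : local A -> local B -> local (A + B)%OP.
Proof. by move=> lA lB f g fg S k j k0; rewrite !apply_opD (lA f g) ?(lB f g). Qed.

Lemma local_scale c A : local A -> local (c *: A)%OP.
Proof. by move=> lA f g fg S k j k0; rewrite !apply_opZ (lA f g). Qed.

Lemma local_mul A B : local A -> local B -> local (A * B)%OP.
Proof. by move=> lA lB f g fg; rewrite !apply_opM; apply/lA/lB. Qed.

Lemma local_static A :
  (forall S t, List.In t (A S) -> kshift t = l0) -> local A.
Proof.
move=> A0 f g fg S k j k0; rewrite /act_op; elim: (A S) (A0 S) => //= t l IHl tl.
rewrite IHl => [|u ul]; last by apply: tl; right.
congr (_ + _); rewrite /apply_term fg // (tl t); last by left.
by rewrite /lval /=; lia.
Qed.

(** The value at k = -1 enters with the factor k = 0. *)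
Lemma local_S : local opS.
Proof.
move=> f g fg S k j k0; rewrite /act_op /= /apply_term /=; congr (_ + _).
have [->|k1] : (k = 0 \/ 1 <= k)%ZZ by lia.
  by rewrite !mul0r.
by rewrite fg // /lval /=; lia.
Qed.

Lemma apply_opshift m f l S k j :
  act_op m n (opD l) f S k j = f S (k + lval m n l)%ZZ j.
Proof. by rewrite /act_op /= /apply_term /= mul1r addr0 Z.add_0_r. Qed.

(** A negative power of D occurs only for n < i, and then the falling factorial of
    n in front of it is zero. *)
Lemma local_D i A : local A -> local (Dn i A).
Proof.
move=> lA; have shift e (c : expr) : (0 <= n - e)%ZZ \/ ev (valuation (2 * Delta) Lam 0 n 0 0) c = 0 ->
    (forall k j, ev (valuation (2 * Delta) Lam 0 n k j) c = ev (valuation (2 * Delta) Lam 0 n 0 0) c) ->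
    local (c *: (opD (Lin 0 1 (- e)) * A)%OP)%OP.
  move=> ne cst f g fg S k j k0; rewrite !apply_opZ !apply_opM cst.
  case: ne => [ne | ->]; last by rewrite !mul0r.
  by rewrite !apply_opshift (lA f g fg) // /lval; cbn [lin_m lin_n lin_c]; lia.
have n_cases : n = 0%ZZ \/ n = 1%ZZ \/ (2 <= n)%ZZ by lia.
case: i => [|[|i]] /=.
- by apply: local_mul lA => f g fg S k j k0; rewrite !apply_opshift fg // /lval;
    cbn [lin_m lin_n lin_c]; lia.
- apply: (shift 1%ZZ) => //=; case: n_cases => [->|n1]; first by right.
  left; lia.
- apply: (shift 2%ZZ) => //=; case: n_cases => [->|[->|n1]]; first by right; rewrite mul0r.
    by right; rewrite /= /zr /=; ring.
  left; lia.
Qed.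

Lemma local_current x : local (current_op x).
Proof.
have lE : local opE by apply: local_static => S t [<-|].
have lF : local opF by apply: local_static => S t [<-|].
have lH : local opH by apply: local_static => S t [<-|].
have l1 : local op1 by apply: local_static => S t [<-|].
have lm i : local (lmul i).
  by apply: local_static => S t; rewrite /lmul; case: ifP => // _ [<-|].
have ld i : local (lder i).
  by apply: local_static => S t; rewrite /lder; case: ifP => // _ [<-|].
have lS := local_S.
have lR : local Rp /\ local Rm.
  by split; repeat (apply: local_mul || apply: local_scale || apply: local_add).
case: lR => lRp lRm.
case: x => [|[]|[] []]; rewrite /current_op;
  by repeat (apply: local_D || apply: local_mul || apply: local_scale || apply: local_add).
Qed.

End Local.

End Action.

Lemma malg_ind (K : nzRingType) (I : choiceType) (P : {malg K[I]} -> Prop) :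
  P 0 -> (forall c i a, P a -> P (c *: << i >> + a)) -> forall a, P a.
Proof.
move=> P0 PD a; rewrite [a]monalgE; elim: (enum_fset _) => [|i s IHs].
  by rewrite big_nil.
rewrite big_cons; have -> : << a@_i *g i >> = a@_i *: << i >>; last exact: PD.
by apply/malgP => k; rewrite mcoeffZ !mcoeffU mulrnAr mulr1.
Qed.

(** The action of basis elements, extended to linear combinations. *)
Section LinearExtension.
Variables (K : numFieldType) (I : choiceType) (h : I -> model K -> model K).

Definition lin_ext (a : {malg K[I]}) (f : model K) : model K :=
  fun S k j => mmap idfun (fun i => h i f S k j) a.

Lemma lin_ext0 f S k j : lin_ext 0 f S k j = 0. Proof. exact: raddf0. Qed.
Lemma lin_extD a b f S k j : lin_ext (a + b) f S k j = lin_ext a f S k j + lin_ext b f S k j.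
Proof. exact: raddfD. Qed.
Lemma lin_extN a f S k j : lin_ext (- a) f S k j = - lin_ext a f S k j.
Proof. exact: raddfN. Qed.
Lemma lin_extU i f S k j : lin_ext << i >> f S k j = h i f S k j.
Proof. by rewrite /lin_ext mmapU mul1r. Qed.

Lemma lin_extZ c a f S k j : lin_ext (c *: a) f S k j = c * lin_ext a f S k j.
Proof.
rewrite /lin_ext (mmapEw (msuppZ_le c a)) mmapE mulr_sumr.
by apply: eq_bigr => i _; rewrite mcoeffZ mulrA.
Qed.

Lemma lin_ext_addZ c a e b f S k j :
  lin_ext (- (c *: a) + e *: b) f S k j = - c * lin_ext a f S k j + e * lin_ext b f S k j.
Proof. by rewrite lin_extD lin_extN !lin_extZ mulNr. Qed.
Lemma lin_ext_subZ c a e b f S k j :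
  lin_ext (- (c *: a) - e *: b) f S k j = - c * lin_ext a f S k j + - e * lin_ext b f S k j.
Proof. by rewrite lin_extD !lin_extN !lin_extZ !mulNr. Qed.

End LinearExtension.

Section Representation.
Variables (K : numFieldType) (Delta : K) (Lam : nat).
Local Notation model := (model K).
Local Notation SK := {malg K[sk_basis]}.
Local Notation act_op := (apply_op (2 * Delta) Lam).
Local Notation rho := (rho Delta Lam).
Local Notation halve := (halve K).
Implicit Types (f g : model) (A B : op).

(** The indices of the algebra are in int, the shifts of operators in Z. *)
Definition Zi (i : int) : Z :=
  match i with Posz n => Z.of_nat n | Negz n => Z.opp (Z.of_nat n.+1) end.

Lemma Zi_sub (m n : nat) : Zi (m%:Z - n%:Z) = (Z.of_nat m - Z.of_nat n)%ZZ.
Proof.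
case: (ssrnat.leqP n m) => [le_nm | /ltnW le_mn].
  by rewrite subzn //= Nat2Z.inj_sub //; exact/ssrnat.leP.
rewrite -opprB subzn //; have /ssrnat.leP := le_mn; case E : (n - m)%N => [|p] /= le.
  have := congr1 Z.of_nat E; rewrite Nat2Z.inj_sub //=; lia.
have := congr1 Z.of_nat E; rewrite Nat2Z.inj_sub //=; lia.
Qed.

Definition current_elt (z : current) (i : int) : SK :=
  match z with fL => eL K (i - 1) | fX a => eX K a i | fG a b => eG K a b i end.

Lemma rho_current z i c f S k j : (i < 0 -> c = 0) ->
  c * lin_ext rho (current_elt z i) f S k j =
  c * trunc (scale (halve z) (act_op 0 (Zi i) (current_op z) f)) S k j.
Proof.
case: i => n c0; last by rewrite c0 // !mul0r.
by case: z => [|a|a b] //=; rewrite /eL ?subrK lin_extU.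
Qed.

(** The truncation between the two factors may be dropped by locality. *)
Lemma rho_mul x y f : rho x (rho y f) =
  trunc (scale (halve (kind x) * halve (kind y))
    (act_op 0 (Z.of_nat (mode x)) (current_op (kind x))
      (act_op 0 (Z.of_nat (mode y)) (current_op (kind y)) f))).
Proof.
apply: trunc_eqP => S k j k0; rewrite /scale -mulrA; congr (_ * _).
rewrite (@local_current _ _ _ _ (Zle_0_nat _) _ _ _ (@agree_trunc _ _)) //.
by rewrite apply_op_scale.
Qed.

Lemma rho_at z i l c1 c2 f S k j : (0 <= k)%ZZ ->
    (i < 0 -> c1 = 0) -> Zi i = l -> c1 * halve z = c2 ->
  c1 * lin_ext rho (current_elt z i) f S k j = c2 * act_op 0 l (current_op z) f S k j.
Proof.
by move=> k0 c0 <- <-; rewrite rho_current // /trunc (introT (Z.leb_spec0 _ _) k0) mulrA.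
Qed.

Lemma lin_ext_neg a f S k j : (k < 0)%ZZ -> lin_ext rho a f S k j = 0.
Proof.
move=> k0; rewrite /lin_ext mmapE big1 // => b _.
by rewrite /rho /trunc; case: Z.leb_spec; rewrite ?mulr0 //; lia.
Qed.

Lemma Zi_pred (m n : nat) :
  Zi (m%:Z + n%:Z - 1) = lval (Z.of_nat m) (Z.of_nat n) lmn1.
Proof.
rewrite -PoszD Zi_sub Nat2Z.inj_add /lval; cbn [lmn1 lin_m lin_n lin_c]; lia.
Qed.

Lemma Zi_add (m n : nat) : Zi (m%:Z + n%:Z) = lval (Z.of_nat m) (Z.of_nat n) lmn.
Proof. rewrite /= Nat2Z.inj_add /lval; cbn [lmn lin_m lin_n lin_c]; lia. Qed.

Lemma pred_neg (m n : nat) : m%:Z + n%:Z - 1 < 0 -> m = 0%N /\ n = 0%N.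
Proof. by rewrite -PoszD; case: m n => [|m] []. Qed.

Lemma apply_bracket_op m n x y f S k j :
  act_op m n (bracket_op x y) f S k j =
  \sum_(t <- bracket_terms x y) ev (valuation (2 * Delta) Lam m n k j) t.1.1 *
    act_op 0 (lval m n t.2) (current_op t.1.2) f S k j.
Proof.
rewrite /bracket_op; elim: (bracket_terms x y) => [|[[c z] l] s IHs].
  by rewrite big_nil.
by rewrite big_cons -IHs [foldr _ _ _]/(_ + _)%OP apply_opD apply_opZ apply_at_mode.
Qed.

(** The two bracket tables agree case by case. The only index which can be out of
    range is m + n - 1 for m = n = 0, and there its coefficient is zero. *)
Lemma bracket_lin_ext x y f S k j : (0 <= k)%ZZ ->
  lin_ext rho (sk_bracket K x y) f S k j =
  halve (kind x) * halve (kind y) *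
  act_op (Z.of_nat (mode x)) (Z.of_nat (mode y)) (bracket_op (kind x) (kind y)) f S k j.
Proof.
move=> k0.
have two0 : 2 != 0 :> K by rewrite pnatr_eq0.
have zrs : ((zr K 2 = 2) * (zr K (-1) = -1) * (zr K 1 = 1))%type by [].
(* The brackets have the indices m + n - 1 and m + n; at_pred and at_add compare the
   contributions of an element with such an index. *)
have at_pred z c1 h c2 m n : (m = 0%N -> n = 0%N -> c1 = 0) -> c1 * halve z = h * c2 ->
    c1 * lin_ext rho (current_elt z (m%:Z + n%:Z - 1)) f S k j =
    h * (c2 * act_op 0 (lval (Z.of_nat m) (Z.of_nat n) lmn1) (current_op z) f S k j).
  move=> c0 hc; rewrite [RHS]mulrA.
  by apply: rho_at => // [/pred_neg[]|]; [exact: c0 | exact: Zi_pred].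
have at_add z c1 h c2 m n : c1 * halve z = h * c2 ->
    c1 * lin_ext rho (current_elt z (m%:Z + n%:Z)) f S k j =
    h * (c2 * act_op 0 (lval (Z.of_nat m) (Z.of_nat n) lmn) (current_op z) f S k j).
  by move=> hc; rewrite [RHS]mulrA; apply: rho_at => //; rewrite Zi_add.
rewrite apply_bracket_op mulr_sumr.
pose simp := (big_cons, big_nil, addr0).
case: x y => [m|a m|a b m] [n|c n|c e n]; cbn [kind mode sk_bracket].
- rewrite lin_extZ [X in eL K X](_ : _ = m%:Z + n%:Z - 1 - 1); last by ring.
  rewrite -[eL _ _]/(current_elt fL _) !simp; apply: at_pred => [-> ->|] //=.
  by rewrite !zr_nat !intrB; field.
- rewrite lin_extN lin_extZ [X in eX _ _ X](_ : _ = m%:Z + n%:Z - 1); last by ring.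
  rewrite -mulNr -[eX _ _ _]/(current_elt (fX c) _) !simp.
  apply: at_pred => [_ ->|] //=; first by rewrite oppr0.
  by rewrite !zr_nat; field.
- rewrite lin_extZ [X in eG _ _ _ X](_ : _ = m%:Z + n%:Z - 1); last by ring.
  rewrite -[eG _ _ _ _]/(current_elt (fG c e) _) !simp.
  apply: at_pred => [-> ->|] /=; first by field.
  by rewrite !zr_nat intrB; field.
- rewrite lin_extZ [X in eX _ _ X](_ : _ = m%:Z + n%:Z - 1); last by ring.
  rewrite -[eX _ _ _]/(current_elt (fX a) _).
  have -> : bracket_terms (fX a) fL = [:: ((2 * Var Vm)%X, fX a, lmn1)] by case: (a).
  rewrite !simp; apply: at_pred => [-> _|] //=; by rewrite !zr_nat; field.
- have at_addX u c1 h c2 : c1 = h * c2 ->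
    c1 * lin_ext rho (eX K u (m%:Z + n%:Z)) f S k j =
    h * (c2 * act_op 0 (lval (Z.of_nat m) (Z.of_nat n) lmn) (current_op (fX u)) f S k j).
    by move=> ->; apply: (at_add (fX u)); rewrite mulr1.
  case: a c => [] []; cbn [sl2_bracket]; rewrite !simp ?lin_ext0 ?lin_extN ?lin_extZ -?mulNr //;
    first [ by apply: at_addX; rewrite /=; ring
          | by rewrite -[LHS]mul1r; apply: at_addX; rewrite /=; ring
          | by rewrite -mulN1r; apply: at_addX; rewrite /=; ring ].
- have at_addG u v c1 h c2 : c1 = h * c2 ->
    c1 * lin_ext rho (eG K u v (m%:Z + n%:Z)) f S k j =
    h * (c2 * act_op 0 (lval (Z.of_nat m) (Z.of_nat n) lmn) (current_op (fG u v)) f S k j).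
    by move=> ->; apply: (at_add (fG u v)); rewrite mulr1.
  case: a c => [] []; cbn [sl2_act]; rewrite ?simp ?lin_ext0 ?lin_extN //;
    first [ by rewrite -[LHS]mul1r; apply: at_addG; rewrite /=; ring
          | by rewrite -mulN1r; apply: at_addG; rewrite /=; ring ].
- have -> : bracket_terms (fG a b) fL = [:: ((2 * Var Vm - Var Vn)%X, fG a b, lmn1)].
    by case: (a) (b) => [] [].
  rewrite (_ : (if b then _ else _) = - (((n%:Z - 1)%:~R / 2 - (m%:R - 2^-1)) *:
    eG K a b (n%:Z - 1 + m%:Z))); last by case: (b).
  rewrite lin_extN lin_extZ [X in eG _ _ _ X](_ : _ = m%:Z + n%:Z - 1); last by ring.
  rewrite -mulNr -[eG _ _ _ _]/(current_elt (fG a b) _) !simp.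
  apply: at_pred => [-> ->|] /=; first by field.
  by rewrite !zr_nat intrB; field.
- have at_addG u v c1 h c2 : c1 = h * c2 ->
    c1 * lin_ext rho (eG K u v (n%:Z + m%:Z)) f S k j =
    h * (c2 * act_op 0 (lval (Z.of_nat m) (Z.of_nat n) lmn) (current_op (fG u v)) f S k j).
    by move=> ->; rewrite addrC; apply: (at_add (fG u v)); rewrite mulr1.
  rewrite (_ : (if b then _ else _) = - sl2_act K c a b (n%:Z + m%:Z)); last by case: (b).
  case: a b c => [] [] []; cbn [sl2_act]; rewrite ?simp ?opprK ?oppr0 ?lin_ext0 ?lin_extN //;
    first [ by rewrite -[LHS]mul1r; apply: at_addG; rewrite /=; ring
          | by rewrite -mulN1r; apply: at_addG; rewrite /=; ring ].
- have at_L c1 h c2 : c1 / 2 = h * c2 ->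
    c1 * lin_ext rho (eL K (m%:Z + n%:Z - 1)) f S k j =
    h * (c2 * act_op 0 (lval (Z.of_nat m) (Z.of_nat n) lmn) (current_op fL) f S k j).
    exact: (at_add fL).
  have at_predX u c1 h c2 : (m = 0%N -> n = 0%N -> c1 = 0) -> c1 = h * c2 ->
    c1 * lin_ext rho (eX K u (m%:Z + n%:Z - 1)) f S k j =
    h * (c2 * act_op 0 (lval (Z.of_nat m) (Z.of_nat n) lmn1) (current_op (fX u)) f S k j).
    by move=> h0 hc; apply: (at_pred (fX u)); rewrite ?mulr1.
  case: b e => [] []; cbn [odd_bracket]; rewrite ?lin_ext0.
  + by case: (a) (c) => [] []; rewrite big_nil.
  + case: a c => [] []; cbn [odd_bracket bracket_terms]; rewrite !big_cons big_nil addr0.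
    * by rewrite lin_extZ; apply: at_predX => [-> ->|]; rewrite /= ?mulr0 // !zr_nat intrB; ring.
    * rewrite lin_ext_subZ; congr (_ + _); last by apply: at_L; rewrite /=; field.
      by apply: at_predX => [-> ->|]; rewrite /= ?oppr0 // !zr_nat intrB; ring.
    * rewrite lin_ext_addZ; congr (_ + _); last by apply: at_L; rewrite /=; field.
      by apply: at_predX => [-> ->|]; rewrite /= ?oppr0 // !zr_nat intrB; ring.
    * by rewrite lin_extN lin_extZ -mulNr; apply: at_predX => [-> ->|];
        rewrite /= ?mulr0 ?oppr0 // !zr_nat intrB; ring.
  + rewrite (addrC m%:Z) in at_L at_predX.
    case: a c at_L at_predX => [] [] at_L at_predX; cbn [odd_bracket bracket_terms];
      rewrite !big_cons big_nil addr0.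
    * by rewrite lin_extZ; apply: at_predX => [-> ->|]; rewrite /= ?mulr0 // !zr_nat intrB; ring.
    * rewrite lin_ext_addZ; congr (_ + _); last by apply: at_L; rewrite /=; field.
      by apply: at_predX => [-> ->|]; rewrite /= ?oppr0 // !zr_nat intrB; ring.
    * rewrite lin_ext_subZ; congr (_ + _); last by apply: at_L; rewrite /=; field.
      by apply: at_predX => [-> ->|]; rewrite /= ?oppr0 // !zr_nat intrB; ring.
    * by rewrite lin_extN lin_extZ -mulNr; apply: at_predX => [-> ->|];
        rewrite /= ?mulr0 ?oppr0 // !zr_nat intrB; ring.
  + by case: (a) (c) => [] []; rewrite big_nil.
Qed.

(** The operators of the basis elements satisfy the relations of the algebra. *)
Lemma rho_bracket x y f S k j :
  rho x (rho y f) S k j - (-1) ^+ (sk_odd x && sk_odd y) * rho y (rho x f) S k j =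
  lin_ext rho (sk_bracket K x y) f S k j.
Proof.
case: (Z.ltb_spec0 k 0) => [k0 | /Z.nlt_ge k0].
  rewrite lin_ext_neg // /rho /trunc; case: Z.leb_spec; first lia.
  by rewrite mulr0 subrr.
rewrite bracket_lin_ext // -(op_eqE _ _ _ _ _ (current_bracket _ _)).
rewrite !rho_mul /trunc (introT (Z.leb_spec0 _ _) k0) /scale.
have oddE z : sk_odd z = current_odd (kind z) by case: z.
have mode_m u v : lval u v lm = u by rewrite /lval; cbn [lm lin_m lin_n lin_c]; lia.
have mode_n u v : lval u v ln = v by rewrite /lval; cbn [ln lin_m lin_n lin_c]; lia.
have first_mode u v A B g : act_op u v (at_mode lm A * at_mode ln B)%OP g =
    act_op 0 u A (act_op 0 v B g).
  by rewrite apply_opM !apply_at_mode mode_m mode_n.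
have second_mode u v A B g : act_op u v (at_mode ln B * at_mode lm A)%OP g =
    act_op 0 v B (act_op 0 u A g).
  by rewrite apply_opM !apply_at_mode mode_m mode_n.
rewrite /supercomm !oddE; case: ifP => _.
  by rewrite apply_opD first_mode second_mode; ring.
by rewrite apply_opD apply_opN first_mode second_mode; ring.
Qed.

End Representation.

(** * The map from the induced module to coordinate functions *)
Section ModuleMap.
Variables (K : numFieldType) (Delta : K) (Lam : nat).
Local Notation model := (model K).
Local Notation SK := {malg K[sk_basis]}.
Local Notation FA := (free_alg K).
Local Notation act_op := (apply_op (2 * Delta) Lam).
Local Notation rho := (rho Delta Lam).
Implicit Types (f g : model).

Definition fcomb c f g : model := fun S k j => c * f S k j + g S k j.
Definition fzero : model := fun _ _ _ => 0.

Lemma model_ext f g : (forall S k j, f S k j = g S k j) -> f = g.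
Proof. by move=> fg; apply/funext=> S; apply/funext=> k; apply/funext=> j. Qed.

Lemma apply_op_comb m n A c f g :
  act_op m n A (fcomb c f g) = fcomb c (act_op m n A f) (act_op m n A g).
Proof.
apply: model_ext => S k j; rewrite /apply_op /fcomb.
elim: (A S) => /= [|t l ->]; first by rewrite mulr0 addr0.
by rewrite /apply_term; ring.
Qed.

Lemma rho_comb x c f g : rho x (fcomb c f g) = fcomb c (rho x f) (rho x g).
Proof.
apply: model_ext => S k j; rewrite /rho apply_op_comb /trunc /scale /fcomb.
by case: ifP => _; ring.
Qed.

Definition word_act (s : seq sk_basis) f : model := foldr rho f s.

Lemma word_act_comb s c f g :
  word_act s (fcomb c f g) = fcomb c (word_act s f) (word_act s g).
Proof. by elim: s => //= x s ->; rewrite rho_comb. Qed.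

Definition fa_act (a : FA) f : model := lin_ext (fun m : {fmonom sk_basis} => word_act m) a f.

Lemma fzeroE f : fzero = fcomb (-1) f f.
Proof. by apply: model_ext => S k j; rewrite /fzero /fcomb mulN1r addNr. Qed.

Lemma word_act0 s : word_act s fzero = fzero.
Proof. by rewrite {1}(fzeroE fzero) word_act_comb -fzeroE. Qed.

Lemma fa_act0 f : fa_act 0 f = fzero.
Proof. by apply: model_ext => S k j; rewrite /fa_act lin_ext0. Qed.

Lemma fa_actP c a b f : fa_act (c *: a + b) f = fcomb c (fa_act a f) (fa_act b f).
Proof. by apply: model_ext => S k j; rewrite /fa_act lin_extD lin_extZ. Qed.

Lemma fa_actU (m : {fmonom sk_basis}) f : fa_act (<< m >> : FA) f = word_act m f.
Proof. by apply: model_ext => S k j; rewrite /fa_act lin_extU. Qed.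

Lemma fa_ind (P : FA -> Prop) :
  P 0 -> (forall c (m : {fmonom sk_basis}) a, P a -> P (c *: (<< m >> : FA) + a)) ->
  forall a, P a.
Proof. exact: malg_ind. Qed.

Lemma fa_act_comb a c f g : fa_act a (fcomb c f g) = fcomb c (fa_act a f) (fa_act a g).
Proof.
elim/fa_ind: a => [|e m a IHa].
  by rewrite !fa_act0; apply: model_ext => S k j; rewrite /fcomb /fzero mulr0 addr0.
rewrite !fa_actP !fa_actU word_act_comb IHa.
by apply: model_ext => S k j; rewrite /fcomb; ring.
Qed.

Lemma fa_actM a b f : fa_act (a * b) f = fa_act a (fa_act b f).
Proof.
have actU (m : {fmonom sk_basis}) : fa_act ((<< m >> : FA) * b) f = word_act m (fa_act b f).
  elim/fa_ind: b => [|e m' b IHb]; first by rewrite mulr0 !fa_act0 word_act0.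
  rewrite mulrDr -scalerAr !fa_actP IHb word_act_comb !fa_actU; congr fcomb.
  rewrite fa_mulE malgM_def fgmulUU mulr1 fa_actU.
  by rewrite /word_act /= fmM foldr_cat.
elim/fa_ind: a => [|e m a IHa]; first by rewrite mul0r !fa_act0.
by rewrite mulrDl -scalerAl !fa_actP IHa actU fa_actU.
Qed.

Lemma fa_act1 f : fa_act 1 f = f.
Proof. by rewrite (fa_actU (mone : {fmonom sk_basis})) fm1. Qed.

Lemma fa_act_gen x f : fa_act (fa_gen K x) f = rho x f.
Proof. by rewrite fa_actU fmU. Qed.

Lemma fa_act_inj (a : SK) f : fa_act (fa_inj a) f = lin_ext rho a f.
Proof.
apply: model_ext => S k j; rewrite /lin_ext mmapE /fa_inj.
elim: (enum_fset _) => [|b s IHs]; first by rewrite !big_nil fa_act0.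
by rewrite !big_cons fa_actP fa_act_gen /fcomb IHs.
Qed.

(** This is where the relations are used: the action of the free algebra passes to
    the enveloping algebra. *)
Lemma fa_act_relator x y f : fa_act (env_relator K x y) f = fzero.
Proof.
have -> : env_relator K x y = (-1 : K) *: fa_inj (sk_bracket K x y) +
    ((- (-1) ^+ (sk_odd x && sk_odd y)) *: (fa_gen K y * fa_gen K x) + fa_gen K x * fa_gen K y).
  rewrite /env_relator scaleN1r addrC scaleNr; congr (_ + _); rewrite addrC; congr (_ + _).
  by case: (_ && _); rewrite ?expr1 ?expr0 ?scaleN1r ?mulN1r ?scale1r ?mul1r.
rewrite !fa_actP !fa_actM !fa_act_gen fa_act_inj.
apply: model_ext => S k j; rewrite /fcomb -rho_bracket /fzero; ring.
Qed.

Lemma fa_act_ideal a f : Defs.span (@env_ideal_gen K) a -> fa_act a f = fzero.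
Proof.
elim=> [|c s v [b [e [x [y ->]]]] _ IHv]; first exact: fa_act0.
rewrite fa_actP IHv !fa_actM fa_act_relator.
have -> : fa_act b fzero = fzero.
  by rewrite {1}(fzeroE fzero) fa_act_comb -fzeroE.
by apply: model_ext => S k j; rewrite /fcomb /fzero mulr0 addr0.
Qed.

Definition env_act (u : env K) f : model := fa_act (repr u) f.

Lemma env_act_proj a f : env_act (env_proj a) f = fa_act a f.
Proof.
have /env_projE : env_proj (repr (env_proj a)) = env_proj a by exact: env_projK.
rewrite /env_act; set b := repr _ => /(@fa_act_ideal _ f) ba0.
have -> : fa_act b f = fa_act (1 *: (b - a) + a) f by rewrite scale1r subrK.
by rewrite fa_actP ba0; apply: model_ext => S k j; rewrite /fcomb /fzero mulr0 add0r.
Qed.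

Lemma env_actM u v f : env_act (u * v) f = env_act u (env_act v f).
Proof.
by case: (env_projP u) (env_projP v) => a -> [b ->]; rewrite -env_projM !env_act_proj fa_actM.
Qed.

Lemma env_actP c u v f : env_act (c *: u + v) f = fcomb c (env_act u f) (env_act v f).
Proof.
case: (env_projP u) (env_projP v) => a -> [b ->].
by rewrite -env_projZ -raddfD !env_act_proj fa_actP.
Qed.

Lemma env_act_comb u c f g : env_act u (fcomb c f g) = fcomb c (env_act u f) (env_act u g).
Proof. exact: fa_act_comb. Qed.

Lemma env_act1 f : env_act 1 f = f.
Proof. by rewrite [1]/(env_proj 1) env_act_proj fa_act1. Qed.

Lemma env_act0 f : env_act 0 f = fzero.
Proof. by rewrite -(raddf0 (@env_proj K)) env_act_proj fa_act0. Qed.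

Lemma env_act_fzero u : env_act u fzero = fzero.
Proof. by rewrite {1}(fzeroE fzero) env_act_comb -fzeroE. Qed.

Lemma env_act_inj (a : SK) f : env_act (env_inj a) f = lin_ext rho a f.
Proof. by rewrite env_inj.unlock env_act_proj fa_act_inj. Qed.

Lemma env_act_gen x f : env_act (env_inj (sk_gen K x)) f = rho x f.
Proof. by rewrite env_act_inj; apply: model_ext => S k j; rewrite lin_extU. Qed.

End ModuleMap.

Section InducedMap.
Variables (K : numFieldType) (Delta : K) (Lam : nat).
Local Notation model := (model K).
Local Notation U := 'rV[K]_Lam.+1.
Local Notation act_op := (apply_op (2 * Delta) Lam).
Local Notation rho := (rho Delta Lam).
Local Notation fzero := (fzero K).
Implicit Types (f g : model).

Definition empty : state := (false, false, false, false).

Definition point (S0 : state) (k0 j0 : Z) : model := fun S k j =>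
  if [&& S == S0, (k =? k0)%ZZ & (j =? j0)%ZZ] then 1 else 0.

(** The coordinates of F^j v; the factor comes from the normalization of m_j. *)
Definition ground (j : nat) : model := scale (Lam ^_ j)%:R (point empty 0 (Z.of_nat j)).

Lemma ground_gt j : (Lam < j)%N -> ground j = fzero.
Proof.
by move=> lt_j; apply: model_ext => S k i; rewrite /ground /scale ffact_small // mul0r.
Qed.

Definition ground_of (u : U) : model := fun S k j => \sum_i u 0 i * ground i S k j.

Lemma ground_of_vec j : ground_of (irr_vec K Lam j) = ground j.
Proof.
apply: model_ext => S k i; rewrite /ground_of.
have [lt_j | gt_j] := ltnP j Lam.+1.
  rewrite (bigD1 (Ordinal lt_j)) //= mxE eqxx mul1r big1 ?addr0 // => l ne_lj.
  by rewrite mxE -[_ == j]/(l == Ordinal lt_j) (negPf ne_lj) mul0r.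
by rewrite (irr_vec_gt _ gt_j) (ground_gt gt_j) big1 // => l _; rewrite mxE mul0r.
Qed.

Lemma ground_ofP c u w : ground_of (c *: u + w) = fcomb c (ground_of u) (ground_of w).
Proof.
apply: model_ext => S k j; rewrite /ground_of /fcomb mulr_sumr -big_split.
by apply: eq_bigr => i _; rewrite !mxE mulrDl mulrA.
Qed.

Lemma ground_of0 : ground_of 0 = fzero.
Proof. by apply: model_ext => S k j; rewrite /ground_of big1 // => i _; rewrite mxE mul0r. Qed.

Lemma rho_fzero x : rho x fzero = fzero.
Proof. exact: (word_act0 Delta Lam [:: x]). Qed.

Lemma ground_src j S k i : S != empty -> ground j S k i = 0.
Proof. by rewrite /ground /scale /point => /negPf ->; rewrite mulr0. Qed.

Lemma apply_terms_ground m n j k i l :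
  apply_terms (2 * Delta) Lam m n (ground j) k i l =
  apply_terms (2 * Delta) Lam m n (ground j) k i [seq t <- l | src t == empty].
Proof.
elim: l => //= t l ->; case: ifP => //= /negbT St.
by rewrite /apply_term ground_src // mulr0 add0r.
Qed.

Lemma ground_ofZ c j : ground_of (c *: irr_vec K Lam j) = scale c (ground j).
Proof.
rewrite -[_ *: _]addr0 ground_ofP ground_of0 ground_of_vec.
by apply: model_ext => S k i; rewrite /fcomb /fzero addr0.
Qed.

(** The elements of non-negative index act on the vectors F^j v as they act on U,
    which is what the induced module requires. *)
Lemma rho_ground x j : 0 <= sk_index x ->
  rho x (ground j) = ground_of (irr_img Delta Lam x j).
Proof.
move=> x0.
have trunc0 f : (forall S k i, (0 <= k)%ZZ -> f S k i = 0) -> trunc f = fzero.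
  by move=> f0; apply: model_ext => S k i; rewrite /trunc; case: Z.leb_spec => // /f0.
have src_empty y S : S != empty -> ~~ current_odd y ->
    [seq t <- current_op y S | src t == empty] = [::].
  by case: y => [|[]|] //; case: S => [[[[] []] []] []].
have at_empty y n S k i : ~~ current_odd y -> S != empty ->
    act_op 0 n (current_op y) (ground j) S k i = 0.
  by move=> ey Se; rewrite /apply_op apply_terms_ground src_empty.
have groundE S k i : ground j S k i = (Lam ^_ j)%:R *
    (if [&& S == empty, (k =? 0)%ZZ & (i =? Z.of_nat j)%ZZ] then 1 else 0) by [].
have lvaln n c : lval 0 n (Lin 0 1 c) = (n + c)%ZZ by rewrite /lval; cbn [lin_m lin_n lin_c]; lia.
have onL n k i : act_op 0 n (current_op fL) (ground j) empty k i =
    (2 * zr K k + zr K n * (2 * Delta)) * ground j empty (k + (n + -1))%ZZ (i + 0)%ZZ.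
  rewrite /apply_op apply_terms_ground [filter _ _]/= /= /apply_term.
  cbn [coef src kshift jshift]; rewrite lvaln; cbn [ev valuation];
    rewrite -?[zr K 2]/(1 + 1) -?[zr K (-1)]/(-1) -?[zr K 0]/0 -?[zr K 1]/1; ring.
have onX n k i : [/\
    act_op 0 n (current_op (fX slE)) (ground j) empty k i =
      (zr K i + 1) * ground j empty (k + (n + 0))%ZZ (i + 1)%ZZ,
    act_op 0 n (current_op (fX slF)) (ground j) empty k i =
      (Lam%:R - zr K i + 1) * ground j empty (k + (n + 0))%ZZ (i + -1)%ZZ &
    act_op 0 n (current_op (fX slH)) (ground j) empty k i =
      (Lam%:R - 2 * zr K i) * ground j empty (k + (n + 0))%ZZ (i + 0)%ZZ].
  split; rewrite /apply_op apply_terms_ground [filter _ _]/= /= /apply_term;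
    cbn [coef src kshift jshift]; rewrite lvaln; cbn [ev valuation];
    rewrite -?[zr K 2]/(1 + 1) -?[zr K (-1)]/(-1) -?[zr K 0]/0 -?[zr K 1]/1; ring.
have neg S k i c (e : nat) : (k < 0)%ZZ -> scale c (ground e) S k i = 0.
  move=> k0; rewrite /scale /ground /scale /point; case: Z.eqb_spec => [|_]; first lia.
  by rewrite andbF !mulr0.
have nat0 n : n != 0%N -> (1 <= Z.of_nat n)%ZZ by case: n => // n _; lia.
case: x x0 => [n|a n|a b n] x0.
- have n0 : n != 0%N by case: n x0.
  have -> : irr_img Delta Lam (bL n) j = (if n == 1%N then Delta else 0) *: irr_vec K Lam j.
    by case: n {x0} n0 => [|[|n]] //= _; rewrite scale0r.
  rewrite ground_ofZ; apply: model_ext => S k i; rewrite /rho /trunc.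
  case: Z.leb_spec => k0; last by rewrite neg.
  have [-> | Se] := eqVneq S empty; last by rewrite /scale at_empty // ground_src // !mulr0.
  rewrite /scale [kind _]/= [mode _]/= onL !groundE eqxx zr_nat Z.add_0_r.
  have {}n0 := nat0 n n0; have [n1 | n1] := eqVneq n 1%N.
    rewrite n1; case: (Z.eqb_spec k 0) => [->|k1].
      by rewrite /=; case: ifP => _; rewrite /=; field.
    by case: Z.eqb_spec => [|_]; [lia | rewrite andbF !mulr0].
  case: Z.eqb_spec => [|_]; last by rewrite andbF !(mulr0, mul0r).
  by have : Z.of_nat n <> 1%ZZ; [move/(@Nat2Z.inj n 1)/eqP; apply/negP | lia].
- have [-> | n1] := eqVneq n 0%N; last first.
    have -> : irr_img Delta Lam (bX a n) j = 0 by case: a n {x0} n1 => [] [|n].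
    rewrite ground_of0; apply: trunc0 => S k i k0.
    have [-> | Se] := eqVneq S empty; last by rewrite /scale at_empty // ?mulr0.
    have {}n1 := nat0 n n1; have [oE oF oH] := onX (Z.of_nat n) k i.
    rewrite /scale [kind _]/= [mode _]/=; case: a {x0}; rewrite ?oE ?oF ?oH groundE;
    by case: Z.eqb_spec => [|_]; [lia | rewrite andbF !mulr0].
  apply: model_ext => S k i; rewrite /rho /trunc.
  have imgE : irr_img Delta Lam (bX a 0) j = (match a with
    | slH => Lam%:R - 2 * j%:R | slE => j%:R * (Lam%:R - j%:R + 1) | slF => 1 end) *:
    irr_vec K Lam (match a with slH => j | slE => j.-1 | slF => j.+1 end).
    by case: a {x0}; rewrite //= scale1r.
  rewrite imgE ground_ofZ; case: Z.leb_spec => k0; last by rewrite neg.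
  have [-> | Se] := eqVneq S empty; last by rewrite /scale at_empty // ground_src // !mulr0.
  rewrite /scale [kind _]/= [mode _]/=; have [oE oF oH] := onX (Z.of_nat 0) k i.
  case: a {x0 imgE}; rewrite ?oE ?oF ?oH /ground /scale /point eqxx /= !Z.add_0_r;
    (case: Z.eqb_spec => [_|]; last by rewrite !(mulr0, mul0r)).
  + case: Z.eqb_spec => [->|]; last by rewrite !(mulr0, mul0r).
    by rewrite zr_nat; ring.
  + case: j {onL onX groundE at_empty oE oF oH} => [|j].
      case: Z.eqb_spec => ij; last by rewrite !(mulr0, mul0r).
      by rewrite (_ : i = -1)%ZZ; [rewrite /=; ring | lia].
    have -> : (i + 1 =? Z.of_nat j.+1)%ZZ = (i =? Z.of_nat j)%ZZ.
      by apply/Z.eqb_spec/Z.eqb_spec; lia.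
    case: Z.eqb_spec => [->|]; last by rewrite !(mulr0, mul0r).
    have [le_j | gt_j] := ltnP j Lam.
      by rewrite zr_nat ffactnSr natrM natrB ?(ltnW le_j) // -natr1; ring.
    rewrite ffact_small // !(mulr0, mul0r).
    move: gt_j; rewrite leq_eqVlt => /predU1P[-> | gt_j]; last by rewrite ffact_small // !(mulr0, mul0r).
    by rewrite -natr1; ring.
  + have -> : (i + -1 =? Z.of_nat j)%ZZ = (i =? Z.of_nat j.+1)%ZZ.
      by apply/Z.eqb_spec/Z.eqb_spec; lia.
    case: Z.eqb_spec => [->|]; last by rewrite !(mulr0, mul0r).
    have [le_j | gt_j] := leqP j Lam.
      by rewrite zr_nat ffactnSr natrM natrB // -natr1; ring.
    by rewrite !ffact_small ?(leqW gt_j) // !(mulr0, mul0r).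
- have n0 : n != 0%N by case: n x0.
  have -> : irr_img Delta Lam (bG a b n) j = 0 by [].
  rewrite ground_of0; apply: trunc0 => S k i k0.
  rewrite /scale [kind _]/= [mode _]/=.
  have {}n0 := nat0 n n0.
  suff -> : act_op 0 (Z.of_nat n) (current_op (fG a b)) (ground j) S k i = 0 by rewrite mulr0.
  rewrite /apply_op apply_terms_ground.
  have shiftE : all (fun t => lin_eq (kshift t) ln) [seq t <- current_op (fG a b) S | src t == empty].
    by case: a b S {x0} => [] [] [[[[] []] []] []].
  elim: (filter _ _) shiftE => //= t l IHl.
  case/andP=> /and3P[/Z.eqb_spec t1 /Z.eqb_spec t2 /Z.eqb_spec t3] /IHl ->.
  rewrite addr0 /apply_term groundE; case: Z.eqb_spec => [|_]; last by rewrite andbF !mulr0.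
  by rewrite /lval t1 t2 t3; cbn [ln lin_m lin_n lin_c]; lia.
Qed.

End InducedMap.

Section Phi.
Variables (K : numFieldType) (Delta : K) (Lam : nat).
Local Notation model := (model K).
Local Notation U := 'rV[K]_Lam.+1.
Local Notation row := 'rV[env K]_Lam.+1.
Local Notation rho := (rho Delta Lam).
Local Notation env_act := (env_act Delta Lam).
Local Notation fzero := (fzero K).
Local Notation indM := (indM Delta Lam).
Local Notation ground := (@ground K Lam).
Implicit Types (f g : model) (a b : env K) (t s : row).

Lemma env_act_scalar c f : env_act (in_alg (env K) c) f = scale c f.
Proof.
rewrite -[in_alg _ _]addr0 env_actP env_act1 env_act0.
by apply: model_ext => S k j; rewrite /fcomb /fzero addr0.
Qed.

Lemma env_act_sum a n (F : 'I_n -> model) :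
  env_act a (fun S k j => \sum_i F i S k j) = fun S k j => \sum_i env_act a (F i) S k j.
Proof.
elim: n F => [|n IHn] F.
  rewrite (_ : (fun S k j => _) = fzero); last first.
    by apply: model_ext => S k j; rewrite big_ord0.
  by rewrite env_act_fzero; apply: model_ext => S k j; rewrite big_ord0.
rewrite (_ : (fun S k j => _) = fcomb 1 (F ord0)
   (fun S k j => \sum_i F (lift ord0 i) S k j)).
  rewrite env_act_comb IHn; apply: model_ext => S k j.
  by rewrite /fcomb big_ord_recl mul1r.
by apply: model_ext => S k j; rewrite /fcomb big_ord_recl mul1r.
Qed.

(** U(g) tensor U is the free module of row vectors over U(g), its i-th basis
    vector being F^i v. *)
Definition row_act t : model := fun S k j => \sum_i env_act (t 0 i) (ground i) S k j.

Lemma row_actP a s t : row_act (a *: s + t) = fcomb 1 (env_act a (row_act s)) (row_act t).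
Proof.
rewrite /row_act env_act_sum; apply: model_ext => S k j.
rewrite /fcomb mul1r -big_split; apply: eq_bigr => i _ /=.
rewrite !mxE -[_ * _](scale1r (_ * _ : env K)) env_actP env_actM.
by rewrite /fcomb mul1r.
Qed.

Lemma row_act0 : row_act 0 = fzero.
Proof.
by apply: model_ext => S k j; rewrite /row_act big1 // => i _; rewrite mxE env_act0.
Qed.

Lemma row_act_one (u : U) : row_act (one_tensor u) = ground_of u.
Proof.
apply: model_ext => S k j; apply: eq_bigr => i _.
by rewrite mxE env_act_scalar.
Qed.

Lemma rho_ground_of x (u : U) : 0 <= sk_index x -> rho x (ground_of u) = ground_of (irr_act Delta x u).
Proof.
move=> x0; elim/irr_ind: u => [|c u w IHu IHw|j].
- by rewrite irr_act0 !ground_of0 rho_fzero.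
- by rewrite ground_ofP rho_comb IHu IHw irr_actP ground_ofP.
- by rewrite ground_of_vec irr_act_vec rho_ground.
Qed.

(** The balancing relations are respected by rho_ground. *)
Lemma row_act_balance t : Defs.span (@balance_gen K Delta Lam) t -> row_act t = fzero.
Proof.
elim=> [|a s v [x [u [x0 ->]]] _ IHv]; first exact: row_act0.
rewrite row_actP IHv -[- one_tensor _]scaleN1r addrC.
have -> : row_act (-1 *: one_tensor (irr_act Delta x u) +
    env_inj (sk_gen K x) *: one_tensor u) = fzero.
  rewrite row_actP -[_ *: one_tensor u]addr0 row_actP row_act0 !row_act_one env_act_gen.
  rewrite (rho_ground_of _ x0) -[-1](scaleN1r (1 : env K)) env_act_scalar.
  by apply: model_ext => S k j; rewrite /fcomb /scale /fzero; ring.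
rewrite env_act_fzero; apply: model_ext => S k j.
by rewrite /fcomb /fzero mulr0 addr0.
Qed.

Definition Phi (w : indM) : model := row_act (repr w).

Lemma Phi_proj t : Phi (span_proj (@balance_gen K Delta Lam) t) = row_act t.
Proof.
rewrite /Phi; set s := repr _.
have /span_projE/row_act_balance st0 : span_proj (@balance_gen K Delta Lam) s =
    span_proj (@balance_gen K Delta Lam) t by rewrite span_projK.
have -> : row_act s = row_act (1 *: (s - t) + t) by rewrite scale1r subrK.
rewrite row_actP st0 env_act_fzero.
by apply: model_ext => S k j; rewrite /fcomb /fzero mulr0 add0r.
Qed.

Lemma PhiP a (w z : indM) : Phi (a *: w + z) = fcomb 1 (env_act a (Phi w)) (Phi z).
Proof.
case: (span_projP w) (span_projP z) => s -> [t ->].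
by rewrite -linearZ -raddfD !Phi_proj row_actP.
Qed.

Lemma Phi0 : Phi 0 = fzero.
Proof. by rewrite -(raddf0 (span_proj (@balance_gen K Delta Lam))) Phi_proj row_act0. Qed.

Lemma PhiZ a w : Phi (a *: w) = env_act a (Phi w).
Proof.
rewrite -[_ *: w]addr0 PhiP Phi0; apply: model_ext => S k j.
by rewrite /fcomb /fzero addr0 mul1r.
Qed.

Lemma PhiD w z : Phi (w + z) = fcomb 1 (Phi w) (Phi z).
Proof. by rewrite -[w]scale1r PhiP env_act1 scale1r. Qed.

Lemma Phi_cscale c w : Phi (cscale c w) = scale c (Phi w).
Proof. by rewrite PhiZ env_act_scalar. Qed.

Lemma Phi_tensor a (u : U) : Phi (tensor Delta a u) = env_act a (ground_of u).
Proof.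
rewrite /tensor Phi_proj -[a *: _]addr0 row_actP row_act0 row_act_one.
by apply: model_ext => S k j; rewrite /fcomb /fzero addr0 mul1r.
Qed.

Lemma Phi_gen x w : Phi (env_inj (sk_gen K x) *: w) = rho x (Phi w).
Proof. by rewrite PhiZ env_act_gen. Qed.

End Phi.

(** * A basis of the induced module *)
Section Spanning.
Variables (K : numFieldType) (Delta : K) (Lam : nat).
Local Notation env := (env K).
Local Notation indM := (indM Delta Lam).
Local Notation X x := (env_inj (sk_gen K x)).
Implicit Types (u v : env) (w z : indM).

Lemma env_inj_gen b : X b = env_proj (fa_gen K b).
Proof.
rewrite env_inj.unlock /fa_inj /sk_gen msuppU oner_eq0 big_seq_fset1 mcoeffUU.
by rewrite scale1r.
Qed.

Lemma env_injE (a : {malg K[sk_basis]}) : env_inj a = \sum_(b <- msupp a) a@_b *: X b.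
Proof.
under eq_bigr do rewrite env_inj_gen.
rewrite env_inj.unlock /fa_inj raddf_sum; apply: eq_bigr => b _.
by rewrite -env_projZ.
Qed.

Lemma env_comm x y : X x * X y =
  (-1) ^+ (sk_odd x && sk_odd y) * (X y * X x) + env_inj (sk_bracket K x y).
Proof.
apply/eqP; rewrite -subr_eq0 !env_inj_gen env_inj.unlock -!env_projM.
have -> : (-1) ^+ (sk_odd x && sk_odd y) = @env_proj K ((-1) ^+ (sk_odd x && sk_odd y)).
  by rewrite (rmorphXn (@env_proj K)) (rmorphN1 (@env_proj K)).
rewrite -env_projM -raddfD -raddfB opprD addrA; apply/eqP.
rewrite -[RHS](raddf0 (@env_proj K)); apply/env_projE; rewrite subr0.
by apply: span_gen; exists 1, 1, x, y; rewrite mul1r mulr1.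
Qed.

Lemma cscaleA c e w : cscale c (cscale e w) = cscale (c * e) w.
Proof. by rewrite /cscale scalerA -scalerAl mul1r scalerA. Qed.
Lemma cscaleDr c w z : cscale c (w + z) = cscale c w + cscale c z.
Proof. exact: scalerDr. Qed.
Lemma cscaleDl c e w : cscale (c + e) w = cscale c w + cscale e w.
Proof. by rewrite /cscale scalerDl scalerDl. Qed.
Lemma cscale0r c : cscale c (0 : indM) = 0. Proof. exact: scaler0. Qed.
Lemma cscale0l w : cscale 0 w = 0. Proof. by rewrite /cscale !scale0r. Qed.
Lemma cscale1 w : cscale 1 w = w. Proof. by rewrite /cscale scale1r scale1r. Qed.
Lemma scale_cscale u c w : u *: cscale c w = cscale c (u *: w).
Proof. by rewrite /cscale !scalerA -scalerAr mulr1 -scalerAl mul1r. Qed.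
Lemma cscale_alg c u w : (c *: u) *: w = cscale c (u *: w).
Proof. by rewrite /cscale scalerA -scalerAl mul1r. Qed.

Definition letter_elt (i : letter) : sk_basis :=
  match i with
  | Thm => bG false true 0 | Thp => bG true true 0
  | Etp => bG true false 0 | Etm => bG false false 0
  end.

(** The basis vectors have the powers of ∂ first and then the letters in the order
    of the components of a state. *)
Definition word (k : nat) (S : state) : seq sk_basis :=
  let: (a, b, c, d) := S in
  nseq k (bL 0) ++ [seq letter_elt i.2 | i <- [:: (a, Thm); (b, Thp); (c, Etp); (d, Etm)] & i.1].

Definition act_word (s : seq sk_basis) w : indM := foldr (fun x z => X x *: z) w s.

Definition bas (k : nat) (S : state) (j : nat) : indM :=
  act_word (word k S) (tensor Delta 1 (irr_vec K Lam j)).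

(** The span of the vectors bas over the field. *)
Inductive spn : indM -> Prop :=
| spn0 : spn 0
| spn_cons c k S (j : 'I_Lam.+1) w : spn w -> spn (cscale c (bas k S j) + w).

Lemma spn_bas k S j : spn (bas k S j).
Proof.
have [lt_j | gt_j] := ltnP j Lam.+1; last first.
  rewrite /bas irr_vec_gt // /tensor /one_tensor map_mx0 scaler0 raddf0.
  elim: (word k S) => [|x s IHs] /=; first exact: spn0.
  suff -> : act_word s 0 = 0 by rewrite scaler0; exact: spn0.
  by elim: s {IHs} => //= y s ->; rewrite scaler0.
rewrite -[bas _ _ _]addr0 -[bas _ _ _]cscale1.
exact: (spn_cons 1 k S (Ordinal lt_j) spn0).
Qed.

Lemma spnD w z : spn w -> spn z -> spn (w + z).
Proof.
elim=> [|c k S j {}w _ IHw] sz; first by rewrite add0r.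
by rewrite -addrA; apply/spn_cons/IHw.
Qed.

Lemma spnZ c w : spn w -> spn (cscale c w).
Proof.
elim=> [|e k S j {}w _ IHw]; first by rewrite cscale0r; exact: spn0.
by rewrite cscaleDr cscaleA; apply: spn_cons.
Qed.

Lemma spnN w : spn w -> spn (- w).
Proof. by move/(spnZ (-1)); rewrite /cscale !scaleN1r. Qed.

Definition stable u := forall w, spn w -> spn (u *: w).

Lemma stable_bas u : (forall k S j, spn (u *: bas k S j)) -> stable u.
Proof.
move=> ub w; elim=> [|c k S j {}w _ IHw]; first by rewrite scaler0; exact: spn0.
by rewrite scalerDr scale_cscale; apply: spnD => //; apply/spnZ/ub.
Qed.

Lemma stableP c u v : stable u -> stable v -> stable (c *: u + v).
Proof.
move=> su sv w sw; rewrite scalerDl cscale_alg.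
by apply: spnD; [apply/spnZ/su | apply: sv].
Qed.

Lemma stableM u v : stable u -> stable v -> stable (u * v).
Proof. by move=> su sv w sw; rewrite -scalerA; apply/su/sv. Qed.

Lemma stable_inj (a : {malg K[sk_basis]}) w :
  (forall x, spn (X x *: w)) -> spn (env_inj a *: w).
Proof.
move=> sx; rewrite env_injE; elim: (enum_fset _) => [|b s IHs].
  by rewrite big_nil scale0r; exact: spn0.
by rewrite big_cons scalerDl cscale_alg; apply: spnD => //; apply: spnZ.
Qed.

Lemma stable_partial : stable (X (bL 0)).
Proof. by apply: stable_bas => k [[[a b] c] d] j; apply: (spn_bas k.+1 (a, b, c, d)). Qed.

Lemma env_inj0 : env_inj (0 : {malg K[sk_basis]}) = 0.
Proof. by rewrite env_injE msupp0 big_seq_fset0. Qed.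

Lemma env_injZ c (a : {malg K[sk_basis]}) : env_inj (c *: a) = c *: env_inj a.
Proof.
have [-> | c0] := eqVneq c 0; first by rewrite !scale0r env_inj0.
rewrite !env_injE msuppZ (negPf c0) scaler_sumr.
by apply: eq_bigr => b _; rewrite mcoeffZ scalerA.
Qed.

Lemma env_injD (a b : {malg K[sk_basis]}) : env_inj (a + b) = env_inj a + env_inj b.
Proof.
have injEw (c : {malg K[sk_basis]}) : (msupp c `<=` msupp a `|` msupp b)%fset ->
    env_inj c = \sum_(i <- (msupp a `|` msupp b)%fset) c@_i *: X i.
  move=> sub; rewrite env_injE; apply: big_fset_incl => // i _ /mcoeff_outdom ->.
  by rewrite scale0r.
rewrite !injEw ?fsubsetUl ?fsubsetUr ?msuppD_le // -big_split.
by apply: eq_bigr => i _; rewrite mcoeffD scalerDl.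
Qed.

Lemma env_injN (a : {malg K[sk_basis]}) : env_inj (- a) = - env_inj a.
Proof. by rewrite -scaleN1r env_injZ scaleN1r. Qed.

(** The negative part is a Heisenberg superalgebra: ∂ is central in it, and
    letter_comm gives the brackets of the letters. *)
Lemma letter_partial i : X (letter_elt i) * X (bL 0) = X (bL 0) * X (letter_elt i).
Proof.
have b0 : ((0%:Z - 1)%:~R / 2 - (0%:R - 2^-1) : K) = 0 by rewrite /=; field.
by rewrite env_comm andbF expr0 mul1r; case: i; cbn [letter_elt sk_bracket];
  rewrite b0 scale0r oppr0 env_inj0 addr0.
Qed.

Lemma eq_opp0 (V : lmodType K) (t : V) : t = - t -> t = 0.
Proof.
move=> t_opp; have -> : t = 2^-1 *: (t + t).
  by rewrite -mulr2n -scaler_nat scalerA mulVf ?scale1r ?pnatr_eq0.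
by rewrite {1}t_opp addNr scaler0.
Qed.

Lemma letter_square i : X (letter_elt i) * X (letter_elt i) = 0.
Proof.
have e2 : X (letter_elt i) * X (letter_elt i) = - (X (letter_elt i) * X (letter_elt i)).
  by rewrite {1}env_comm; case: i; rewrite /= expr1 mulN1r env_inj0 addr0.
exact: eq_opp0 e2.
Qed.

Lemma letter_comm i i' :
  X (letter_elt i) * X (letter_elt i') = - (X (letter_elt i') * X (letter_elt i))
    + (match i, i' with
       | Etm, Thp | Thp, Etm => - 2 | Etp, Thm | Thm, Etp => 2 | _, _ => 0 end)
    *: X (bL 0).
Proof.
rewrite env_comm.
have -> : sk_odd (letter_elt i) && sk_odd (letter_elt i') by case: i i' => [] [].
rewrite expr1 mulN1r; congr (_ + _).
have LE : eL K (0%:Z + 0%:Z - 1) = sk_gen K (bL 0) by [].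
by case: i i' => [] [];
  cbn [letter_elt sk_bracket odd_bracket];
  rewrite ?LE ?subrr ?mulr0 ?scale0r ?oppr0 ?add0r ?env_injN ?env_injZ ?env_inj0 ?scaleNr.
Qed.

Lemma act_word_cat s s' w : act_word (s ++ s') w = act_word s (act_word s' w).
Proof. exact: foldr_cat. Qed.

Lemma spn_act_word s w :
  (forall x, x \in s -> stable (X x)) -> spn w -> spn (act_word s w).
Proof.
move=> st sw; elim: s st => //= x s IHs st; apply: (st x); rewrite ?mem_head //.
by apply: IHs => y ys; apply: st; rewrite in_cons ys orbT.
Qed.

(** Moving a letter past another one produces a multiple of ∂, under which the span
    is stable. *)
Lemma letter_step i i' w : stable (X (letter_elt i')) -> spn w ->
  spn (X (letter_elt i) *: w) -> spn (X (letter_elt i) *: (X (letter_elt i') *: w)).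
Proof.
move=> st sw siw; rewrite scalerA letter_comm scalerDl scaleNr cscale_alg -scalerA.
apply: spnD; first by apply/spnN/st.
exact/spnZ/stable_partial.
Qed.

(** A letter is first moved past the powers of ∂, then past the letters in front of
    its place; it either fills its place or squares to zero there. The letters are
    treated in their order, since each needs the stability under the earlier
    ones. *)
Lemma stable_letter i : stable (X (letter_elt i)).
Proof.
pose tail S j := bas 0 S j.
have on_tail l : (forall S j, spn (X (letter_elt l) *: tail S j)) -> stable (X (letter_elt l)).
  move=> st; apply: stable_bas => k S j.
  have -> : bas k S j = act_word (nseq k (bL 0)) (tail S j).
    by rewrite /tail /bas -act_word_cat; case: S => [[[a b] c] d].
  have -> : X (letter_elt l) *: act_word (nseq k (bL 0)) (tail S j) =
            act_word (nseq k (bL 0)) (X (letter_elt l) *: tail S j).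
    elim: k => //= k <-; by rewrite !scalerA letter_partial.
  apply: spn_act_word => // x /nseqP[-> _]; exact: stable_partial.
have sq l w : X (letter_elt l) *: (X (letter_elt l) *: w) = 0.
  by rewrite scalerA letter_square scale0r.
have sA : stable (X (letter_elt Thm)).
  apply: on_tail => -[[[a b] c] d] j; case: a; last exact: (spn_bas 0 (true, b, c, d) j).
  by rewrite [tail _ _]/(X (letter_elt Thm) *: _) sq; exact: spn0.
have sB : stable (X (letter_elt Thp)).
  apply: on_tail => -[[[a b] c] d] j.
  have B0 : spn (X (letter_elt Thp) *: tail (false, b, c, d) j).
    case: b; last exact: (spn_bas 0 (false, true, c, d) j).
    by rewrite [tail _ _]/(X (letter_elt Thp) *: _) sq; exact: spn0.
  by case: a => //; exact: letter_step sA (spn_bas 0 (false, b, c, d) j) B0.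
have sC : stable (X (letter_elt Etp)).
  apply: on_tail => -[[[a b] c] d] j.
  have C0 : spn (X (letter_elt Etp) *: tail (false, false, c, d) j).
    case: c; last exact: (spn_bas 0 (false, false, true, d) j).
    by rewrite [tail _ _]/(X (letter_elt Etp) *: _) sq; exact: spn0.
  have CB : spn (X (letter_elt Etp) *: tail (false, b, c, d) j).
    by case: b => //; exact: letter_step sB (spn_bas 0 (false, false, c, d) j) C0.
  by case: a => //; exact: letter_step sA (spn_bas 0 (false, b, c, d) j) CB.
case: i => //; apply: on_tail => -[[[a b] c] d] j.
have D0 : spn (X (letter_elt Etm) *: tail (false, false, false, d) j).
  case: d; last exact: (spn_bas 0 (false, false, false, true) j).
  by rewrite [tail _ _]/(X (letter_elt Etm) *: _) sq; exact: spn0.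
have DC : spn (X (letter_elt Etm) *: tail (false, false, c, d) j).
  by case: c => //; exact: letter_step sC (spn_bas 0 (false, false, false, d) j) D0.
have DB : spn (X (letter_elt Etm) *: tail (false, b, c, d) j).
  by case: b => //; exact: letter_step sB (spn_bas 0 (false, false, c, d) j) DC.
by case: a => //; exact: letter_step sA (spn_bas 0 (false, b, c, d) j) DB.
Qed.

Lemma tensor_gen x (u : 'rV[K]_Lam.+1) : 0 <= sk_index x ->
  X x *: tensor Delta 1 u = tensor Delta 1 (irr_act Delta x u).
Proof.
move=> x0; rewrite /tensor !scale1r -linearZ; apply/span_projE.
by apply: span_gen; exists x, u.
Qed.

Lemma spn_tensor (u : 'rV[K]_Lam.+1) : spn (tensor Delta 1 u).
Proof.
elim/irr_ind: u => [|c u w IHu IHw|j].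
- by rewrite /tensor /one_tensor map_mx0 scaler0 raddf0; exact: spn0.
- have -> : tensor Delta 1 (c *: u + w) = cscale c (tensor Delta 1 u) + tensor Delta 1 w.
    rewrite /tensor /cscale !scale1r -linearZ -raddfD; congr span_proj.
    by apply/rowP => i; rewrite !mxE rmorphD rmorphM.
  by apply: spnD => //; apply: spnZ.
- exact: (spn_bas 0 empty j).
Qed.

(** By induction on the word, for all basis elements y at once: y passes the first
    letter z, the commutator is a combination of basis elements applied to a shorter
    word, and at the end of the word y acts on U. *)
Lemma stable_gen x : stable (X x).
Proof.
pose neg (y : sk_basis) := y = bL 0 \/ exists i, y = letter_elt i.
have neg_stable y : neg y -> stable (X y).
  by case=> [-> | [i ->]]; [exact: stable_partial | exact: stable_letter].
have pos y : neg y \/ 0 <= sk_index y.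
  case: y => [[|n]|a n|a b [|n]]; try by right; rewrite /= ?ler0n ?subr_ge0 ?ler1n.
  - by left; left.
  - left; right; case: a b => [] [];
      by [exists Thp | exists Etp | exists Thm | exists Etm].
  - by right; rewrite /= subr_ge0 (le_trans (y := 1)) ?ler1n // invf_le1 ?ler1n.
have on_word s (u : 'rV[K]_Lam.+1) y : (forall t, t \in s -> neg t) ->
    spn (X y *: act_word s (tensor Delta 1 u)).
  elim: s y => [|z s IHs] y ns /=.
    case: (pos y) => [/neg_stable|y0]; first by apply; apply: spn_tensor.
    by rewrite tensor_gen //; apply: spn_tensor.
  have nz : neg z by apply: ns; rewrite mem_head.
  have {}ns t : t \in s -> neg t by move=> ts; apply: ns; rewrite in_cons ts orbT.
  have {}IHs t := IHs t ns.
  rewrite scalerA env_comm scalerDl; apply: spnD; last exact: stable_inj.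
  have -> : (-1) ^+ (sk_odd y && sk_odd z) * (X z * X y) =
      ((-1) ^+ (sk_odd y && sk_odd z) : K) *: (X z * X y).
    by case: (_ && _); rewrite ?expr1 ?expr0 ?mulN1r ?scaleN1r ?mul1r ?scale1r.
  by rewrite cscale_alg -scalerA; apply/spnZ/neg_stable.
apply: stable_bas => k [[[a b] c] d] j; apply: on_word => y.
rewrite mem_cat => /orP[/nseqP[-> _] | ]; first by left.
elim: [:: _; _; _; _] => //= -[[] i] s IHs //=; rewrite inE => /orP[/eqP -> | //].
by right; exists i.
Qed.

Lemma stable_env u : stable u.
Proof.
case: (env_projP u) => a ->; elim/fa_ind: a => [|c m a IHa].
  by move=> w _; rewrite raddf0 scale0r; exact: spn0.
rewrite linearP /=; apply: stableP => //.
case: m => m; elim: m => [|x m IHm].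
  suff -> : @env_proj K << FMonom [::] >> = 1 by move=> w; rewrite scale1r.
  congr env_proj; congr (<< _ >>); apply/eqP; by rewrite -val_eqE /= fm1.
have -> : (<< FMonom (x :: m) >> : free_alg K) = fa_gen K x * (<< FMonom m >> : free_alg K).
  rewrite fa_mulE malgM_def fgmulUU mulr1; congr (<< _ >>).
  by apply/eqP; rewrite -val_eqE /= fmM fmU.
by rewrite env_projM -env_inj_gen; apply: stableM => //; apply: stable_gen.
Qed.

Lemma indM_spanned w : spn w.
Proof.
case: (span_projP w) => t ->.
have -> : t = \sum_i t 0 i *: one_tensor (irr_vec K Lam i).
  apply/rowP => l; rewrite summxE (bigD1 l) //= !mxE eqxx big1 ?addr0.
    by rewrite /= scale1r mulr1.
  move=> i ne_il; rewrite !mxE eq_sym -[_ == _]/(i == l) (negPf ne_il).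
  by rewrite rmorph0 mulr0.
rewrite raddf_sum /=; apply: big_ind => [||i _]; [exact: spn0 | exact: spnD |].
rewrite linearZ; apply: stable_env.
have := spn_tensor (irr_vec K Lam i); by rewrite /tensor scale1r.
Qed.

End Spanning.

(** * Linear independence of the basis *)
Section Injectivity.
Variables (K : numFieldType) (Delta : K) (Lam : nat).
Local Notation model := (model K).
Local Notation indM := (indM Delta Lam).
Local Notation act_op := (apply_op (2 * Delta) Lam).
Local Notation rho := (rho Delta Lam).
Local Notation word_act := (word_act Delta Lam).
Local Notation Phi := (@Phi K Delta Lam).
Local Notation bas := (@bas K Delta Lam).
Local Notation point := (@point K).

(** The zero modes of the odd currents. *)
Definition creation (i : letter) : op :=
  match i with
  | Thm => lmul Thm
  | Thp => lmul Thp
  | Etp => lmul Etp + 2 *: (opS * lder Thm)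
  | Etm => lmul Etm - 2 *: (opS * lder Thp)
  end%OP.

Lemma rho_letter i f :
  rho (letter_elt i) f = trunc (act_op 0 0 (creation i) f).
Proof.
have modeE A : act_op 0 0 A f = act_op 0 0 (at_mode (lin_cst 0) A) f.
  by rewrite apply_at_mode.
apply: trunc_eqP => S k j _; rewrite /scale.
have -> : halve K (kind (letter_elt i)) = 1 by case: i.
have -> : Z.of_nat (mode (letter_elt i)) = 0%ZZ by case: i.
rewrite mul1r (modeE (current_op _)); congr (_ S k j); apply: op_eqE; by case: i; vm_compute.
Qed.

Lemma rho_partial f : rho (bL 0) f = trunc (act_op 0 0 opS f).
Proof.
apply: trunc_eqP => S k j _; rewrite /scale [kind _]/= [mode _]/=.
have E : op_eq (at_mode (lin_cst 0) (current_op fL)) (2 *: opS)%OP by vm_compute.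
have -> : act_op 0 0 (current_op fL) f = act_op 0 0 (2 *: opS)%OP f.
  by rewrite -(op_eqE _ _ _ _ _ E) apply_at_mode.
by rewrite apply_opZ mulrA /= mulVf ?mul1r // pnatr_eq0.
Qed.

(** A letter that comes before all letters of S is added to S without any sign or
    correction, so that words build up delta functions. *)
Lemma rho_letter_point i S k j : (0 <= k)%ZZ ->
    (let: (a, b, c, d) := S in match i with
     | Thm => ~~ a | Thp => ~~ (a || b) | Etp => ~~ [|| a, b | c]
     | Etm => ~~ [|| a, b, c | d] end) ->
  rho (letter_elt i) (point S k j) = point (toggle i S) k j.
Proof.
move=> k0 iS; rewrite rho_letter; apply: model_ext => T k' j'; rewrite /trunc.
case: Z.leb_spec => k'0; last first.
  by rewrite /point; case: (Z.eqb_spec k'); [lia | rewrite andbF].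
case: S i iS T => [[[[] []] []] []] [] // _ [[[[] []] []] []];
  rewrite /apply_op /= /apply_term /point /lval /= ?Z.add_0_r;
  by rewrite ?(mulr0, addr0, mul1r).
Qed.

Lemma rho_partial_point S k j : (0 <= k)%ZZ ->
  rho (bL 0) (point S k j) = scale (zr K (k + 1)) (point S (k + 1) j).
Proof.
move=> k0; rewrite rho_partial; apply: model_ext => T k' j'.
rewrite /trunc /scale /apply_op /= /apply_term /point /lval.
cbn [coef src kshift jshift lin_cst lin_m lin_n lin_c ev valuation].
rewrite addr0 Z.add_0_r (_ : (_ =? k)%ZZ = (k' =? k + 1)%ZZ); last first.
  by apply/Z.eqb_spec/Z.eqb_spec; lia.
case: (Z.eqb_spec k' (k + 1)) => [->|_]; last by rewrite andbF !mulr0; case: ifP.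
by rewrite (introT (Z.leb_spec0 _ _)) //; lia.
Qed.

Lemma word_act_scale s c f : word_act s (scale c f) = scale c (word_act s f).
Proof.
have scaleE g : scale c g = fcomb c g (fzero K).
  by apply: model_ext => S k j; rewrite /fcomb /fzero addr0.
by rewrite !scaleE word_act_comb word_act0.
Qed.

Lemma word_act_point k S j :
  word_act (word k S) (point empty 0 j) = scale k`!%:R (point S (Z.of_nat k) j).
Proof.
have -> : word_act (word k S) (point empty 0 j) = word_act (nseq k (bL 0)) (point S 0 j).
  rewrite /word_act; case: S => [[[a b] c] d]; rewrite foldr_cat; congr foldr.
  by case: a b c d => [] [] [] []; cbn [map filter foldr fst snd]; rewrite ?rho_letter_point.
elim: k => [|k IHk].
  by apply: model_ext => T k j'; rewrite /scale mul1r.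
rewrite -[LHS]/(rho (bL 0) (word_act (nseq k (bL 0)) (point S 0 j))) IHk.
have := word_act_scale [:: bL 0]; rewrite /word_act /= => ->.
rewrite rho_partial_point; last exact: Zle_0_nat.
rewrite Z.add_1_r -Nat2Z.inj_succ zr_nat factS mulnC natrM.
by apply: model_ext => T k' j'; rewrite /scale mulrA.
Qed.

Lemma Phi_act_word s w : Phi (act_word s w) = word_act s (Phi w).
Proof. by elim: s => //= x s IHs; rewrite Phi_gen IHs. Qed.

Lemma Phi_bas k S j :
  Phi (bas k S j) = scale (k`! * Lam ^_ j)%:R (point S (Z.of_nat k) (Z.of_nat j)).
Proof.
rewrite /bas Phi_act_word Phi_tensor env_act1 ground_of_vec /ground.
rewrite word_act_scale word_act_point natrM.
by apply: model_ext => T k' j'; rewrite /scale mulrA (mulrC (Lam ^_ j)%:R).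
Qed.

(** A left inverse of Phi on the vectors whose power of ∂ is less than N. *)
Definition Psi (N : nat) (f : model) : indM :=
  \sum_(k < N) \sum_(S <- states) \sum_(j < Lam.+1)
    cscale (f S (Z.of_nat k) (Z.of_nat j) / (k`! * Lam ^_ j)%:R) (bas k S j).

Lemma PsiP N c f g : Psi N (fcomb c f g) = cscale c (Psi N f) + Psi N g.
Proof.
rewrite /Psi /cscale scaler_sumr -big_split; apply: eq_bigr => k _ /=.
rewrite scaler_sumr -big_split; apply: eq_bigr => S _ /=.
rewrite scaler_sumr -big_split; apply: eq_bigr => j _ /=.
rewrite -!/(cscale _ _) cscaleA -cscaleDl /fcomb; congr cscale.
by rewrite mulrDl mulrA.
Qed.

Lemma states_uniq : uniq states. Proof. by []. Qed.

Lemma Psi_bas N k S (j : 'I_Lam.+1) : (k < N)%N -> Psi N (Phi (bas k S j)) = bas k S j.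
Proof.
move=> lt_kN; rewrite Phi_bas /Psi (bigD1 (Ordinal lt_kN)) //= [Y in _ + Y]big1 ?addr0.
  rewrite (bigD1_seq S) ?mem_states ?states_uniq //= [Y in _ + Y]big1 ?addr0.
    rewrite (bigD1 j) //= [Y in _ + Y]big1 ?addr0.
      rewrite /scale /point eqxx !Z.eqb_refl mulr1 divff ?cscale1 //.
      rewrite pnatr_eq0 -lt0n muln_gt0 fact_gt0 ffact_gt0 -ltnS ltn_ord //.
    move=> i ne_ij; rewrite /scale /point eqxx.
    case: (Z.eqb_spec (Z.of_nat i)) => [/Nat2Z.inj/val_inj/eqP|_].
      by rewrite (negPf ne_ij).
    by rewrite andbF mulr0 mul0r cscale0l.
  move=> T ne_TS; rewrite big1 // => i _.
  by rewrite /scale /point (negPf ne_TS) mulr0 mul0r cscale0l.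
move=> i ne_ik; rewrite big1 // => T _; rewrite big1 // => l _.
rewrite /scale /point; case: (Z.eqb_spec (Z.of_nat i)) => [/Nat2Z.inj ik|_].
  by case/negP: ne_ik; apply/eqP/val_inj.
by rewrite andbF mulr0 mul0r cscale0l.
Qed.

(** Every vector is a finite combination of the vectors bas, so it is recovered by
    Psi N for N large enough. *)
Lemma Phi_inj w : Phi w = fzero K -> w = 0.
Proof.
have [N Nw] : exists N, forall M, (N <= M)%N -> Psi M (Phi w) = w.
  elim: {w} (indM_spanned w) => [|c k S j w _ [N IHw]].
    exists 0%N => M _; rewrite Phi0 (fzeroE (fzero K)) PsiP.
    by rewrite /cscale !scaleN1r addNr.
  exists (maxn N k.+1) => M; rewrite geq_max => /andP[NM kM].
  rewrite PhiD Phi_cscale.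
  have -> : fcomb 1 (scale c (Phi (bas k S j))) (Phi w) = fcomb c (Phi (bas k S j)) (Phi w).
    by apply: model_ext => T k' j'; rewrite /fcomb /scale mul1r.
  by rewrite PsiP IHw // Psi_bas.
move=> w0; rewrite -(Nw N (leqnn N)) w0 (fzeroE (fzero K)) PsiP.
by rewrite /cscale !scaleN1r addNr.
Qed.

Lemma Phi_eq w z : Phi w = Phi z -> w = z.
Proof.
move=> wz; apply/eqP; rewrite -subr_eq0 addrC -scaleN1r; apply/eqP/Phi_inj.
rewrite PhiP wz -[-1](scaleN1r (1 : env K)) env_act_scalar.
by apply: model_ext => S k j; rewrite /fcomb /scale /fzero; ring.
Qed.

End Injectivity.

(** * Singular vectors as solutions of a linear system *)
Section System.
Variables (K : numFieldType) (Delta : K) (Lam : nat).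
Local Notation model := (model K).
Local Notation act_op := (apply_op (2 * Delta) Lam).
Local Notation rho := (rho Delta Lam).
Local Notation Phi := (@Phi K Delta Lam).
Local Notation point := (@point K).
Implicit Types (f g : model) (A B : op).

Definition bz (b : bool) : Z := if b then 1%ZZ else 0%ZZ.
(** Half the degree 2k + deg S is the energy above Delta, and wt S - 2j is the
    sl_2-weight relative to Lambda. *)
Definition deg (S : state) : Z :=
  let: (a, b, c, d) := S in (bz a + bz b + bz c + bz d)%ZZ.
Definition wt (S : state) : Z :=
  let: (a, b, c, d) := S in (bz b + bz c - bz a - bz d)%ZZ.

Lemma Phi_support w S k j : Phi w S k j != 0 ->
  (0 <= k)%ZZ /\ (0 <= j <= Z.of_nat Lam)%ZZ.
Proof.
elim: {w} (indM_spanned w) => [|c k0 S0 j0 w _ IHw]; first by rewrite Phi0 /fzero eqxx.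
rewrite PhiD Phi_cscale Phi_bas /fcomb /scale mul1r.
have [-> | w0] := eqVneq (Phi w S k j) 0; last by move=> _; apply: IHw.
rewrite addr0 /point; case: (Z.eqb_spec k) => [->|_]; last by rewrite andbF !mulr0 eqxx.
case: (Z.eqb_spec j) => [-> _|_]; last by rewrite !andbF !mulr0 eqxx.
by have := ltn_ord j0; rewrite ltnS => /ssrnat.leP; lia.
Qed.

Definition kills A f := forall S k j, (0 <= k)%ZZ -> act_op 0 0 A f S k j = 0.

(** The operators of E_0, of twice L_0 and of H_0, and of the modes G^(ab)_(1/2)
    and X_1. *)
Definition E0 : op := (EtaE + ThE)%OP.
Definition D1 : op := opD (lin_cst 1).
Definition grade : op := fun S => [:: Term (2 * Var Vk + Cst (deg S) + Var Vd) S l0 0].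
Definition weight : op := fun S => [:: Term (Var VL - 2 * Var Vj + Cst (wt S)) S l0 0].
Definition G1 (a b : bool) : op :=
  match a, b with
  | true, true => D1 * lmul Thp + Rp
  | false, true => D1 * lmul Thm + Rm
  | true, false => D1 * lmul Etp + 2 *: (opS * D1 * lder Thm) + Tp
  | false, false => D1 * lmul Etm - 2 *: (opS * D1 * lder Thp) + Tm
  end%OP.
Definition X1 (a : sl2_basis) : op :=
  match a with
  | slH => D1 * (EtaH + ThH) + (Rp * lder Thp - Rm * lder Thm)
  | slE => D1 * (EtaE + ThE) + Rp * lder Thm
  | slF => D1 * (EtaF + ThF) + Rm * lder Thp
  end%OP.

Lemma rho_mode x A f : op_eq (at_mode (lin_cst (Z.of_nat (mode x))) (current_op (kind x))) A ->
  rho x f = trunc (scale (halve K (kind x)) (act_op 0 0 A f)).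
Proof.
move=> xA; rewrite -(op_eqE _ _ _ _ _ xA) apply_at_mode /rho.
by rewrite (_ : lval 0 0 _ = Z.of_nat (mode x)) // /lval; cbn [lin_cst lin_m lin_n lin_c]; lia.
Qed.

Lemma rho_killsP x A f :
  op_eq (at_mode (lin_cst (Z.of_nat (mode x))) (current_op (kind x))) A ->
  rho x f = fzero K <-> kills A f.
Proof.
move=> /rho_mode xA; rewrite xA; split=> [f0 S k j k0 | kA].
  have := congr1 (fun g => g S k j) f0; rewrite /trunc (introT (Z.leb_spec0 _ _) k0).
  rewrite /scale /fzero => /eqP; rewrite mulf_eq0 => /orP[|/eqP //].
  by case: (kind x) => [|a|a b]; rewrite /halve ?oner_eq0 // invr_eq0 pnatr_eq0.
apply: model_ext => S k j; rewrite /trunc /scale; case: Z.leb_spec => // k0.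
by rewrite kA // mulr0.
Qed.

Lemma kills_add A B f : kills A f -> kills B f -> kills (A + B)%OP f.
Proof. by move=> kA kB S k j k0; rewrite apply_opD kA // kB // addr0. Qed.

Lemma kills_scale c A f : kills A f -> kills (c *: A)%OP f.
Proof. by move=> kA S k j k0; rewrite apply_opZ kA // mulr0. Qed.

Lemma kills_der i A f : kills A f -> kills (lder i * A)%OP f.
Proof.
move=> kA S k j k0; rewrite apply_opM {1}/apply_op /lder.
case: ifP => _ //=; rewrite /apply_term kA ?mulr0 ?addr0 //.
rewrite /lval; cbn [kshift l0 lin_cst lin_m lin_n lin_c]; lia.
Qed.

Lemma kills_eq A B f : op_eq A B -> kills A f -> kills B f.
Proof. by move=> AB kA S k j k0; rewrite -(op_eqE _ _ _ _ _ AB) kA. Qed.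

(** The diagonal operator Lambda - 2j + (weight of the G^(+-), G^(--) part),
    followed by the derivative in ∂. *)
Definition DH := (D1 * EtaH)%OP.

Section Derived.
Variable f : model.
Hypothesis kG : forall a b, kills (G1 a b) f.
Hypothesis kX : forall a, kills (X1 a) f.

(** In H_1 + (d/dG^(++)) G^(++)_(1/2) - (d/dG^(-+)) G^(-+)_(1/2) all contributions
    which are not diagonal cancel. *)
Lemma kills_DH : kills DH f.
Proof.
apply: (@kills_eq (X1 slH + lder Thp * G1 true true - lder Thm * G1 false true)%OP).
  by vm_compute.
by apply: kills_add; [apply: kills_add | apply: kills_scale] => //; apply: kills_der.
Qed.

End Derived.

(** The coordinate functions of given degree and weight are parametrized by one
    scalar for each state, since S determines k and j. *)
Definition graded (N J : Z) (x : state -> K) : model := fun S k j =>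
  if (2 * k + deg S =? N)%ZZ && (2 * j - wt S =? J)%ZZ then x S else 0.

Definition term_has_degree S dN dJ (t : term) : bool :=
  [&& (lin_m (kshift t) =? 0)%ZZ, (lin_n (kshift t) =? 0)%ZZ,
      (2 * lin_c (kshift t) + deg (src t) =? deg S - dN)%ZZ &
      (2 * jshift t - wt (src t) =? - wt S - dJ)%ZZ].

Definition has_degree A dN dJ : bool :=
  all (fun S => all (term_has_degree S dN dJ) (A S)) states.

(** The row of A at (S, k, j), applied to such a family of scalars. *)
Definition coeffs A (x : state -> K) (S : state) (k j : Z) : K :=
  foldr (fun t a => ev (valuation (2 * Delta) Lam 0 0 k j) (coef t) * x (src t) + a) 0 (A S).

Lemma apply_graded A dN dJ N J x S k j : has_degree A dN dJ ->
  act_op 0 0 A (graded N J x) S k j =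
  if (2 * k + deg S =? N + dN)%ZZ && (2 * j - wt S =? J + dJ)%ZZ
  then coeffs A x S k j else 0.
Proof.
move=> /allP/(_ S (mem_states S)); rewrite /apply_op /coeffs.
elim: (A S) => /= [|t l IHl]; first by case: ifP.
case/andP=> /and4P[/Z.eqb_spec tm /Z.eqb_spec tn /Z.eqb_spec tc /Z.eqb_spec tj] /IHl ->.
rewrite /apply_term /graded.
have -> : (2 * (k + lval 0 0 (kshift t)) + deg (src t) =? N)%ZZ = (2 * k + deg S =? N + dN)%ZZ.
  by apply/Z.eqb_spec/Z.eqb_spec; rewrite /lval tm tn; lia.
have -> : (2 * (j + jshift t) - wt (src t) =? J)%ZZ = (2 * j - wt S =? J + dJ)%ZZ.
  by apply/Z.eqb_spec/Z.eqb_spec; lia.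
by case: ifP => _; rewrite ?mulr0 ?addr0.
Qed.

(** The killing condition is one linear equation for each state. *)
Lemma kills_gradedP A dN dJ N J x : has_degree A dN dJ ->
  kills A (graded N J x) <->
  (forall S k j, (0 <= k)%ZZ -> (2 * k + deg S = N + dN)%ZZ -> (2 * j - wt S = J + dJ)%ZZ ->
     coeffs A x S k j = 0).
Proof.
move=> dA; split=> [kA S k j k0 /Z.eqb_spec Ek /Z.eqb_spec Ej | cA S k j k0].
  by have := kA S k j k0; rewrite (apply_graded _ _ _ _ _ _ dA) Ek Ej.
rewrite (apply_graded _ _ _ _ _ _ dA).
by case: Z.eqb_spec => //= Ek; case: Z.eqb_spec => // Ej; apply: cA.
Qed.

End System.

Section SingularSystem.
Variables (K : numFieldType) (Delta : K) (Lam : nat).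
Local Notation model := (model K).
Local Notation indM := (indM Delta Lam).
Local Notation X x := (env_inj (sk_gen K x)).
Local Notation rho := (rho Delta Lam).
Local Notation Phi := (@Phi K Delta Lam).
Local Notation kills := (kills Delta Lam).
Implicit Types (f g : model) (w : indM).

(** This is where characteristic zero enters: eigenvalues of L_0 and H_0 determine
    the integers N and J. *)
Lemma zr_inj : injective (zr K).
Proof.
move=> a b /eqP; rewrite -subr_eq0 -zrB => ab0.
suff : (a - b = 0)%ZZ by lia.
have nat0 n : zr K (Z.of_nat n) == 0 -> n = 0%N by rewrite zr_nat pnatr_eq0 => /eqP.
have [n E] : exists n, (a - b = Z.of_nat n \/ a - b = - Z.of_nat n)%ZZ.
  by exists (Z.abs_nat (a - b)); lia.
by move: ab0; case: E => ->; rewrite ?zrN ?oppr_eq0 => /nat0 ->.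
Qed.

Lemma rho_grade f S k j : (0 <= k)%ZZ ->
  rho (bL 1) f S k j = 2^-1 * ((zr K (2 * k + deg S) + 2 * Delta) * f S k j).
Proof.
move=> k0; rewrite zrD zrM (@rho_mode _ _ _ _ grade); last by vm_compute.
rewrite /trunc (introT (Z.leb_spec0 _ _) k0) /scale /apply_op /= /apply_term /lval.
cbn [coef src kshift jshift l0 lin_cst lin_m lin_n lin_c ev valuation].
by rewrite !Z.add_0_r addr0.
Qed.

Lemma rho_weight f S k j : (0 <= k)%ZZ ->
  rho (bX slH 0) f S k j = (Lam%:R - zr K (2 * j - wt S)) * f S k j.
Proof.
move=> k0; rewrite zrB zrM (@rho_mode _ _ _ _ weight); last by vm_compute.
rewrite /trunc (introT (Z.leb_spec0 _ _) k0) /scale /apply_op /= /apply_term /lval.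
cbn [coef src kshift jshift l0 lin_cst lin_m lin_n lin_c ev valuation].
rewrite !Z.add_0_r addr0 mul1r -?[zr K (-1)]/(-1) -?[zr K 2]/(1 + 1); ring.
Qed.

(** A nonzero scalar has to belong to an actual basis vector ∂^k S F^j v. *)
Definition supported (N J : Z) (x : state -> K) := forall S, x S != 0 ->
  exists k j, [/\ (2 * k + deg S = N)%ZZ, (2 * j - wt S = J)%ZZ,
                  (0 <= k)%ZZ & (0 <= j <= Z.of_nat Lam)%ZZ].

Lemma weight_graded w : weight_vector w -> exists N J x,
  [/\ Phi w = graded N J x, supported N J x & exists S, x S != 0].
Proof.
case=> w0 [a [b [L0w H0w]]]; set f := Phi w.
have fa S k j : (0 <= k)%ZZ -> rho (bL 1) f S k j = a * f S k j.
  by move=> _; rewrite /f -Phi_gen -[X _]/(env_inj (eL K 0)) L0w Phi_cscale.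
have fb S k j : (0 <= k)%ZZ -> rho (bX slH 0) f S k j = b * f S k j.
  by move=> _; rewrite /f -Phi_gen -[X _]/(env_inj (eX K slH 0)) H0w Phi_cscale.
have [S0 [k0 [j0 f0]]] : exists S k j, f S k j != 0.
  apply: contrapT => nf; case/eqP: w0; apply: Phi_inj; apply: model_ext => S k j.
  by apply/eqP/negPn/negP => f0; apply: nf; exists S, k, j.
have degE S k j : f S k j != 0 -> zr K (2 * k + deg S) = 2 * a - 2 * Delta.
  move=> fS; have [k_ge0 _] := Phi_support fS.
  by have := fa S k j k_ge0; rewrite rho_grade // mulrA => /(mulIf fS) <-; field.
have wtE S k j : f S k j != 0 -> zr K (2 * j - wt S) = Lam%:R - b.
  move=> fS; have [k_ge0 _] := Phi_support fS.
  by have := fb S k j k_ge0; rewrite rho_weight // => /(mulIf fS) <-; ring.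
pose N := (2 * k0 + deg S0)%ZZ; pose J := (2 * j0 - wt S0)%ZZ.
have NJ S k j : f S k j != 0 -> (2 * k + deg S = N /\ 2 * j - wt S = J)%ZZ.
  move=> fS; split; apply: zr_inj.
    by rewrite (degE _ _ _ fS) (degE _ _ _ f0).
  by rewrite (wtE _ _ _ fS) (wtE _ _ _ f0).
exists N, J, (fun S => f S ((N - deg S) / 2) ((J + wt S) / 2))%ZZ.
have halfE a1 c1 e1 : (2 * a1 + c1 = e1 -> (e1 - c1) / 2 = a1)%ZZ.
  by move=> <-; rewrite Z.add_simpl_r Z.mul_comm Z.div_mul.
split.
- apply: model_ext => S k j; rewrite /graded.
  case: Z.eqb_spec => [Nk|Nk] /=; last first.
    by apply/eqP/negPn/negP => /NJ[].
  case: Z.eqb_spec => [Jj|Jj]; last by apply/eqP/negPn/negP => /NJ[].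
  rewrite (halfE k) // (_ : (J + wt S) / 2 = j)%ZZ //.
  by rewrite -[wt S]Z.opp_involutive; apply: halfE.
- move=> S fS; have [Nk Jj] := NJ _ _ _ fS; have [k_ge0 j_in] := Phi_support fS.
  by exists ((N - deg S) / 2)%ZZ, ((J + wt S) / 2)%ZZ.
- exists S0; rewrite (halfE k0) // (_ : (J + wt S0) / 2 = j0)%ZZ //.
  by rewrite -[wt S0]Z.opp_involutive; apply: halfE.
Qed.

Lemma homog_gen x : sk_homog (sk_index x) (sk_gen K x).
Proof. by move=> b; rewrite /sk_gen msuppU oner_eq0 inE => /eqP ->. Qed.

Lemma singular_kills w : singular w -> [/\ kills E0 (Phi w),
  forall a b, kills (G1 a b) (Phi w) & forall a, kills (X1 a) (Phi w)].
Proof.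
case=> _ E0w pos.
have kill x A : X x *: w = 0 ->
    op_eq (at_mode (lin_cst (Z.of_nat (mode x))) (current_op (kind x))) A -> kills A (Phi w).
  by move=> xw xA; apply/(@rho_killsP K Delta Lam x A _ xA); rewrite -Phi_gen xw Phi0.
have posX x : 0 < sk_index x -> X x *: w = 0.
  by move=> x0; apply: pos x0 (@homog_gen x).
split.
- by apply: (kill (bX slE 0)) => //; vm_compute.
- move=> a b; apply: (kill (bG a b 1)); last by case: a b => [] []; vm_compute.
  by apply: posX; rewrite /= subr_gt0 invf_lt1 ?ltr1n.
- by move=> a; apply: (kill (bX a 1)); [exact: posX | case: a; vm_compute].
Qed.

Lemma env_inj_comb c e x y w : env_inj (c *: sk_gen K x + e *: sk_gen K y) *: w =
  cscale c (X x *: w) + cscale e (X y *: w).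
Proof. by rewrite env_injD scalerDl !env_injZ !cscale_alg. Qed.

Definition annihilates w x : Prop := X x *: w = 0.

Lemma annihilates_comb c e x y w : e != 0 -> annihilates w x ->
  env_inj (c *: sk_gen K x + e *: sk_gen K y) *: w = 0 -> annihilates w y.
Proof.
move=> e0 xw; rewrite env_inj_comb xw cscale0r add0r => yw.
by rewrite /annihilates -[LHS]cscale1 -(mulVf e0) -cscaleA yw cscale0r.
Qed.

(** From F_1, bracketing with E_0 gives H_1 and E_1; bracketing with these gives
    all X_n, n > 0, and from G^(-b)_(1/2) all G_r, r > 0. The L_n, n > 0, occur in
    the brackets of G^(++)_(1/2) with G^(--)_(n-1/2). *)
Lemma positive_annihilates w :
    annihilates w (bX slE 0) -> annihilates w (bX slF 1) ->
    annihilates w (bG false true 1) -> annihilates w (bG false false 1) ->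
  forall x, 0 < sk_index x -> annihilates w x.
Proof.
move=> E0w F1w Gpw Gmw; pose ann := annihilates w.
have ann_bracket x y : ann x -> ann y -> env_inj (sk_bracket K x y) *: w = 0.
  move=> xw yw; have : (X x * X y) *: w = 0 by rewrite -scalerA yw scaler0.
  by rewrite env_comm scalerDl -!scalerA xw !scaler0 add0r.
have ann_scale c x z : c != 0 -> env_inj (c *: sk_gen K z) *: w = 0 -> x = z -> ann x.
  move=> c0 + ->; rewrite env_injZ cscale_alg => zw.
  by rewrite /ann /annihilates -[LHS]cscale1 -(mulVf c0) -cscaleA zw cscale0r.
have two0 : 2 != 0 :> K by rewrite pnatr_eq0.
have n1 : -1 != 0 :> K by rewrite oppr_eq0 oner_eq0.
have n2 : - 2 != 0 :> K by rewrite oppr_eq0.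
have G1w a b : ann (bG a b 1).
  have Gfw b' : ann (bG false b' 1) by case: b'.
  case: a; last exact: Gfw.
  have := ann_bracket _ _ E0w (Gfw b); cbn [sk_bracket sl2_act].
  by move=> bw; apply: (ann_scale 1 _ (bG true b 1)); rewrite ?scale1r ?oner_eq0.
have H1w : ann (bX slH 1).
  have := ann_bracket _ _ E0w F1w; cbn [sk_bracket sl2_bracket].
  by move=> bw; apply: (ann_scale 1 _ (bX slH 1)); rewrite ?scale1r ?oner_eq0.
have E1w : ann (bX slE 1).
  have := ann_bracket _ _ E0w H1w; cbn [sk_bracket sl2_bracket].
  by move=> bw; apply: (ann_scale (- 2) _ (bX slE 1)); rewrite ?scaleNr.
have Xw a n : ann (bX a n.+1).
  elim: n a => [|n IHn]; first by case; [exact: H1w | exact: E1w | exact: F1w].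
  case.
  - have := ann_bracket _ _ E1w (IHn slF); cbn [sk_bracket sl2_bracket].
    by move=> bw; apply: (ann_scale 1 _ (bX slH n.+2)); rewrite ?scale1r ?oner_eq0.
  - have := ann_bracket _ _ H1w (IHn slE); cbn [sk_bracket sl2_bracket].
    by move=> bw; apply: (ann_scale 2 _ (bX slE n.+2)).
  - have := ann_bracket _ _ H1w (IHn slF); cbn [sk_bracket sl2_bracket].
    by move=> bw; apply: (ann_scale (- 2) _ (bX slF n.+2)); rewrite ?scaleNr.
have Gw a b n : ann (bG a b n.+1).
  elim: n => [|n IHn]; first exact: G1w.
  case: a IHn => IHn.
  - have := ann_bracket _ _ H1w IHn; cbn [sk_bracket sl2_act].
    by move=> bw; apply: (ann_scale 1 _ (bG true b n.+2)); rewrite ?scale1r ?oner_eq0.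
  - have := ann_bracket _ _ H1w IHn; cbn [sk_bracket sl2_act].
    by move=> bw; apply: (ann_scale (- 1) _ (bG false b n.+2)); rewrite ?scaleN1r.
case=> [n|a [|n]|a b [|n]] x0;
  [|by exfalso; move: x0; rewrite /= ltxx|exact: Xw| |exact: Gw].
- case: n x0 => [|[|n]] x0; [by exfalso; move: x0; rewrite /= sub0r oppr_gt0 ltr10
    | by exfalso; move: x0; rewrite /= subrr ltxx |].
  have := ann_bracket _ _ (Gw true true 0%N) (Gw false false n).
  have idx : 1%:Z + n.+1%:Z - 1 = n.+1%:Z by ring.
  cbn [sk_bracket odd_bracket]; rewrite idx; set c := (_%:~R : K).
  have -> : - (c *: eX K slH n.+1%:Z) - 2 *: eL K n.+1%:Z =
      (- c) *: sk_gen K (bX slH n.+1) + (- 2) *: sk_gen K (bL n.+2).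
    by rewrite !scaleNr /eL -PoszD addn1.
  exact: annihilates_comb n2 (Xw slH n).
- by exfalso; move: x0; rewrite /= sub0r oppr_gt0 ltNge invr_ge0 ler0n.
Qed.

End SingularSystem.

(** * The vectors of the list in coordinates *)
Section Vectors.
Variables (K : numFieldType) (Delta : K) (Lam : nat).
Local Notation model := (model K).
Local Notation indM := (indM Delta Lam).
Local Notation X x := (env_inj (sk_gen K x)).
Local Notation Phi := (@Phi K Delta Lam).
Local Notation bas := (@bas K Delta Lam).
Implicit Types (f g : model) (w : indM).

Definition at_state (S T : state) : K := (T == S)%:R.

Definition has_coords (N J : Z) (x : state -> K) w := Phi w = graded N J x.

Lemma coords_bas k S j : has_coords (2 * Z.of_nat k + deg S) (2 * Z.of_nat j - wt S)
  (fun T => (k`! * Lam ^_ j)%:R * at_state S T) (bas k S j).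
Proof.
rewrite /has_coords Phi_bas; apply: model_ext => T k' j'.
rewrite /scale /point /graded /at_state.
have [-> | _] := eqVneq T S; last by rewrite mulr0; case: ifP.
have -> : (2 * k' + deg S =? 2 * Z.of_nat k + deg S)%ZZ = (k' =? Z.of_nat k)%ZZ.
  by apply/Z.eqb_spec/Z.eqb_spec; lia.
have -> : (2 * j' - wt S =? 2 * Z.of_nat j - wt S)%ZZ = (j' =? Z.of_nat j)%ZZ.
  by apply/Z.eqb_spec/Z.eqb_spec; lia.
by rewrite /=; case: ifP => _; rewrite ?mulr1 ?mulr0.
Qed.

Lemma coordsD N J x y w z : has_coords N J x w -> has_coords N J y z ->
  has_coords N J (fun T => x T + y T) (w + z).
Proof.
rewrite /has_coords PhiD => -> ->; apply: model_ext => S k j.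
by rewrite /fcomb mul1r /graded; case: ifP => _; rewrite ?addr0.
Qed.

Lemma coordsZ N J x w c : has_coords N J x w -> has_coords N J (fun T => c * x T) (cscale c w).
Proof.
rewrite /has_coords Phi_cscale => ->; apply: model_ext => S k j.
by rewrite /scale /graded; case: ifP => _; rewrite ?mulr0.
Qed.

Lemma coords0 N J : has_coords N J (fun=> 0) 0.
Proof.
by rewrite /has_coords Phi0; apply: model_ext => S k j; rewrite /graded /fzero; case: ifP.
Qed.

(** A linear combination of vectors bas k S j, as a list of (coefficient, k, S, j).
    Equalities of vectors and their coordinates are computed from such lists. *)
Definition combination := seq (K * nat * state * nat).
Definition comb (l : combination) : indM :=
  foldr (fun t w => let: (c, k, s, j) := t in cscale c (bas k s j) + w) 0 l.
Definition comb_coords (l : combination) : state -> K := fun T =>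
  foldr (fun t a => let: (c, k, s, j) := t in
    c * ((k`! * Lam ^_ j)%:R * at_state s T) + a) 0 l.
Definition comb_deg (N J : Z) (l : combination) : bool :=
  all (fun t => let: (c, k, s, j) := t in
    (2 * Z.of_nat k + deg s =? N)%ZZ && (2 * Z.of_nat j - wt s =? J)%ZZ) l.

Lemma coords_comb N J l : comb_deg N J l -> has_coords N J (comb_coords l) (comb l).
Proof.
elim: l => [|[[[c k] s] j] l IHl] /=; first by move=> _; apply: coords0.
case/andP=> /andP[/Z.eqb_spec EN /Z.eqb_spec EJ] /IHl cl; apply: coordsD => //.
by apply: coordsZ; rewrite -EN -EJ; apply: coords_bas.
Qed.

Lemma comb_cons c k s j l : comb ((c, k, s, j) :: l) = cscale c (bas k s j) + comb l.
Proof. by []. Qed.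

Lemma comb_cat l l' : comb (l ++ l') = comb l + comb l'.
Proof.
elim: l => [|[[[c k] s] j] l IHl] /=; first by rewrite add0r.
by rewrite IHl addrA.
Qed.

Definition scale_comb c (l : combination) : combination :=
  [seq (let: (e, k, s, j) := t in (c * e, k, s, j)) | t <- l].

Lemma comb_scale c l : comb (scale_comb c l) = cscale c (comb l).
Proof.
elim: l => [|[[[e k] s] j] l IHl] /=; first by rewrite cscale0r.
by rewrite cscaleDr cscaleA IHl.
Qed.

Local Notation v := (hwv Delta Lam).
Local Notation F0 := (X (bX slF 0)).

Lemma F0_v : F0 *: v = bas 0 empty 1.
Proof. by rewrite /hwv tensor_gen // irr_act_vec. Qed.

Lemma F0_F0_v : F0 *: (F0 *: v) = bas 0 empty 2.
Proof. by rewrite F0_v [bas _ _ _]/(tensor Delta 1 _) tensor_gen // irr_act_vec. Qed.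

Lemma nat_scale n w : (n%:R : env K) *: w = cscale n%:R w.
Proof. by rewrite /cscale !scaler_nat. Qed.

Local Notation o := false.
Local Notation i := true.

Let combE := (comb_cons, cscale1, addr0).

(** c_i is the expansion of a_i in the basis, where F_0^j v has the number j. *)
Definition c1 : combination := [:: (1, 0%N, empty, 0%N)].
Definition c2 : combination := [:: (1, 0%N, (o, i, o, o), 0%N)].
Definition c3 : combination := [:: (1, 0%N, (o, o, i, o), 0%N)].
Definition c4 : combination := [:: (Lam%:R, 0%N, (i, o, o, o), 0%N); (-1, 0%N, (o, i, o, o), 1%N)].
Definition c5 : combination := [:: (- Lam%:R, 0%N, (o, o, o, i), 0%N); (1, 0%N, (o, o, i, o), 1%N)].
Definition c6 : combination := [:: (1, 0%N, (i, i, o, o), 0%N)].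
Definition c7 : combination := [:: (1, 0%N, (o, o, i, i), 0%N)].
Definition c8 : combination := [:: (1, 0%N, (o, i, i, o), 0%N)].
Definition c9 : combination := [:: (1, 0%N, (i, o, i, o), 0%N); (-1, 0%N, (o, i, o, i), 0%N)].
Definition c10 : combination := [:: (- Lam%:R, 0%N, (o, i, o, i), 0%N); (1, 0%N, (o, i, i, o), 1%N)].
Definition c11 : combination :=
  [:: (- ((Lam%:R - 1) * Lam%:R), 0%N, (i, o, o, i), 0%N); (Lam%:R - 1, 0%N, (i, o, i, o), 1%N);
      (Lam%:R - 1, 0%N, (o, i, o, i), 1%N); (-1, 0%N, (o, i, i, o), 2%N)].
Definition c12 : combination := [:: (1, 0%N, (i, i, i, o), 0%N)].
Definition c13 : combination := [:: (1, 0%N, (o, i, i, i), 0%N)].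
Definition c14 : combination := [:: (- Lam%:R, 0%N, (i, i, o, i), 0%N); (1, 0%N, (i, i, i, o), 1%N)].
Definition c15 : combination := [:: (- Lam%:R, 0%N, (i, o, i, i), 0%N); (1, 0%N, (o, i, i, i), 1%N)].
Definition c16 : combination := [:: (1, 0%N, (i, i, i, i), 0%N)].

Lemma cscaleN1 w : cscale (-1) w = - w.
Proof. by rewrite /cscale !scaleN1r. Qed.

Lemma a1E : a1 Delta Lam = comb c1.
Proof. by rewrite !combE. Qed.
Lemma a2E : a2 Delta Lam = comb c2.
Proof. by rewrite !combE. Qed.
Lemma a3E : a3 Delta Lam = comb c3.
Proof. by rewrite !combE. Qed.
Lemma a4E : a4 Delta Lam = comb c4.
Proof. by rewrite /a4 scalerBl -!scalerA nat_scale F0_v !combE cscaleN1. Qed.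
Lemma a5E : a5 Delta Lam = comb c5.
Proof.
rewrite /a5 scalerDl scaleNr -!scalerA nat_scale F0_v !combE.
by rewrite -mulN1r -cscaleA cscaleN1.
Qed.
Lemma a6E : a6 Delta Lam = comb c6.
Proof. by rewrite !combE /a6 -scalerA. Qed.
Lemma a7E : a7 Delta Lam = comb c7.
Proof. by rewrite !combE /a7 -scalerA. Qed.
Lemma a8E : a8 Delta Lam = comb c8.
Proof. by rewrite !combE /a8 -scalerA. Qed.
Lemma a9E : a9 Delta Lam = comb c9.
Proof. by rewrite !combE /a9 scalerBl -!scalerA cscaleN1. Qed.
Lemma a10E : a10 Delta Lam = comb c10.
Proof.
rewrite /a10 scalerDl scaleNr -!scalerA nat_scale F0_v !combE.
by rewrite -mulN1r -cscaleA cscaleN1.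
Qed.
Lemma a11E : a11 Delta Lam = comb c11.
Proof.
rewrite /a11 scalerBl expr2 -!scalerA F0_F0_v.
have -> : (Lam%:R - 1 : env K) = (Lam%:R - 1 : K)%:A by rewrite scalerBl scale1r scaler_nat.
rewrite -[_%:A *: _]/(cscale _ _) !scalerDl scaleNr -!scalerA nat_scale F0_v !combE.
by rewrite !cscaleDr -[- cscale _ _]cscaleN1 !cscaleA mulrN1 mulNr cscaleN1 !addrA.
Qed.
Lemma a12E : a12 Delta Lam = comb c12.
Proof. by rewrite !combE /a12 -!scalerA. Qed.
Lemma a13E : a13 Delta Lam = comb c13.
Proof. by rewrite !combE /a13 -!scalerA. Qed.
Lemma a14E : a14 Delta Lam = comb c14.
Proof.
rewrite /a14 -!scalerA scalerDl scaleNr -!scalerA nat_scale F0_v !combE.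
by rewrite -[- cscale _ _]cscaleN1 cscaleA mulN1r !scalerDr !scale_cscale.
Qed.
Lemma a15E : a15 Delta Lam = comb c15.
Proof.
rewrite /a15 scalerDl scaleNr -!scalerA nat_scale F0_v !combE.
by rewrite -[- cscale _ _]cscaleN1 cscaleA mulN1r.
Qed.
Lemma a16E : a16 Delta Lam = comb c16.
Proof. by rewrite !combE /a16 -!scalerA. Qed.

(** The effect of 2∂ on an expansion. *)
Definition shift_comb (l : combination) : combination :=
  [seq (let: (c, k, s, j) := t in (c * 2, k.+1, s, j)) | t <- l].

Lemma partial_comb l : (2 * partial K) *: comb l = comb (shift_comb l).
Proof.
elim: l => [|[[[c k] s] j] l IHl]; first exact: scaler0.
rewrite /shift_comb map_cons !comb_cons scalerDr IHl; congr (_ + _).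
rewrite scale_cscale -scalerA -[2]/(2%:R) nat_scale cscaleA; congr cscale.
by case: s => [[[a b] e] g].
Qed.

(** The families of the classification; the digits name the vectors a_i which are
    combined. *)
Definition fam8 al := scale_comb al c8.
Definition fam11 al := scale_comb al c11.
Definition fam16 al := scale_comb al (c16 ++ scale_comb (-1) (shift_comb c10)).
Definition fam23 al be := scale_comb al c2 ++ scale_comb be c3.
Definition fam45 al be := scale_comb al c4 ++ scale_comb be c5.
Definition fam1415 al be :=
  scale_comb al c14 ++ scale_comb be (c15 ++ scale_comb (-1) (shift_comb c5)).
Definition fam1312 al be := scale_comb al c13 ++ scale_comb be (c12 ++ shift_comb c2).
Definition fam679 al be ga :=
  scale_comb al c6 ++ scale_comb be c7 ++ scale_comb ga (c9 ++ scale_comb (-1) (shift_comb c1)).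

Let famE := (comb_cat, comb_scale, cscaleN1).
Local Notation d := (partial K).

Lemma fam8E al : comb (fam8 al) = cscale al (a8 Delta Lam).
Proof. by rewrite /fam8 !famE a8E. Qed.
Lemma fam11E al : comb (fam11 al) = cscale al (a11 Delta Lam).
Proof. by rewrite /fam11 !famE a11E. Qed.
Lemma fam16E al : comb (fam16 al) = cscale al (a16 Delta Lam - (2 * d) *: a10 Delta Lam).
Proof. by rewrite /fam16 !famE a16E a10E partial_comb. Qed.
Lemma fam23E al be : comb (fam23 al be) = cscale al (a2 Delta Lam) + cscale be (a3 Delta Lam).
Proof. by rewrite /fam23 !famE a2E a3E. Qed.
Lemma fam45E al be : comb (fam45 al be) = cscale al (a4 Delta Lam) + cscale be (a5 Delta Lam).
Proof. by rewrite /fam45 !famE a4E a5E. Qed.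
Lemma fam1415E al be : comb (fam1415 al be) =
  cscale al (a14 Delta Lam) + cscale be (a15 Delta Lam - (2 * d) *: a5 Delta Lam).
Proof. by rewrite /fam1415 !famE a14E a15E a5E partial_comb. Qed.
Lemma fam1312E al be : comb (fam1312 al be) =
  cscale al (a13 Delta Lam) + cscale be (a12 Delta Lam + (2 * d) *: a2 Delta Lam).
Proof. by rewrite /fam1312 !famE a13E a12E a2E partial_comb. Qed.
Lemma fam679E al be ga : comb (fam679 al be ga) =
  cscale al (a6 Delta Lam) + cscale be (a7 Delta Lam)
  + cscale ga (a9 Delta Lam - (2 * d) *: a1 Delta Lam).
Proof. by rewrite /fam679 !famE a6E a7E a9E a1E partial_comb addrA. Qed.

End Vectors.

(** * Solving the system *)

(** In the names of hypotheses the letters G^(-+), G^(++), G^(+-), G^(--) are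
    numbered 0, 1, 2, 3: x02 is about the scalar at G^(-+) G^(+-), and x_0 about the
    scalar at the empty product. *)
Section Solve.
Variables (K : numFieldType) (Delta : K) (Lam : nat) (N J : Z) (x : state -> K).
Local Notation L := (Lam%:R : K).
Local Notation d := (2 * Delta).
Local Notation coeffs := (coeffs Delta Lam).
Local Notation o := false.
Local Notation i := true.
Hypothesis sx : supported Lam N J x.
Hypothesis kE : kills Delta Lam E0 (graded N J x).
Hypothesis kG : forall a b, kills Delta Lam (G1 a b) (graded N J x).
Hypothesis kH : kills Delta Lam DH (graded N J x).

Lemma rowE S k j : (0 <= k)%ZZ -> (2 * k + deg S = N)%ZZ -> (2 * j - wt S = J - 2)%ZZ ->
  coeffs E0 x S k j = 0.
Proof.
move=> k0 hN hJ; apply: (proj1 (@kills_gradedP _ _ _ _ 0 (-2) _ _ _ _) kE) => //; lia.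
Qed.

Lemma rowG a b S k j : (0 <= k)%ZZ -> (2 * k + deg S = N - 1)%ZZ ->
  (2 * j - wt S = J + (if a then -1 else 1))%ZZ -> coeffs (G1 a b) x S k j = 0.
Proof.
move=> k0 hN hJ.
apply: (proj1 (@kills_gradedP _ _ _ _ (-1) (if a then -1 else 1)%ZZ _ _ _ _) (kG a b)) => //.
by case: (a) (b) => [] []; vm_compute.
Qed.

Lemma rowH S k j : (0 <= k)%ZZ -> (2 * k + deg S = N - 2)%ZZ -> (2 * j - wt S = J)%ZZ ->
  coeffs DH x S k j = 0.
Proof.
move=> k0 hN hJ; apply: (proj1 (@kills_gradedP _ _ _ _ (-2) 0 _ _ _ _) kH) => //; lia.
Qed.

(** A scalar vanishes when its k or j would be out of range or half-integral. *)
Lemma x_out S : (forall k j, (2 * k + deg S = N)%ZZ -> (2 * j - wt S = J)%ZZ ->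
  (0 <= k)%ZZ -> (0 <= j <= Z.of_nat Lam)%ZZ -> False) -> x S = 0.
Proof.
by move=> xF; apply/eqP/negPn/negP => /sx[k [j [Nk Jj k0 jL]]]; apply: (xF k j).
Qed.

Arguments rowE : clear implicits.
Arguments rowG : clear implicits.
Arguments rowH : clear implicits.

Lemma zr_num : ((zr K 0 = 0) * (zr K 1 = 1) * (zr K (-1) = -1) * (zr K 2 = 2)
  * (zr K (-2) = -2))%type.
Proof. by []. Qed.

Ltac side := cbn [deg wt bz]; lia.
(* Puts the equation r S k j in front of the goal, with its row expanded. *)
Ltac row r S k j :=
  let e := fresh "e" in
  have e := r S k j ltac:(side) ltac:(side) ltac:(side);
  move: e; rewrite /coeffs;
  match goal with |- context [foldr _ _ (?A S)] =>
    let l := eval vm_compute in (A S) in change (A S) with l end;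
  cbn [foldr ev valuation coef src]; rewrite ?(zrD, zrB, zrN) ?zr_num.

Ltac out := apply: x_out => ? ? + + ? ?; cbn [deg wt bz] => ? ?; lia.
(* The goal is the equation on top, or its opposite, up to ring identities. *)
Ltac by_eq := let e := fresh "e" in move=> e;
  first [ apply: (etrans _ e); ring
        | apply: (etrans _ (etrans (congr1 -%R e) (oppr0 _))); ring ].
(* Compares x with a family, state by state; the states of the wrong parity are
   settled by x_out. *)
Ltac coords :=
  case=> [[[[] []] []] []];
  rewrite /fam8 /fam11 /fam16 /fam23 /fam45 /fam1415 /fam1312 /fam679 /c1 /c2 /c3 /c4 /c5 /c6 /c7
    /c8 /c9 /c10 /c11 /c12 /c13 /c14 /c15 /c16 /scale_comb /shift_comb /comb_coords /at_state /=
    ?(fact0, factS, ffactn0, ffactn1, mul1n, muln1);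
  try (match goal with |- x ?S = _ => rewrite (_ : x S = 0); [ring | by out] end).

Lemma cancel_coeff (c y : K) : c * y = 0 -> c != 0 -> y = 0.
Proof. by move=> /eqP; rewrite mulf_eq0 => /orP[/eqP -> | /eqP //]; rewrite eqxx. Qed.

(** The equations of G_(1/2) at the product of all four letters kill the scalars of
    the triple products, and then those at the pairs kill the scalars of the single
    letters. *)
Lemma odd_large m p : N = (2 * m + 1)%ZZ -> J = (2 * p - 1)%ZZ -> (2 <= m)%ZZ ->
  forall S, x S = 0.
Proof.
move=> Nm Jp m2.
have x023 : x (i, o, i, i) = 0 by row (rowG true true) (i,i,i,i) (m - 2)%ZZ (p - 1)%ZZ; by_eq.
have x123 : x (o, i, i, i) = 0 by row (rowG false true) (i,i,i,i) (m - 2)%ZZ p; by_eq.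
have x013 : x (i, i, o, i) = 0 by row (rowG true false) (i,i,i,i) (m - 2)%ZZ (p - 1)%ZZ; by_eq.
have x012 : x (i, i, i, o) = 0 by row (rowG false false) (i,i,i,i) (m - 2)%ZZ p; by_eq.
have x2 : x (o, o, i, o) = 0.
  by row (rowG true true) (o,i,i,o) (m - 1)%ZZ p; rewrite x123; by_eq.
have x3 : x (o, o, o, i) = 0.
  by row (rowG true true) (o,i,o,i) (m - 1)%ZZ (p - 1)%ZZ; rewrite x123; by_eq.
have x1 : x (o, i, o, o) = 0.
  by row (rowG true false) (o,i,i,o) (m - 1)%ZZ p; rewrite x012; by_eq.
have x0 : x (i, o, o, o) = 0.
  by row (rowG true false) (i,o,i,o) (m - 1)%ZZ (p - 1)%ZZ; rewrite x012 x013; by_eq.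
by case=> [[[[] []] []] []] //; out.
Qed.

Local Notation x4 := (x (i, i, i, i)).

(** The equations of G_(1/2) express all scalars by the one at the product of all
    four letters, and give 2 Delta = -m - 1. From E_0 follows J = 0, from the
    diagonal equation Lambda <= 1 and 2 Delta = - Lambda - 2, so that
    Lambda = m - 1 >= 1. *)
Lemma even_large m q : N = (2 * m)%ZZ -> J = (2 * q)%ZZ -> (2 <= m)%ZZ ->
    (exists S, x S != 0) ->
  [/\ N = 4%ZZ, J = 0%ZZ, Lam = 1%N, d = - 3 &
   exists al, forall S, x S = comb_coords Lam
     (fam16 Lam al) S].
Proof.
move=> Nm Jq m2 [S0 xS0].
have x23 : x (o, o, i, i) = 0 by row (rowG true true) (o,i,i,i) (m - 2)%ZZ q; by_eq.
have x01 : x (i, i, o, o) = 0 by row (rowG true false) (i,i,i,o) (m - 2)%ZZ q; by_eq.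
have x02 : x (i, o, i, o) = (L - 2 * zr K q + d + 2) * x4.
  by apply: subr0_eq; row (rowG true true) (i,i,i,o) (m - 2)%ZZ q; by_eq.
have x03 : x (i, o, o, i) = 2 * zr K q * x4.
  by apply: subr0_eq; row (rowG true true) (i,i,o,i) (m - 2)%ZZ (q - 1)%ZZ; by_eq.
have x12 : x (o, i, i, o) = - (2 * L - 2 * zr K q) * x4.
  by apply: subr0_eq; row (rowG false true) (i,i,i,o) (m - 2)%ZZ (q + 1)%ZZ; by_eq.
have x13 : x (o, i, o, i) = (L - 2 * zr K q - 2 - d) * x4.
  by apply: subr0_eq; row (rowG false true) (i,i,o,i) (m - 2)%ZZ q; by_eq.
have x_0 : x (o, o, o, o) = (2 * zr K q + 2) * x (o, i, i, o)
                           - (L - 2 * zr K q + d) * x (o, i, o, i).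
  by apply: subr0_eq; row (rowG true true) (o,i,o,o) (m - 1)%ZZ q; by_eq.
have x4_neq0 : x4 != 0.
  apply: contraNneq xS0 => x40; apply/eqP; rewrite x40 ?mulr0 in x02 x03 x12 x13.
  rewrite x12 x13 !mulr0 subrr in x_0.
  by case: (S0) => [[[[] []] []] []] //; out.
have q0 : q = 0%ZZ.
  apply/(@zr_inj K)/(mulIf x4_neq0); rewrite zr_num mul0r.
  by row rowE (i,i,i,i) (m - 2)%ZZ (q - 1)%ZZ; by_eq.
have dm : d = - zr K m - 1.
  have two4 : 2 * x4 != 0 by rewrite mulf_neq0 // pnatr_eq0.
  apply: (mulIf two4); apply/subr0_eq.
  row (rowG true false) (o,i,i,i) (m - 2)%ZZ q; rewrite x13 => e.
  by move: e; by_eq.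
rewrite q0 zr_num in x02 x03 x12 x13 x_0.
have x02_0 : x (i, o, i, o) = 0.
  row rowH (i,o,i,o) (m - 2)%ZZ q; rewrite q0 zr_num => e.
  have L1 : L + 1 != 0 by rewrite natr1 pnatr_eq0.
  by apply: (mulfI L1); rewrite mulr0; move: e; by_eq.
have dL : d = - L - 2.
  by apply: (mulIf x4_neq0); apply/subr0_eq; move: x02; rewrite x02_0 => /esym; by_eq.
have Lam01 : (Lam = 0 \/ Lam = 1)%N.
  have : L * (L - 1) * x4 = 0.
    row rowH (o,i,o,i) (m - 2)%ZZ q; rewrite q0 zr_num x13 dL => e.
    have two0 : 2 != 0 :> K by rewrite pnatr_eq0.
    by apply: (mulfI two0); rewrite mulr0; move: e; by_eq.
  move=> /eqP; rewrite !mulf_eq0 (negPf x4_neq0) orbF subr_eq0 pnatr_eq0 (eqr_nat _ _ 1).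
  by case/orP=> /eqP ->; [left | right].
have Lm : Lam = 1%N /\ m = 2%ZZ.
  have mL : zr K m = zr K (Z.of_nat Lam + 1)%ZZ.
    rewrite zrD zr_nat zr_num; apply: subr0_eq.
    by move: dm; rewrite dL => /eqP; rewrite -subr_eq0 => /eqP; by_eq.
  by move/zr_inj: mL; case: Lam01 => ->; lia.
case: Lm => Lam1 m2'; split=> //.
- lia.
- lia.
- by rewrite dL Lam1; ring.
exists x4; rewrite dL Lam1 in x12 x13 x_0.
rewrite Lam1; coords; rewrite ?x_0 ?x01 ?x23 ?x02_0 ?x03 ?x12 ?x13; ring.
Qed.

Lemma degree0 q : N = 0%ZZ -> J = (2 * q)%ZZ -> (exists S, x S != 0) ->
  J = 0%ZZ /\ exists al, forall S, x S = comb_coords Lam (scale_comb al (c1 K)) S.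
Proof.
move=> N0 Jq [S0 xS0].
have xS S : S != (o, o, o, o) -> x S = 0.
  by case: S => [[[[] []] []] []] // _; out.
have x0 : x (o, o, o, o) != 0 by have [<- //|/xS x0] := eqVneq S0 (o, o, o, o); rewrite x0 eqxx in xS0.
have q0 : q = 0%ZZ.
  apply/(@zr_inj K)/(mulIf x0); rewrite zr_num mul0r.
  by row rowE (o,o,o,o) 0%ZZ (q - 1)%ZZ; by_eq.
split; first lia.
by exists (x (o, o, o, o)); coords; ring.
Qed.

(** E_0 says that the scalars of each pair (G^(++), G^(-+)), (G^(+-), G^(--)) form a
    highest weight vector, in the tensor product of the standard module with U; the
    two cases are its two components. G_(1/2) then fixes Delta. *)
Lemma degree1 p : N = 1%ZZ -> J = (2 * p - 1)%ZZ -> (exists S, x S != 0) ->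
  (J = (-1)%ZZ /\ d = L /\ exists al be, forall S, x S = comb_coords Lam
     (fam23 al be) S) \/
  (J = 1%ZZ /\ d = - L - 2 /\ (1 <= Lam)%N /\ exists al be, forall S, x S = comb_coords Lam
     (fam45 Lam al be) S).
Proof.
move=> N1 Jp [S0 xS0].
have x01 : x (i, o, o, o) = - zr K p * x (o, i, o, o).
  by apply: subr0_eq; row rowE (o,i,o,o) 0%ZZ (p - 1)%ZZ; by_eq.
have x32 : x (o, o, o, i) = - zr K p * x (o, o, i, o).
  by apply: subr0_eq; row rowE (o,o,i,o) 0%ZZ (p - 1)%ZZ; by_eq.
have x12 : (x (o, i, o, o) != 0) \/ (x (o, o, i, o) != 0).
  have [x1|] := eqVneq (x (o, i, o, o)) 0; last by left.
  have [x2|] := eqVneq (x (o, o, i, o)) 0; last by right.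
  exfalso; case/eqP: xS0; rewrite x1 mulr0 in x01; rewrite x2 mulr0 in x32.
  by case: (S0) => [[[[] []] []] []] //; out.
have p01 : p = 0%ZZ \/ p = 1%ZZ.
  have pp (y : K) : y != 0 -> (zr K p - 1) * (zr K p * y) = 0 -> p = 0%ZZ \/ p = 1%ZZ.
    move=> y0 /eqP; rewrite !mulf_eq0 (negPf y0) orbF => /orP[].
      by rewrite -[1]/(zr K 1) -zrB -[0]/(zr K 0) => /eqP/zr_inj; right; lia.
    by rewrite -[0]/(zr K 0) => /eqP/zr_inj; left.
  case: x12 => y0; apply: (pp _ y0).
    by row rowE (i,o,o,o) 0%ZZ (p - 2)%ZZ; rewrite x01; by_eq.
  by row rowE (o,o,o,i) 0%ZZ (p - 2)%ZZ; rewrite x32; by_eq.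
case: p01 => pE; rewrite pE in Jp; rewrite pE zr_num in x01 x32.
- left; split; first lia; split.
    case: x12 => y0; apply: (mulIf y0); apply: subr0_eq.
      by row (rowG false false) (o,o,o,o) 0%ZZ 0%ZZ; rewrite x01; by_eq.
    by row (rowG false true) (o,o,o,o) 0%ZZ 0%ZZ; rewrite x32; by_eq.
  exists (x (o,i,o,o)), (x (o,o,i,o)).
  by coords; rewrite ?x01 ?x32; ring.
- have L1 : (1 <= Lam)%N.
    have [L0|//] := posnP Lam; exfalso; case: x12 => /eqP[]; out.
  have L0 : L != 0 by rewrite pnatr_eq0 -lt0n.
  right; split; first lia; split.
    case: x12 => y0; apply: (mulIf y0); apply: subr0_eq.
      by row (rowG true false) (o,o,o,o) 0%ZZ 0%ZZ; rewrite x01; by_eq.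
    by row (rowG true true) (o,o,o,o) 0%ZZ 0%ZZ; rewrite x32; by_eq.
  (* a_4 and a_5 have the coefficients Lambda and -Lambda at these states. *)
  split=> //; exists (x (i,o,o,o) / L), (- x (o,o,o,i) / L).
  by coords; rewrite ?x01 ?x32; field.
Qed.

Lemma zr_neq0 a : a <> 0%ZZ -> zr K a != 0.
Proof. by move=> a0; apply/eqP => /(@zr_inj K a 0%ZZ). Qed.

(** E_0 leaves three possible weights. For the middle one with Lambda > 0 the
    diagonal equation kills the scalar of ∂ v, and the equations of G_(1/2) for the
    remaining ones have only the zero solution. *)
Lemma degree2 q : N = 2%ZZ -> J = (2 * q)%ZZ -> (exists S, x S != 0) ->
  [\/ J = (-2)%ZZ /\ d = L /\ exists al, forall S, x S = comb_coords Lam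
        (fam8 al) S,
     J = 2%ZZ /\ d = - L - 2 /\ (2 <= Lam)%N /\ exists al, forall S, x S = comb_coords Lam
        (fam11 Lam al) S |
     J = 0%ZZ /\ Lam = 0%N /\ d = - 2 /\ exists al be ga, forall S, x S = comb_coords Lam
        (fam679 al be ga) S].
Proof.
move=> N2 Jq [S0 xS0].
have E_0 : zr K q * x (o, o, o, o) = 0 by row rowE (o,o,o,o) 1%ZZ (q - 1)%ZZ; by_eq.
have E01 : zr K q * x (i, i, o, o) = 0 by row rowE (i,i,o,o) 0%ZZ (q - 1)%ZZ; by_eq.
have E23 : zr K q * x (o, o, i, i) = 0 by row rowE (o,o,i,i) 0%ZZ (q - 1)%ZZ; by_eq.
have E02 : zr K q * x (i, o, i, o) + x (i, o, o, i) = 0.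
  by row rowE (i,o,i,o) 0%ZZ (q - 1)%ZZ; by_eq.
have E13 : zr K q * x (o, i, o, i) + x (i, o, o, i) = 0.
  by row rowE (o,i,o,i) 0%ZZ (q - 1)%ZZ; by_eq.
have E03 : (zr K q - 1) * x (i, o, o, i) = 0 by row rowE (i,o,o,i) 0%ZZ (q - 2)%ZZ; by_eq.
have E12 : x (i, o, i, o) + (zr K q + 1) * x (o, i, i, o) + x (o, i, o, i) = 0.
  by row rowE (o,i,i,o) 0%ZZ q; by_eq.
have H_0 : (L - 2 * zr K q) * x (o, o, o, o) = 0 by row rowH (o,o,o,o) 0%ZZ q; by_eq.
have q_cases : q = (-1)%ZZ \/ q = 0%ZZ \/ q = 1%ZZ.
  have [q3 | q3] : ((q = -1 \/ q = 0 \/ q = 1) \/ (q <> 0 /\ q + 1 <> 0 /\ q - 1 <> 0))%ZZ by lia.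
    by [].
  case: q3 => /zr_neq0 q0 [/zr_neq0 + /zr_neq0]; rewrite zrD zrB zr_num => qp qm.
  exfalso; case/eqP: xS0.
  have x_0 := cancel_coeff E_0 q0; have x01 := cancel_coeff E01 q0.
  have x23 := cancel_coeff E23 q0; have x03 := cancel_coeff E03 qm.
  rewrite x03 !addr0 in E02 E13.
  have x02 := cancel_coeff E02 q0; have x13 := cancel_coeff E13 q0.
  rewrite x02 x13 add0r addr0 in E12; have x12 := cancel_coeff E12 qp.
  by case: (S0) => [[[[] []] []] []] //; out.
have two0 : 2 != 0 :> K by rewrite pnatr_eq0.
case: q_cases => [qE | [qE | qE]]; rewrite qE in Jq;
  rewrite qE ?zr_num in E_0 E01 E23 E02 E13 E03 E12 H_0.
- constructor 1; split; first lia.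
  have x0 S : S != (o, i, i, o) -> x S = 0 by case: S => [[[[] []] []] []] // _; out.
  have x12 : x (o, i, i, o) != 0.
    by have [<- //|/x0 xS] := eqVneq S0 (o, i, i, o); rewrite xS eqxx in xS0.
  split; last by exists (x (o, i, i, o)); coords; ring.
  apply: (mulIf x12); apply: subr0_eq.
  by row (rowG false true) (o,i,o,o) 0%ZZ 0%ZZ; rewrite (x0 (o, i, o, i)) //; by_eq.
- have x03 : x (i, o, o, i) = 0 by move: E02; by_eq.
  have [L0 | Lgt0] := posnP Lam.
    have x12 : x (o, i, i, o) = 0 by out.
    have x13 : x (o, i, o, i) = - x (i, o, i, o).
      by apply: subr0_eq; move: E12; rewrite x12; by_eq.
    have x_0 : x (o, o, o, o) = d * x (i, o, i, o).
      by apply: subr0_eq; row (rowG false true) (i,o,o,o) 0%ZZ 0%ZZ; rewrite x03 L0; by_eq.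
    have d02 : (d + 2) * x (i, o, i, o) = 0.
      row (rowG true false) (o,o,i,o) 0%ZZ 0%ZZ; rewrite x12 x13 x_0 L0 => e.
      by apply: (mulfI two0); rewrite mulr0; move: e; by_eq.
    have d01 : (d + 2) * x (i, i, o, o) = 0.
      by row (rowG true false) (o,i,o,o) 0%ZZ 0%ZZ; rewrite L0; by_eq.
    have d23 : (d + 2) * x (o, o, i, i) = 0.
      by row (rowG true true) (o,o,i,o) 0%ZZ 0%ZZ; rewrite L0; by_eq.
    have dE : d = - 2.
      have [/eqP|d2] := eqVneq (d + 2) 0; first by rewrite addr_eq0 => /eqP.
      exfalso; case/eqP: xS0; have x02 := cancel_coeff d02 d2.
      have x01 := cancel_coeff d01 d2; have x23 := cancel_coeff d23 d2.
      rewrite x02 ?mulr0 ?oppr0 in x13 x_0.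
      by case: (S0) => [[[[] []] []] []] //; out.
    constructor 3; do 3 (split; first by [lia | ]).
    exists (x (i, i, o, o)), (x (o, o, i, i)), (x (i, o, i, o)).
    by coords; rewrite ?x_0 ?x13 ?x12 ?x03 ?dE; ring.
  have L0 : L != 0 by rewrite pnatr_eq0 -lt0n.
  exfalso; case/eqP: xS0.
  have x_0 : x (o, o, o, o) = 0 by apply: cancel_coeff L0; move: H_0; by_eq.
  have x01 : x (i, i, o, o) = 0.
    apply: cancel_coeff (mulf_neq0 two0 L0).
    by row (rowG false false) (o,i,o,o) 0%ZZ 1%ZZ; by_eq.
  have x23 : x (o, o, i, i) = 0.
    apply: cancel_coeff (mulf_neq0 two0 L0).
    by row (rowG false true) (o,o,i,o) 0%ZZ 1%ZZ; by_eq.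
  have x02a : (L - d) * x (i, o, i, o) = 0.
    by row (rowG false true) (i,o,o,o) 0%ZZ 0%ZZ; rewrite x_0 x03; by_eq.
  have x02b : (L + 4 + d) * x (i, o, i, o) = 0.
    row (rowG true false) (o,o,i,o) 0%ZZ 0%ZZ; rewrite x_0 => e.
    by apply: (etrans _ (etrans (congr2 (fun a b => a + 2 * b) e E12) _)); ring.
  have L2 : L + 2 != 0 by rewrite -natrD pnatr_eq0 addn2.
  have x02 : x (i, o, i, o) = 0.
    apply: cancel_coeff (mulf_neq0 two0 L2).
    by apply: (etrans _ (etrans (congr2 +%R x02a x02b) _)); ring.
  have x13 : x (o, i, o, i) = - x (o, i, i, o).
    by apply: subr0_eq; move: E12; rewrite x02; by_eq.
  have x12 : x (o, i, i, o) = 0.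
    apply: cancel_coeff (mulf_neq0 two0 L0).
    have e1 : (L + d + 2) * x (o, i, i, o) = 0.
      by row (rowG true true) (o,i,o,o) 0%ZZ 0%ZZ; rewrite x_0 x13; by_eq.
    have e2 : (L - 2 - d) * x (o, i, i, o) = 0.
      by row (rowG false false) (o,o,i,o) 0%ZZ 1%ZZ; rewrite x02; by_eq.
    by apply: (etrans _ (etrans (congr2 +%R e1 e2) _)); ring.
  rewrite x12 oppr0 in x13.
  by case: (S0) => [[[[] []] []] []] //; out.
- have x_0 : x (o, o, o, o) = 0 by move: E_0; by_eq.
  have x01 : x (i, i, o, o) = 0 by move: E01; by_eq.
  have x23 : x (o, o, i, i) = 0 by move: E23; by_eq.
  have x02 : x (i, o, i, o) = - x (i, o, o, i) by apply: subr0_eq; move: E02; by_eq.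
  have x13 : x (o, i, o, i) = - x (i, o, o, i) by apply: subr0_eq; move: E13; by_eq.
  have x12 : x (o, i, i, o) = x (i, o, o, i).
    apply: (mulfI two0); apply: subr0_eq; move: E12; rewrite x02 x13; by_eq.
  have x03 : x (i, o, o, i) != 0.
    apply: contraNneq xS0 => x03; apply/eqP; rewrite x03 ?oppr0 in x02 x13 x12.
    by case: (S0) => [[[[] []] []] []] //; out.
  have L2 : (2 <= Lam)%N.
    rewrite leqNgt; apply: contra x03 => L2; rewrite -x12; apply/eqP.
    by have := ssrnat.leP L2 => ?; out.
  constructor 2; split; first lia; split.
    apply: (mulIf x03); apply: subr0_eq.
    by row (rowG true true) (i,o,o,o) 0%ZZ 0%ZZ; rewrite x02; by_eq.
  (* a_11 has the coefficient - (Lambda - 1) Lambda at this state. *)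
  split=> //; exists (- x (i, o, o, i) / ((L - 1) * L)).
  have L0 : L != 0 by rewrite pnatr_eq0 -lt0n (leq_trans _ L2).
  have L1 : L - 1 != 0 by rewrite subr_eq0 (eqr_nat _ _ 1) neq_ltn L2 orbT.
  have ff2 : (Lam ^_ 2)%:R = L * (L - 1) :> K.
    by rewrite ffactnS ffactn1 natrM -subn1 natrB // (leq_trans _ L2).
  coords; rewrite ?x_0 ?x01 ?x23 ?x02 ?x13 ?x12 ?ff2; field; by rewrite ?L0 ?L1.
Qed.

(** The products of three letters behave as single letters for E_0, which leaves two
    weights; the diagonal equation bounds Lambda, and G_(1/2) fixes Delta. *)
Lemma degree3 p : N = 3%ZZ -> J = (2 * p - 1)%ZZ -> (exists S, x S != 0) ->
  (J = (-1)%ZZ /\ Lam = 0%N /\ d = - 2 /\ exists al be, forall S, x S = comb_coords Lam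
     (fam1312 al be) S) \/
  (J = 1%ZZ /\ Lam = 1%N /\ d = - 3 /\ exists al be, forall S, x S = comb_coords Lam
     (fam1415 Lam al be) S).
Proof.
move=> N3 Jp [S0 xS0].
have x0E : x (i, o, o, o) = - zr K p * x (o, i, o, o).
  by apply: subr0_eq; row rowE (o,i,o,o) 1%ZZ (p - 1)%ZZ; by_eq.
have x3E : x (o, o, o, i) = - zr K p * x (o, o, i, o).
  by apply: subr0_eq; row rowE (o,o,i,o) 1%ZZ (p - 1)%ZZ; by_eq.
have x013E : x (i, i, o, i) = - zr K p * x (i, i, i, o).
  by apply: subr0_eq; row rowE (i,i,i,o) 0%ZZ (p - 1)%ZZ; by_eq.
have x023E : x (i, o, i, i) = - zr K p * x (o, i, i, i).
  by apply: subr0_eq; row rowE (o,i,i,i) 0%ZZ (p - 1)%ZZ; by_eq.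
have all0 : x (o, i, o, o) = 0 -> x (o, o, i, o) = 0 -> x (i, i, i, o) = 0 ->
    x (o, i, i, i) = 0 -> False.
  move=> x1 x2 x012 x123; case/eqP: xS0; rewrite x1 mulr0 in x0E; rewrite x2 mulr0 in x3E.
  rewrite x012 mulr0 in x013E; rewrite x123 mulr0 in x023E.
  by case: (S0) => [[[[] []] []] []] //; out.
have p01 : p = 0%ZZ \/ p = 1%ZZ.
  have [// | [/zr_neq0 p0 /zr_neq0]] : ((p = 0 \/ p = 1) \/ (p <> 0 /\ p - 1 <> 0))%ZZ by lia.
  rewrite zrB zr_num => p1; exfalso; have pp := mulf_neq0 p1 p0.
  apply: all0; apply: cancel_coeff pp.
  - by row rowE (i,o,o,o) 1%ZZ (p - 2)%ZZ; rewrite x0E; by_eq.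
  - by row rowE (o,o,o,i) 1%ZZ (p - 2)%ZZ; rewrite x3E; by_eq.
  - by row rowE (i,i,o,i) 0%ZZ (p - 2)%ZZ; rewrite x013E; by_eq.
  - by row rowE (i,o,i,i) 0%ZZ (p - 2)%ZZ; rewrite x023E; by_eq.
have two0 : 2 != 0 :> K by rewrite pnatr_eq0.
case: p01 => pE; rewrite pE in Jp; rewrite pE zr_num ?oppr0 ?mul0r ?mulN1r in x0E x3E x013E x023E.
- left.
  have x2 : x (o, o, i, o) = 0.
    have L1 : L + 1 != 0 by rewrite natr1 pnatr_eq0.
    by apply: cancel_coeff L1; row rowH (o,o,i,o) 0%ZZ 0%ZZ; by_eq.
  have [L0 | Lgt0] := posnP Lam; last first.
    have L0 : L != 0 by rewrite pnatr_eq0 -lt0n.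
    exfalso; apply: all0 => //.
    + by apply: cancel_coeff L0; row rowH (o,i,o,o) 0%ZZ 0%ZZ; by_eq.
    + apply: cancel_coeff (mulf_neq0 two0 L0).
      by row (rowG false false) (o,i,i,o) 0%ZZ 1%ZZ; by_eq.
    + apply: cancel_coeff (mulf_neq0 two0 L0).
      by row (rowG false true) (o,i,i,o) 0%ZZ 1%ZZ; by_eq.
  have d123 : (d + 2) * x (o, i, i, i) = 0.
    by row (rowG true true) (o,i,i,o) 0%ZZ 0%ZZ; rewrite x2 L0; by_eq.
  have d012 : (d + 2) * x (i, i, i, o) = 0.
    by row (rowG false false) (i,o,i,o) 0%ZZ 0%ZZ; rewrite L0; by_eq.
  have x1 : x (o, i, o, o) = - d * x (i, i, i, o).
    by apply: subr0_eq; row (rowG false true) (i,i,o,o) 0%ZZ 0%ZZ; rewrite x013E L0; by_eq.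
  have dE : d = - 2.
    have [/eqP|d2] := eqVneq (d + 2) 0; first by rewrite addr_eq0 => /eqP.
    exfalso; have x012 := cancel_coeff d012 d2; apply: all0 => //.
      by rewrite x1 x012 mulr0.
    exact: cancel_coeff d123 d2.
  do 3 (split; first by [lia | ]).
  exists (x (o, i, i, i)), (x (i, i, i, o)).
  by coords; rewrite ?x0E ?x3E ?x013E ?x023E ?x2 ?x1 ?dE; ring.
- right.
  have [L0 | Lgt0] := posnP Lam.
    by exfalso; apply: all0; out.
  have L0 : L != 0 by rewrite pnatr_eq0 -lt0n.
  have x1 : x (o, i, o, o) = 0.
    by apply: cancel_coeff L0; row rowH (i,o,o,o) 0%ZZ 0%ZZ; rewrite x0E; by_eq.
  rewrite x1 oppr0 in x0E.
  have L012 : (L - 1) * x (i, i, i, o) = 0.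
    apply: (mulfI two0); rewrite mulr0.
    by row (rowG false false) (o,i,i,o) 0%ZZ 2%ZZ; by_eq.
  have L123 : (L - 1) * x (o, i, i, i) = 0.
    apply: (mulfI two0); rewrite mulr0.
    by row (rowG false true) (o,i,i,o) 0%ZZ 2%ZZ; by_eq.
  have L2 : (L - 1) * x (o, o, i, o) = 0.
    by row rowH (o,o,i,o) 0%ZZ 1%ZZ; by_eq.
  have L1 : Lam = 1%N.
    have [/eqP|l1] := eqVneq (L - 1) 0; first by rewrite subr_eq0 (eqr_nat _ _ 1) => /eqP.
    exfalso; apply: all0 => //; exact: cancel_coeff l1.
  have x2 : x (o, o, i, o) = - 2 * x (o, i, i, i).
    by apply: subr0_eq; row (rowG false true) (i,o,i,o) 0%ZZ 1%ZZ; rewrite x023E L1; by_eq.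
  have d123 : (d + 3) * x (o, i, i, i) = 0.
    by row (rowG true true) (i,o,i,o) 0%ZZ 0%ZZ; rewrite x023E L1; by_eq.
  have d012 : (d + 3) * x (i, i, i, o) = 0.
    by row (rowG true false) (o,i,i,o) 0%ZZ 1%ZZ; rewrite x1 L1; by_eq.
  have dE : d = - 3.
    have [/eqP|d3] := eqVneq (d + 3) 0; first by rewrite addr_eq0 => /eqP.
    exfalso; have x123 := cancel_coeff d123 d3; apply: all0 => //.
      by rewrite x2 x123 mulr0.
    exact: cancel_coeff d012 d3.
  split; first lia; split=> //; split=> //.
  exists (x (i, i, i, o)), (x (o, i, i, i)); rewrite L1.
  by coords; rewrite ?x0E ?x3E ?x013E ?x023E ?x1 ?x2; ring.
Qed.

End Solve.

(** * The listed vectors are singular *)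
Section Converse.
Variables (K : numFieldType) (Delta : K) (Lam : nat).
Local Notation L := (Lam%:R : K).
Local Notation d := (2 * Delta).
Local Notation indM := (indM Delta Lam).
Local Notation X x := (env_inj (sk_gen K x)).
Local Notation Phi := (@Phi K Delta Lam).
Local Notation comb := (@comb K Delta Lam).
Local Notation comb_coords := (@comb_coords K Lam).
Local Notation kills := (kills Delta Lam).
Local Notation coeffs := (coeffs Delta Lam).
Implicit Types (w z : indM).

Lemma Phi_eq_ge0 w z : (forall S k j, (0 <= k)%ZZ -> Phi w S k j = Phi z S k j) -> w = z.
Proof.
move=> wz; apply: Phi_eq; apply: model_ext => S k j.
have [k0 | k0] := Z_le_gt_dec 0 k; first exact: wz.
have out u : Phi u S k j = 0.
  by apply/eqP/negPn/negP => /Phi_support[k_ge0 _]; lia.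
by rewrite !out.
Qed.

Lemma kills_annihilates x A w :
  op_eq (at_mode (lin_cst (Z.of_nat (mode x))) (current_op (kind x))) A ->
  kills A (Phi w) -> annihilates w x.
Proof.
move=> xA kA; apply: Phi_inj; rewrite Phi_gen.
exact/(@rho_killsP K Delta Lam x A _ xA).
Qed.

Lemma comb_coords_point N J (l : combination K) S : comb_deg N J l -> comb_coords l S != 0 ->
  exists k j, [/\ (2 * k + deg S = N)%ZZ, (2 * j - wt S = J)%ZZ & (0 <= k)%ZZ].
Proof.
elim: l => [|[[[c k] s] j] l IHl] /=; first by rewrite eqxx.
case/andP=> /andP[/Z.eqb_spec EN /Z.eqb_spec EJ] /IHl{}IHl.
rewrite /at_state; case: (eqVneq S s) => [-> _ | _]; last by rewrite !mulr0 add0r.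
by exists (Z.of_nat k), (Z.of_nat j); split=> //; lia.
Qed.

Lemma positive_elements w : (forall x, 0 < sk_index x -> annihilates w x) ->
  forall (j : rat) (a : {malg K[sk_basis]}), 0 < j -> sk_homog j a -> env_inj a *: w = 0.
Proof.
move=> wx j a j0 ha; rewrite env_injE scaler_suml big_seq big1 // => b /ha bj.
by rewrite cscale_alg wx ?bj ?cscale0r.
Qed.

(** A combination of basis vectors of the same degree and weight is a weight vector,
    and it is not a multiple of v when its degree is nonzero. *)
Lemma homogeneous_singular N J l : comb_deg N J l -> (N <> 0)%ZZ ->
    (exists S, comb_coords l S != 0) ->
    kills E0 (graded N J (comb_coords l)) -> kills (X1 slF) (graded N J (comb_coords l)) ->
    (forall b, kills (G1 false b) (graded N J (comb_coords l))) ->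
  proper_singular (comb l).
Proof.
move=> lNJ N0 [S xS] kE kF kG; have cl := @coords_comb K Delta Lam N J l lNJ.
have [k [j [Nk Jj k0]]] := comb_coords_point lNJ xS.
have lS : Phi (comb l) S k j != 0.
  by rewrite cl /graded -Nk -Jj !Z.eqb_refl.
rewrite -cl in kE kF kG.
have E0w : annihilates (comb l) (bX slE 0) by apply: (kills_annihilates _ kE); vm_compute.
split; last first.
  case=> c lc; move: lS; rewrite lc Phi_cscale (_ : hwv Delta Lam = bas Delta Lam 0 empty 0) // Phi_bas.
  rewrite /scale /point; case: (eqVneq S empty) => [S0 | _]; last by rewrite !mulr0 eqxx.
  case: (Z.eqb_spec k) => [kE0 | _]; last by rewrite !mulr0 eqxx.
  by case: N0; rewrite -Nk S0 kE0.
split.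
- split; first by apply: contraNneq lS => ->; rewrite Phi0.
  exists (2^-1 * (zr K N + d)), (L - zr K J).
  have eig x c : (forall S k j, (0 <= k)%ZZ ->
      rho Delta Lam x (Phi (comb l)) S k j = c * Phi (comb l) S k j) ->
      X x *: comb l = cscale c (comb l).
    by move=> xc; apply: Phi_eq_ge0 => T k' j' k'0; rewrite Phi_gen Phi_cscale xc.
  split; [apply: (eig (bL 1)) | apply: (eig (bX slH 0))] => T k' j' k'0.
    rewrite rho_grade // cl /graded -mulrA; case: Z.eqb_spec => [-> | _] //=.
    by rewrite !mulr0.
  rewrite rho_weight // cl /graded; case: Z.eqb_spec => _ /=; last by rewrite !mulr0.
  by case: Z.eqb_spec => [-> | _]; rewrite ?mulr0.
- exact: E0w.
- apply: positive_elements; apply: positive_annihilates => //.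
  + by apply: (kills_annihilates _ kF); vm_compute.
  + by apply: (kills_annihilates _ (kG true)); vm_compute.
  + by apply: (kills_annihilates _ (kG false)); vm_compute.
Qed.

(** A form of kills_gradedP in which k and j are computed from S, for numerical N and
    J. *)
Lemma kills_graded A dN dJ N J x : has_degree A dN dJ ->
  (forall S, let k := ((N + dN - deg S) / 2)%ZZ in let j := ((J + dJ + wt S) / 2)%ZZ in
     [&& (0 <=? k)%ZZ, (2 * k + deg S =? N + dN)%ZZ & (2 * j - wt S =? J + dJ)%ZZ] ->
     coeffs A x S k j = 0) ->
  kills A (graded N J x).
Proof.
move=> dA cA; apply/(kills_gradedP _ _ _ _ _ dA) => S k j k0 Nk Jj.
have kE : ((N + dN - deg S) / 2 = k)%ZZ.
  by rewrite (_ : N + dN - deg S = k * 2)%ZZ ?Z.div_mul //; lia.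
have jE : ((J + dJ + wt S) / 2 = j)%ZZ.
  by rewrite (_ : J + dJ + wt S = j * 2)%ZZ ?Z.div_mul //; lia.
have := cA S; rewrite kE jE; apply.
by apply/and3P; split; [apply/Z.leb_spec0 | apply/Z.eqb_spec | apply/Z.eqb_spec].
Qed.

Lemma ffact2 : (Lam ^_ 2)%:R = L * (L - 1) :> K.
Proof.
have [->|L0] := posnP Lam; first by rewrite mul0r.
by rewrite ffactnS ffactn1 natrM -subn1 natrB.
Qed.

End Converse.

(* Reduces the killing of a graded function to its equations, discarding the states
   for which k or j is out of range. *)
Ltac equations dN dJ :=
  apply: (@kills_graded _ _ _ _ dN dJ); [by vm_compute | case=> [[[[] []] []] []]; cbv zeta];
  match goal with |- is_true ?b -> coeffs _ _ _ _ _ ?k ?j = 0 =>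
    let b' := eval vm_compute in b in
    let k' := eval vm_compute in k in
    let j' := eval vm_compute in j in
    change k with k'; change j with j'; change (is_true b' -> ?Q) with (is_true b' -> Q)
  end; first [by [] | move=> _];
  rewrite /coeffs;
  match goal with |- context [foldr _ _ (?A ?S)] =>
    let l := eval vm_compute in (A S) in change (A S) with l end;
  cbn [foldr ev valuation coef src]; rewrite ?(zrD, zrB, zrN) ?zr_num.

Ltac expand :=
  rewrite /fam8 /fam11 /fam16 /fam23 /fam45 /fam1415 /fam1312 /fam679 /c1 /c2 /c3 /c4 /c5 /c6 /c7
    /c8 /c9 /c10 /c11 /c12 /c13 /c14 /c15 /c16 /scale_comb /shift_comb
    /comb_coords /at_state /= ?(fact0, factS, ffactn0, ffactn1, mul1n, muln1) ?ffact2.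

Ltac singular_family N J dE :=
  apply: (@homogeneous_singular _ _ _ N J);
  [ by [] | by [] | expand
  | equations 0%ZZ (-2)%ZZ; expand; rewrite ?dE; ring
  | equations (-2)%ZZ 2%ZZ; expand; rewrite ?dE; ring
  | case; equations (-1)%ZZ 1%ZZ; expand; rewrite ?dE; ring ].

(* The scalar at S is nonzero because of h, up to sign. *)
Ltac witness S h :=
  let h0 := fresh "h" in exists S; expand; apply: contraNneq h => h0; apply/eqP;
  first [ apply: (etrans _ h0); ring | apply: (etrans _ (etrans (congr1 -%R h0) (oppr0 _))); ring ].

Section Families.
Variables (K : numFieldType) (Delta : K) (Lam : nat).
Local Notation L := (Lam%:R : K).
Local Notation d := (2 * Delta).
Local Notation indM := (indM Delta Lam).
Local Notation comb := (@comb K Delta Lam).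
Local Notation o := false.
Local Notation i := true.
Implicit Types (w z : indM).

Lemma fam23_singular (al be : K) : d = L -> (al, be) != (0, 0) ->
  proper_singular (comb (fam23 al be)).
Proof.
rewrite xpair_eqE negb_and => dE ab0; singular_family 1%ZZ (-1)%ZZ dE.
by case/orP: ab0 => ab0; [witness (o, i, o, o) ab0 | witness (o, o, i, o) ab0].
Qed.

Lemma fam45_singular (al be : K) : d = - L - 2 -> (1 <= Lam)%N -> (al, be) != (0, 0) ->
  proper_singular (comb (fam45 Lam al be)).
Proof.
rewrite xpair_eqE negb_and => dE L1 ab0; singular_family 1%ZZ 1%ZZ dE.
have L0 : L != 0 by rewrite pnatr_eq0 -lt0n.
case/orP: ab0 => ab0; [witness (i, o, o, o) (mulf_neq0 L0 ab0)
  | witness (o, o, o, i) (mulf_neq0 L0 ab0)].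
Qed.

Lemma fam8_singular (al : K) : d = L -> al != 0 -> proper_singular (comb (fam8 al)).
Proof. by move=> dE a0; singular_family 2%ZZ (-2)%ZZ dE; witness (o, i, i, o) a0. Qed.

Lemma fam11_singular (al : K) : d = - L - 2 -> (2 <= Lam)%N -> al != 0 ->
  proper_singular (comb (fam11 Lam al)).
Proof.
move=> dE L2 a0; singular_family 2%ZZ 2%ZZ dE.
have L0 : L != 0 by rewrite pnatr_eq0 -lt0n (leq_trans _ L2).
have L1 : L - 1 != 0 by rewrite subr_eq0 (eqr_nat _ _ 1) neq_ltn L2 orbT.
witness (i, o, o, i) (mulf_neq0 (mulf_neq0 L0 L1) a0).
Qed.

End Families.

Section SmallWeights.
Variables (K : numFieldType) (Delta : K).
Local Notation d := (2 * Delta).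
Local Notation o := false.
Local Notation i := true.

Lemma fam1415_singular (al be : K) : d = - 3 -> (al, be) != (0, 0) ->
  proper_singular (@comb K Delta 1 (fam1415 1 al be)).
Proof.
rewrite xpair_eqE negb_and => dE ab0; singular_family 3%ZZ 1%ZZ dE.
by case/orP: ab0 => ab0; [witness (i, i, i, o) ab0 | witness (o, i, i, i) ab0].
Qed.

Lemma fam16_singular (al : K) : d = - 3 -> al != 0 -> proper_singular (@comb K Delta 1 (fam16 1 al)).
Proof. by move=> dE a0; singular_family 4%ZZ 0%ZZ dE; witness (i, i, i, i) a0. Qed.

Lemma fam679_singular (al be ga : K) : d = - 2 -> (al, be, ga) != (0, 0, 0) ->
  proper_singular (@comb K Delta 0 (fam679 al be ga)).
Proof.
rewrite !xpair_eqE !negb_and => dE ab0; singular_family 2%ZZ 0%ZZ dE.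
case/orP: ab0 => [/orP[]|] ab0;
  [witness (i, i, o, o) ab0 | witness (o, o, i, i) ab0 | witness (i, o, i, o) ab0].
Qed.

Lemma fam1312_singular (al be : K) : d = - 2 -> (al, be) != (0, 0) ->
  proper_singular (@comb K Delta 0 (fam1312 al be)).
Proof.
rewrite xpair_eqE negb_and => dE ab0; singular_family 3%ZZ (-1)%ZZ dE.
by case/orP: ab0 => ab0; [witness (o, i, i, i) ab0 | witness (i, i, i, o) ab0].
Qed.

End SmallWeights.

(** * The classification *)
Section Classification.
Variables (K : numFieldType) (Delta : K) (Lam : nat).
Local Notation L := (Lam%:R : K).
Local Notation d := (2 * Delta).
Local Notation comb := (@comb K Delta Lam).
Implicit Types w : indM Delta Lam.

Lemma comb_unique N J x w (l : combination K) : has_coords N J x w -> comb_deg N J l ->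
  (forall S, x S = comb_coords Lam l S) -> w = comb l.
Proof.
move=> wx lNJ xl; apply: Phi_eq; rewrite wx (@coords_comb K Delta Lam _ _ _ lNJ).
by congr graded; apply: funext.
Qed.

(** The parameters of a family cannot all vanish because w is nonzero; the case N = 0
    is the one excluded by properness. *)
Lemma classification w : proper_singular w <->
  [\/ d - L = 0 /\
      ((exists alpha beta : K, (alpha, beta) != (0, 0) /\
          w = cscale alpha (a2 Delta Lam) + cscale beta (a3 Delta Lam)) \/
       (exists alpha : K, alpha != 0 /\ w = cscale alpha (a8 Delta Lam))),
      d + L + 2 = 0 /\ (2 <= Lam)%N /\
      ((exists alpha beta : K, (alpha, beta) != (0, 0) /\
          w = cscale alpha (a4 Delta Lam) + cscale beta (a5 Delta Lam)) \/
       (exists alpha : K, alpha != 0 /\ w = cscale alpha (a11 Delta Lam))),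
      d + L + 2 = 0 /\ Lam = 1%N /\
      [\/ exists alpha beta : K, (alpha, beta) != (0, 0) /\
            w = cscale alpha (a4 Delta Lam) + cscale beta (a5 Delta Lam),
          exists alpha beta : K, (alpha, beta) != (0, 0) /\
            w = cscale alpha (a14 Delta Lam)
                + cscale beta (a15 Delta Lam - (2 * partial K) *: a5 Delta Lam) |
          exists alpha : K, alpha != 0 /\
            w = cscale alpha (a16 Delta Lam - (2 * partial K) *: a10 Delta Lam)] |
      d + L + 2 = 0 /\ Lam = 0%N /\
      ((exists alpha beta gamma : K, (alpha, beta, gamma) != (0, 0, 0) /\
          w = cscale alpha (a6 Delta Lam) + cscale beta (a7 Delta Lam)
              + cscale gamma (a9 Delta Lam - (2 * partial K) *: a1 Delta Lam)) \/
       (exists alpha beta : K, (alpha, beta) != (0, 0) /\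
          w = cscale alpha (a13 Delta Lam)
              + cscale beta (a12 Delta Lam + (2 * partial K) *: a2 Delta Lam)))].
Proof.
split=> [[ws np] | ].
  have [ww E0w pos] := ws; have [w0 _] := ww.
  have [N [J [x [wx sx x0]]]] := weight_graded ww.
  have [kE kG kX] := singular_kills ws; have kH := kills_DH kG kX.
  rewrite wx in kE kG kH.
  have w1 := comb_unique wx.
  have nz1 (al : K) z : w = cscale al z -> al != 0.
    by move=> wE; apply: contraNneq w0 => al0; rewrite wE al0 cscale0l.
  have nz2 (al be : K) z1 z2 : w = cscale al z1 + cscale be z2 -> (al, be) != (0, 0).
    by move=> wE; apply: contraNneq w0 => -[a0 b0]; rewrite wE a0 b0 !cscale0l addr0.
  have nz3 (al be ga : K) z1 z2 z3 : w = cscale al z1 + cscale be z2 + cscale ga z3 ->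
      (al, be, ga) != (0, 0, 0).
    by move=> wE; apply: contraNneq w0 => -[a0 b0 c0]; rewrite wE a0 b0 c0 !cscale0l !addr0.
  have [NJ N0] : (exists m q, (N = 2 * m /\ J = 2 * q) \/ (N = 2 * m + 1 /\ J = 2 * q - 1))%ZZ /\
      (0 <= N)%ZZ.
    have [S /sx[k [j [Nk Jj k0 j0]]]] := x0; split; last first.
      by move: Nk; case: (S) => [[[[] []] []] []]; cbn [deg bz]; lia.
    exists (N / 2)%ZZ, ((J + 1) / 2)%ZZ.
    have := Z.div_mod N 2; have := Z.mod_pos_bound N 2.
    have := Z.div_mod (J + 1) 2; have := Z.mod_pos_bound (J + 1) 2.
    by move: Nk Jj; case: (S) => [[[[] []] []] []]; cbn [deg wt bz]; lia.
  have [m [q [[Nm Jq] | [Nm Jq]]]] := NJ.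
  - have [m0 | [m1 | m2]] : (m = 0 \/ m = 1 \/ 2 <= m)%ZZ by lia.
    + have N00 : N = 0%ZZ by lia.
      have [J0 [al xal]] := degree0 sx kE N00 Jq x0; exfalso; apply: np; exists al.
      rewrite -[hwv _ _]/(a1 Delta Lam) a1E -comb_scale.
      by apply: w1 => //; rewrite N00 J0.
    + have N2 : N = 2%ZZ by lia.
      have [[JE [dE [al xal]]] | [JE [dE [L2 [al xal]]]] | [JE [L0 [dE [al [be [ga xal]]]]]]] :=
        degree2 sx kE kG kH N2 Jq x0.
      * have wE : w = comb (fam8 al) by apply: w1 => //; rewrite N2 JE.
        rewrite fam8E in wE; constructor 1; rewrite dE subrr; split=> //; right.
        by exists al; split=> //; apply: nz1 wE.
      * have wE : w = comb (fam11 Lam al) by apply: w1 => //; rewrite N2 JE.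
        rewrite fam11E in wE; constructor 2; split; first by rewrite dE; ring.
        by split=> //; right; exists al; split=> //; apply: nz1 wE.
      * have wE : w = comb (fam679 al be ga) by apply: w1 => //; rewrite N2 JE.
        rewrite fam679E in wE; constructor 4; split; first by rewrite dE L0; ring.
        by split=> //; left; exists al, be, ga; split=> //; apply: nz3 wE.
    + have [N4 J0 L1 dE [al xal]] := even_large sx kE kG kH Nm Jq m2 x0.
      have wE : w = comb (fam16 Lam al) by apply: w1 => //; rewrite N4 J0.
      rewrite fam16E in wE; constructor 3; split; first by rewrite dE L1; ring.
      by split=> //; constructor 3; exists al; split=> //; apply: nz1 wE.
  - have [m0 | [m1 | m2]] : (m = 0 \/ m = 1 \/ 2 <= m)%ZZ by lia.
    + have N1 : N = 1%ZZ by lia.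
      have [[JE [dE [al [be xal]]]] | [JE [dE [L1 [al [be xal]]]]]] := degree1 sx kE kG N1 Jq x0.
      * have wE : w = comb (fam23 al be) by apply: w1 => //; rewrite N1 JE.
        rewrite fam23E in wE; constructor 1; rewrite dE subrr; split=> //; left.
        by exists al, be; split=> //; apply: nz2 wE.
      * have wE : w = comb (fam45 Lam al be) by apply: w1 => //; rewrite N1 JE.
        rewrite fam45E in wE.
        have dL : d + L + 2 = 0 by rewrite dE; ring.
        have ab0 := nz2 _ _ _ _ wE.
        move: L1; rewrite leq_eqVlt => /orP[/eqP L1 | L2].
          by constructor 3; do 2 split=> //; constructor 1; exists al, be.
        by constructor 2; do 2 split=> //; left; exists al, be.
    + have N3 : N = 3%ZZ by lia.
      have [[JE [L0 [dE [al [be xal]]]]] | [JE [L1 [dE [al [be xal]]]]]] :=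
        degree3 sx kE kG kH N3 Jq x0.
      * have wE : w = comb (fam1312 al be) by apply: w1 => //; rewrite N3 JE.
        rewrite fam1312E in wE; constructor 4; split; first by rewrite dE L0; ring.
        by split=> //; right; exists al, be; split=> //; apply: nz2 wE.
      * have wE : w = comb (fam1415 Lam al be) by apply: w1 => //; rewrite N3 JE.
        rewrite fam1415E in wE; constructor 3; split; first by rewrite dE L1; ring.
        by split=> //; constructor 2; exists al, be; split=> //; apply: nz2 wE.
    + have [S xS] := x0; exfalso; move: xS; rewrite (odd_large sx kG Nm Jq m2) eqxx //.
have dLE : d + L + 2 = 0 -> d = - L - 2 by move=> e; apply: subr0_eq; rewrite -[RHS]e; ring.
case=> [[/eqP + []] | [/dLE dE [L2 []]] | [/dLE dE [L1 []]] | [/dLE dE [L0 []]]].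
- rewrite subr_eq0 => /eqP dE [al [be [ab0 ->]]]; rewrite -fam23E; exact: fam23_singular.
- by rewrite subr_eq0 => /eqP dE [al [a0 ->]]; rewrite -fam8E; apply: fam8_singular.
- by case=> al [be [ab0 ->]]; rewrite -fam45E; apply: fam45_singular => //; apply: ltnW.
- by case=> al [a0 ->]; rewrite -fam11E; apply: fam11_singular.
- by case=> al [be [ab0 ->]]; rewrite -fam45E; apply: fam45_singular => //; rewrite L1.
- case=> al [be [ab0 ->]]; rewrite -fam1415E; subst Lam; apply: fam1415_singular => //.
  by rewrite dE; ring.
- case=> al [a0 ->]; rewrite -fam16E; subst Lam; apply: fam16_singular => //.
  by rewrite dE; ring.
- case=> al [be [ga [ab0 ->]]]; rewrite -fam679E; subst Lam; apply: fam679_singular => //.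
  by rewrite dE; ring.
- case=> al [be [ab0 ->]]; rewrite -fam1312E; subst Lam; apply: fam1312_singular => //.
  by rewrite dE; ring.
Qed.

End Classification.

Theorem proposition6p1 (R : realType) (Delta : R[i]) (Lambda : nat)
    (w : indM Delta Lambda) :
  let a1 := a1 Delta Lambda in let a2 := a2 Delta Lambda in
  let a3 := a3 Delta Lambda in let a4 := a4 Delta Lambda in
  let a5 := a5 Delta Lambda in let a6 := a6 Delta Lambda in
  let a7 := a7 Delta Lambda in let a8 := a8 Delta Lambda in
  let a9 := a9 Delta Lambda in let a10 := a10 Delta Lambda in
  let a11 := a11 Delta Lambda in let a12 := a12 Delta Lambda in
  let a13 := a13 Delta Lambda in let a14 := a14 Delta Lambda in
  let a15 := a15 Delta Lambda in let a16 := a16 Delta Lambda in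
  let d := partial R[i] in
  proper_singular w <->
  [\/ 2 * Delta - Lambda%:R = 0 /\
      ((exists alpha beta : R[i], (alpha, beta) != (0, 0) /\
          w = cscale alpha a2 + cscale beta a3) \/
       (exists alpha : R[i], alpha != 0 /\ w = cscale alpha a8)),
      2 * Delta + Lambda%:R + 2 = 0 /\ (2 <= Lambda)%N /\
      ((exists alpha beta : R[i], (alpha, beta) != (0, 0) /\
          w = cscale alpha a4 + cscale beta a5) \/
       (exists alpha : R[i], alpha != 0 /\ w = cscale alpha a11)),
      2 * Delta + Lambda%:R + 2 = 0 /\ Lambda = 1%N /\
      [\/ exists alpha beta : R[i], (alpha, beta) != (0, 0) /\
            w = cscale alpha a4 + cscale beta a5,
          exists alpha beta : R[i], (alpha, beta) != (0, 0) /\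
            w = cscale alpha a14 + cscale beta (a15 - (2 * d) *: a5) |
          exists alpha : R[i], alpha != 0 /\
            w = cscale alpha (a16 - (2 * d) *: a10)] |
      2 * Delta + Lambda%:R + 2 = 0 /\ Lambda = 0%N /\
      ((exists alpha beta gamma : R[i], (alpha, beta, gamma) != (0, 0, 0) /\
          w = cscale alpha a6 + cscale beta a7
              + cscale gamma (a9 - (2 * d) *: a1)) \/
       (exists alpha beta : R[i], (alpha, beta) != (0, 0) /\
          w = cscale alpha a13 + cscale beta (a12 + (2 * d) *: a2)))].
Proof. by move=> *; exact: classification. Qed.
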